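(* Let $m\ge 3$ and let $\vec{\Phi}:\Sigma\rightarrow\mathbb{R}^m$ be a smooth immersion of an oriented surface $\Sigma$. Define $$ \vec{\mathcal{W}}\;:=\;\Delta_\perp\vec{H}+\big(\vec{h}^{i}_{j}\cdot\vec{H}\big)\vec{h}^{j}_{i}-2|\vec{H}|^2\vec{H}\:,\qquad \vec{T}^j\;:=\;\nabla^j\vec{H}-2\,\pi_{\vec{n}}\nabla^j\vec{H}+|\vec{H}|^2\nabla^j\vec{\Phi}\:. $$ Then the following three conservation laws (corresponding respectively, via Noether's theorem, to the invariance of the Willmore energy under translations, rotations, and dilations of $\mathbb{R}^m$) hold pointwise on $\Sigma$: $$ \left\{\begin{array}{rcl} \nabla_j\vec{T}^j&=&-\,\vec{\mathcal{W}}\\[1ex] \nabla_j\big(\vec{T}^j\wedge\vec{\Phi}+\vec{H}\wedge\nabla^j\vec{\Phi}\big)&=&-\,\vec{\mathcal{W}}\wedge\vec{\Phi}\\[1ex] \nabla_j\big(\vec{T}^j\cdot\vec{\Phi}\big)&=&-\,\vec{\mathcal{W}}\cdot\vec{\Phi}\:. \end{array}\right. $$ In particular, the immersion $\vec{\Phi}$ is Willmore if and only if $$ \nabla_j\big(\nabla^j\vec{H}-2\,\pi_{\vec{n}}\nabla^j\vec{H}+|\vec{H}|^2\nabla^j\vec{\Phi}\big)\;=\;\vec{0}\:. $$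
   Context: $\Sigma$ is equipped with the pull-back metric $g:=\vec{\Phi}^*g_{\mathbb{R}^m}$, with components $g_{ij}=\nabla_i\vec{\Phi}\cdot\nabla_j\vec{\Phi}$ in local coordinates. $\nabla_j$ is the covariant derivative (Levi-Civita connection) of $g$, acting componentwise on tensors with values in $\mathbb{R}^m$ or in $\Lambda^2(\mathbb{R}^m)$. Indices are raised and lowered with $g$, and Einstein's summation convention applies. The dot is the Euclidean scalar product of $\mathbb{R}^m$. The second fundamental form is the normal-valued symmetric 2-tensor with components $\vec{h}_{ij}:=\nabla_i\nabla_j\vec{\Phi}$, and the mean curvature vector is $\vec{H}:=\frac12 g^{ij}\vec{h}_{ij}$. At each point, $\pi_{\vec{n}}$ denotes the orthogonal projection of $\mathbb{R}^m$ onto the normal space of the immersion, that is, the orthogonal complement of $\mathrm{span}\{\nabla_1\vec{\Phi},\nabla_2\vec{\Phi}\}$. The normal Laplacian of a normal vector field $\vec{B}$ is $\Delta_\perp\vec{B}:=\pi_{\vec{n}}\nabla_j\big(\pi_{\vec{n}}\nabla^j\vec{B}\big)$. The Willmore energy is $\int_\Sigma|\vec{H}|^2\,d\mathrm{vol}_g$. The immersion $\vec{\Phi}$ is called Willmore if it is a critical point of the Willmore energy (under smooth compactly supported variations). It is a known fact that this is equivalent to the Euler-Lagrange equation $\vec{\mathcal{W}}=\vec{0}$. *)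

(* Defs.v *)
From HB Require Import structures.
From mathcomp Require Import all_boot all_order all_algebra.
From mathcomp Require Import all_classical all_reals all_analysis.

Set Implicit Arguments.
Unset Strict Implicit.
Unset Printing Implicit Defensive.
Import Order.TTheory GRing.Theory Num.Theory numFieldNormedType.Exports.

Local Open Scope classical_set_scope.
Local Open Scope ring_scope.

Section PlaneCalculus.
Context {R : realType}.

Definition basis2 (i : 'I_2) : R * R := ((i == 0)%:R, (i == 1)%:R).

Definition coord2 (x : R * R) (i : 'I_2) : R := if i == 0 then x.1 else x.2.

Definition pderiv {W : normedModType R} (i : 'I_2) (f : R * R -> W) :
  R * R -> W := fun x => 'D_(basis2 i) f x.

Definition pderivs {W : normedModType R} (s : seq 'I_2) (f : R * R -> W) :
  R * R -> W := foldr pderiv f s.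

(* C^oo on the open set U: all iterated partial derivatives exist and are
   continuous. The values of f outside U are irrelevant. *)
Definition smooth_on {W : normedModType R} (U : set (R * R))
    (f : R * R -> W) : Prop :=
  forall (s : seq 'I_2) (x : R * R), U x ->
    {for x, continuous (pderivs s f)} /\
    forall i, derivable (pderivs s f) x (basis2 i).

Definition jacobian (f : R * R -> R * R) (x : R * R) : R :=
  \det (\matrix_(i < 2, j < 2) coord2 (pderiv i f x) j).

Definition lebesgue2 :
  {measure set (measurableTypeR R * measurableTypeR R) -> \bar R} :=
  (@lebesgue_measure R \x @lebesgue_measure R)%E.

End PlaneCalculus.

Section Surfaces.
Variable R : realType.

(* [to_coord] and [of_coord] are mutually inverse homeomorphisms between the
   open sets [chart_dom] and [chart_cod]; outside of these sets their values
   are junk. *)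
Record chart (S : topologicalType) := Chart {
  chart_dom : set S;
  chart_cod : set (R * R);
  to_coord : S -> R * R;
  of_coord : R * R -> S;
  chart_dom_open : open chart_dom;
  chart_cod_open : open chart_cod;
  to_coord_cod : forall p, chart_dom p -> chart_cod (to_coord p);
  of_coord_dom : forall x, chart_cod x -> chart_dom (of_coord x);
  to_coordK : forall p, chart_dom p -> of_coord (to_coord p) = p;
  of_coordK : forall x, chart_cod x -> to_coord (of_coord x) = x;
  to_coord_continuous : {within chart_dom, continuous to_coord};
  of_coord_continuous : {within chart_cod, continuous of_coord} }.

Definition transition (S : topologicalType) (c d : chart S) :
  R * R -> R * R := to_coord d \o of_coord c.

Definition transition_dom (S : topologicalType) (c d : chart S) :
  set (R * R) := chart_cod c `&` of_coord c @^-1` chart_dom d.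

Record oriented_surface := OrientedSurface {
  points :> topologicalType;
  points_hausdorff : hausdorff_space points;
  points_second_countable : @second_countable points;
  atlas_index : Type;
  atlas : atlas_index -> chart points;
  atlas_cover : forall p, exists c, chart_dom (atlas c) p;
  transition_smooth : forall c d,
    smooth_on (transition_dom (atlas c) (atlas d))
              (transition (atlas c) (atlas d));
  transition_oriented : forall c d x,
    transition_dom (atlas c) (atlas d) x ->
    0 < jacobian (transition (atlas c) (atlas d)) x }.

Definition in_chart (S : oriented_surface) (W : Type) (c : atlas_index S)
  (f : S -> W) : R * R -> W := f \o of_coord (atlas c).

Definition smooth (S : oriented_surface) (W : normedModType R)
    (f : S -> W) : Prop :=
  forall c : atlas_index S, smooth_on (chart_cod (atlas c)) (in_chart c f).

End Surfaces.

Section EuclideanAlgebra.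
Context {R : realType} {m : nat}.

Definition dot (u v : 'rV[R]_m) : R := (u *m v^T) 0 0.

(* Lambda^2(R^m) is represented by skew-symmetric matrices,
   (u /\ v)_(a, b) = u_a v_b - u_b v_a. *)
Definition wedge (u v : 'rV[R]_m) : 'M[R]_m := u^T *m v - v^T *m u.

End EuclideanAlgebra.

(* Geometry of an immersion in local coordinates: F : R^2 -> R^m is the
   expression of the immersion in a chart. *)
Section LocalGeometry.
Context {R : realType} {m : nat}.
Variable F : R * R -> 'rV[R]_m.
Implicit Types (i j k l : 'I_2) (x : R * R).

Definition diff_mx x : 'M[R]_(2, m) := \matrix_(i < 2) pderiv i F x.

Definition metric_mx x : 'M[R]_2 :=
  \matrix_(i < 2, j < 2) dot (pderiv i F x) (pderiv j F x).

Definition metric i j x : R := metric_mx x i j.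

Definition cometric i j x : R := invmx (metric_mx x) i j.

Definition volume_density x : R := Num.sqrt (\det (metric_mx x)).

(* christoffel k i j is Gamma^k_(i j) *)
Definition christoffel k i j x : R :=
  2^-1 * \sum_(l < 2) cometric k l x *
    (pderiv i (metric j l) x + pderiv j (metric i l) x
     - pderiv l (metric i j) x).

(* nabla_i w_j for a W-valued covector field w *)
Definition nabla_covector {W : normedModType R} i (w : 'I_2 -> R * R -> W) j x
  : W := pderiv i (w j) x - \sum_(k < 2) christoffel k i j x *: w k x.

(* nabla_i X^j for a W-valued vector field X *)
Definition nabla_vector {W : normedModType R} i (X : 'I_2 -> R * R -> W) j x
  : W := pderiv i (X j) x + \sum_(k < 2) christoffel j i k x *: X k x.

(* nabla_j X^j *)
Definition divergence {W : normedModType R} (X : 'I_2 -> R * R -> W) x : W :=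
  \sum_(j < 2) nabla_vector j X j x.

(* nabla^j f *)
Definition grad {W : normedModType R} (f : R * R -> W) j x : W :=
  \sum_(k < 2) cometric j k x *: pderiv k f x.

(* The row space of diff_mx x is the tangent plane, and that of the kernel of
   its transpose is the orthogonal complement of the tangent plane. *)
Definition normal_proj x (v : 'rV[R]_m) : 'rV[R]_m :=
  v *m proj_mx (kermx (diff_mx x)^T) <<diff_mx x>>%MS.

Definition second_ff i j x : 'rV[R]_m :=
  nabla_covector i (fun k => pderiv k F) j x.

(* h^i_j *)
Definition second_ff_mixed i j x : 'rV[R]_m :=
  \sum_(k < 2) cometric i k x *: second_ff k j x.

Definition mean_curvature x : 'rV[R]_m :=
  2^-1 *: \sum_(i < 2) \sum_(j < 2) cometric i j x *: second_ff i j x.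

Definition normal_laplacian (B : R * R -> 'rV[R]_m) x : 'rV[R]_m :=
  normal_proj x (divergence (fun j y => normal_proj y (grad B j y)) x).

Definition willmore_vector x : 'rV[R]_m :=
  normal_laplacian mean_curvature x
  + \sum_(i < 2) \sum_(j < 2)
      dot (second_ff_mixed i j x) (mean_curvature x) *: second_ff_mixed j i x
  - (2 * dot (mean_curvature x) (mean_curvature x)) *: mean_curvature x.

(* T^j *)
Definition stress j x : 'rV[R]_m :=
  grad mean_curvature j x
  - 2 *: normal_proj x (grad mean_curvature j x)
  + dot (mean_curvature x) (mean_curvature x) *: grad F j x.

End LocalGeometry.

Section Willmore.
Variables (R : realType) (m : nat) (S : oriented_surface R).

Definition immersion (Phi : S -> 'rV[R]_m) : Prop :=
  smooth Phi /\
  forall (c : atlas_index S) x, chart_cod (atlas c) x ->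
    row_free (diff_mx (in_chart c Phi) x).

(* A finite smooth partition of unity over K, the k-th function being
   compactly supported in the domain of the chart c k. *)
Definition partition_of_unity (K : set S) (n : nat)
    (c : 'I_n -> atlas_index S) (rho : 'I_n -> S -> R) : Prop :=
  [/\ forall k, smooth (rho k),
      forall k p, 0 <= rho k p,
      forall k, exists L : set S,
        [/\ compact L, L `<=` chart_dom (atlas (c k))
          & forall p, ~ L p -> rho k p = 0]
    & forall p, K p -> \sum_(k < n) rho k p = 1].

(* The integral over K of |H|^2 dvol_g, computed in charts by means of a
   partition of unity over K. *)
Definition willmore_energy (K : set S) (n : nat)
    (c : 'I_n -> atlas_index S) (rho : 'I_n -> S -> R)
    (Phi : S -> 'rV[R]_m) : R :=
  \sum_(k < n)
    \int[lebesgue2]_(x in chart_cod (atlas (c k))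
                          `&` of_coord (atlas (c k)) @^-1` K)
      (in_chart (c k) (rho k) x
       * dot (mean_curvature (in_chart (c k) Phi) x)
             (mean_curvature (in_chart (c k) Phi) x)
       * volume_density (in_chart (c k) Phi) x).

(* Critical point of the Willmore energy under the variations Phi + t V with V
   smooth and supported in a compact set K. The energy is taken over K, since
   it may be infinite over S while the variation leaves it unchanged off K. As
   the energy over K does not depend on the partition of unity used to compute
   it, all of them are allowed. *)
Definition willmore (Phi : S -> 'rV[R]_m) : Prop :=
  forall (V : S -> 'rV[R]_m) (K : set S) (n : nat)
         (c : 'I_n -> atlas_index S) (rho : 'I_n -> S -> R),
    smooth V -> compact K -> (forall p, ~ K p -> V p = 0) ->
    partition_of_unity K c rho ->
    is_derive (0 : R) (1 : R)
      (fun t : R => willmore_energy K c rho (fun p => Phi p + t *: V p))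
      (0 : R).

End Willmore.

(* Main.v *)
Require Import Defs.
From HB Require Import structures.
From mathcomp Require Import all_boot all_order all_algebra.
From mathcomp Require Import all_classical all_reals all_analysis.
From mathcomp Require Import measurable_realfun.
From mathcomp Require Import ring lra.
Set Implicit Arguments.
Unset Strict Implicit.
Unset Printing Implicit Defensive.
Import Order.TTheory GRing.Theory Num.Theory numFieldNormedType.Exports.
Local Open Scope classical_set_scope.
Local Open Scope ring_scope.

(* In a chart, the coordinate expressions of the second and third derivatives of
   the immersion, the Weingarten relation and the traced Codazzi equation give
   [div T = - W]; the two other laws follow from [T^j /\ d_j Phi = - d_j H /\ d^j Phi],
   [T^j . d_j Phi = 0] and [Delta Phi = 2 H].

   For the variational statement, the derivative of the energy density along [Phi +
   t V], computed from the 2-jets of [Phi] and [V], is the sum of the divergence of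
   [sqrt g (H . grad^j V + V . T^j)] and of [- sqrt g V . div T]. If [div T <> 0]
   at a point, a cut-off of the constant field [div T] near this point gives a
   negative derivative. Conversely, if [div T = 0], the field [V] is cut by the
   partition of unity into pieces supported in one chart each; the density of the
   variation is moved to this chart by a change of variables, the weights add up to
   1 there, and the integral of the divergence vanishes.

   The change of variables for compactly supported integrands rests on homotopy
   invariance: if [phi_s] is a homotopy of maps of the plane, then the derivative
   of [g(phi_s) det D phi_s] in [s] is a divergence. Near a point the map is thus
   replaced by its affine approximation, and then by the identity. *)

(** * Differential calculus on the plane *)

(** Smoothness is given by iterated partial derivatives, and no formula for the derivatives of order
    n of a composite is ever written: a class of functions stable under one partial derivation
    suffices.

    That [div T] has no tangential part is proved before [div T = - W]; the normal part then comes
    from a projection, which kills every derivative of a coefficient that multiplies a tangent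
    vector.

    The weights shape the variational part. The energy is a sum of chart integrals weighted by
    [rho k], and an integration by parts against a weight would leave its gradient. The weights must
    therefore add up to 1 under one integral sign, which requires all the pieces in the same chart.
    The transformation rule of the variation density is not computed from its formula: it is the
    derivative in [t] of the rule for the energy density, which only asks how a 2-jet transforms.
    Since [willmore] allows every partition of unity, the implication from Willmore to [div T = 0]
    stays in a single chart, with one weight. *)

Section PlaneDerivatives.
Context {R : realType}.
Implicit Types (U : set (R * R)) (x : R * R) (i j : 'I_2).

Lemma eq_on_near (W : Type) U (f g : R * R -> W) x :
  open U -> U x -> (forall y, U y -> f y = g y) -> \forall y \near x, f y = g y.
Proof. by move=> oU Ux fg; apply: filterS fg _; exact: open_nbhs_nbhs. Qed.

Lemma eq_on_derive (W : normedModType R) U (f g : R * R -> W) x v :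
  open U -> U x -> (forall y, U y -> f y = g y) -> 'D_v f x = 'D_v g x.
Proof. by move=> oU Ux fg; apply: near_eq_derive; exact: eq_on_near fg. Qed.

Lemma eq_on_derivable (W : normedModType R) U (f g : R * R -> W) x v :
  open U -> U x -> (forall y, U y -> f y = g y) ->
  derivable f x v -> derivable g x v.
Proof. by move=> oU Ux fg; apply: near_eq_derivable; exact: eq_on_near fg. Qed.

Lemma eq_on_continuous (W : topologicalType) U (f g : R * R -> W) x :
  open U -> U x -> (forall y, U y -> f y = g y) ->
  {for x, continuous f} -> {for x, continuous g}.
Proof.
move=> oU Ux fg; rewrite /prop_for /continuous_at (fg _ Ux) => fx.
apply: cvg_trans fx; apply: near_eq_cvg; exact: eq_on_near fg.
Qed.

Lemma is_derive_segment (W : normedModType R) (f : R * R -> W) x v (t : R) (df : W) :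
  is_derive (t *: v + x) v f df <-> is_derive t 1 (fun h : R => f (h *: v + x)) df.
Proof.
have E : (fun h : R => h^-1 *: ((f \o shift (t *: v + x)) (h *: v) - f (t *: v + x))) =
    (fun h : R => h^-1 *: (((fun h : R => f (h *: v + x)) \o shift t) (h *: 1) -
                           f (t *: v + x))).
  by apply/funext => h /=; rewrite addrA -scalerDl [_%:A]mulr1.
split=> -[d1 d2]; split.
- by rewrite /derivable -E.
- by rewrite -d2 /derive -E.
- by rewrite /derivable E.
- by rewrite -d2 /derive E.
Qed.

Lemma is_derive_horizontal (W : normedModType R) (f : R * R -> W) (s t : R) (df : W) :
  is_derive (s, t) (basis2 0) f df <-> is_derive s 1 (fun h => f (h, t)) df.
Proof.
have -> : (s, t) = s *: basis2 0 + (0, t) :> R * R.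
  by rewrite /basis2 /=; congr pair => /=; rewrite ?mulr0 ?[_ *: _]mulr1 ?addr0 ?[_ *: _]mulr0
    ?add0r.
rewrite is_derive_segment.
suff -> : (fun h : R => f (h *: basis2 0 + (0, t))) = (fun h => f (h, t)) by [].
apply/funext => h; congr f.
by rewrite /basis2 /=; congr pair => /=; rewrite ?[_ *: _]mulr1 ?addr0 ?[_ *: _]mulr0 ?add0r.
Qed.

Lemma is_derive_vertical (W : normedModType R) (f : R * R -> W) (s t : R) (df : W) :
  is_derive (s, t) (basis2 1) f df <-> is_derive t 1 (fun h => f (s, h)) df.
Proof.
have -> : (s, t) = t *: basis2 1 + (s, 0) :> R * R.
  by rewrite /basis2 /=; congr pair => /=; rewrite ?mulr0 ?[_ *: _]mulr1 ?addr0 ?[_ *: _]mulr0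
    ?add0r.
rewrite is_derive_segment.
suff -> : (fun h : R => f (h *: basis2 1 + (s, 0))) = (fun h => f (s, h)) by [].
apply/funext => h; congr f.
by rewrite /basis2 /=; congr pair => /=; rewrite ?[_ *: _]mulr1 ?addr0 ?[_ *: _]mulr0 ?add0r.
Qed.

(** The increments in the plane have components of either sign, so the interval is described by the
    distance to [a] instead of by an order between [a] and [b]. *)
Lemma MVT_between (f df : R -> R) (a b : R) :
  (forall t, `|t - a| <= `|b - a| -> is_derive t 1 f (df t)) ->
  exists2 c, `|c - a| <= `|b - a| & f b - f a = df c * (b - a).
Proof.
move=> fd.
have cf (u v : R) : (forall t, t \in `[u, v] -> `|t - a| <= `|b - a|) ->
    {within `[u, v], continuous f}.
  move=> H; apply: derivable_within_continuous => t tuv.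
  by have [] := fd t (H t tuv).
have [ab|ba] := leP a b.
  have H t : t \in `[a, b] -> `|t - a| <= `|b - a|.
    by rewrite in_itv /= => /andP[h1 h2]; rewrite !ger0_norm ?subr_ge0// lerB.
  have [c cab E] := @MVT_segment _ f df a b ab
     (fun t tab => fd t (H t (subset_itv_oo_cc tab))) (cf _ _ H).
  by exists c => //; apply: H.
have H t : t \in `[b, a] -> `|t - a| <= `|b - a|.
  rewrite in_itv /= => /andP[h1 h2]; rewrite !ler0_norm ?subr_le0// ?(ltW ba)//.
  by rewrite lerN2 lerB.
have [c cab E] := @MVT_segment _ f df b a (ltW ba)
     (fun t tab => fd t (H t (subset_itv_oo_cc tab))) (cf _ _ H).
exists c; first exact: H.
by rewrite -[LHS]opprB E -mulrN opprB.
Qed.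

Lemma ball_pairP (x y : R * R) (r : R) :
  ball x r y <-> `|y.1 - x.1| < r /\ `|y.2 - x.2| < r.
Proof.
have E : ball x r y = (ball x.1 r y.1 /\ ball x.2 r y.2) by [].
by rewrite E -!ball_normE /ball_ /= (distrC y.1) (distrC y.2).
Qed.


Lemma ball_sup (x y : R * R) (r : R) :
  ball x r y <-> (`|y.1 - x.1| < r) && (`|y.2 - x.2| < r).
Proof. by rewrite ball_pairP; split => [[-> ->]|/andP[]]. Qed.

Definition linear2 (a b : R) (h : R * R) : R := h.1 * a + h.2 * b.

Lemma linear2_is_linear (a b : R) : linear (linear2 a b).
Proof. by move=> k u v; rewrite /linear2 /=; rewrite /GRing.scale /=; ring. Qed.

HB.instance Definition _ (a b : R) :=
  GRing.isLinear.Build R (R * R)%type R *:%R (linear2 a b) (linear2_is_linear a b).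

Lemma linear2_continuous (a b : R) : continuous (linear2 a b).
Proof.
move=> x; apply: cvgD; apply: cvgM; try exact: cvg_cst.
- exact: cvg_fst.
- exact: cvg_snd.
Qed.

(** [differentiable] speaks of the chosen differential ['d f x]. Any continuous linear map that
    satisfies the expansion is a witness for that choice. *)
Lemma differentiable_of_littleo (V W : normedModType R) (f : V -> W) (x : V)
    (df : {linear V -> W}) :
  continuous df -> f \o shift x = cst (f x) + df +o_ 0 id ->
  differentiable f x.
Proof.
move=> dfc dxf.
apply/diffP => /=.
apply: (@getPex _ (fun (df : {linear V -> W}) => continuous df /\
  forall y, f y = f (lim (nbhs x)) + df (y - lim (nbhs x))
                  +o_(y \near x) (y - lim (nbhs x)))).
exists df; split=> //; apply: eqaddoEx => z.
have hdf h : (f \o shift x = cst (f x) + h +o_ 0 id) ->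
    h = f \o shift x - cst (f x) +o_ 0 id.
  move=> hdf; apply: eqaddoE.
  rewrite hdf addrAC -!addrA addrC !addrA subrK.
  rewrite -[LHS]addr0 -addrA; congr (_ + _).
  by apply/eqP; rewrite eq_sym addrC addr_eq0 oppo.
rewrite (hdf _ dxf) !addrA lim_id // /(_ \o _) /= subrK [f _ + _]addrC addrK.
rewrite -addrA -[LHS]addr0; congr (_ + _).
apply/eqP; rewrite eq_sym addrC addr_eq0 oppox; apply/eqP.
rewrite [in LHS]littleo_center0 (comp_centerK x id).
by rewrite -[- _ in RHS](comp_centerK x).
Qed.

(* The increment is split along the two sides of a rectangle, and the mean value
   theorem is applied on each of them. *)
Lemma C1_differentiable (f : R * R -> R) x :
  (\forall y \near x, forall i, derivable f y (basis2 i)) ->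
  (forall i, {for x, continuous (pderiv i f)}) ->
  differentiable f x.
Proof.
move=> fd fc.
apply: (@differentiable_of_littleo _ R f x (linear2 (pderiv 0 f x) (pderiv 1 f x)
   : {linear (R * R)%type -> R})); first exact: linear2_continuous.
apply/eqaddoP => _/posnumP[e].
have e2 : 0 < e%:num / 2 by rewrite divr_gt0.
have c0 : \forall y \near x, `|pderiv 0 f x - pderiv 0 f y| < e%:num / 2.
  by have /cvgrPdist_lt /(_ _ e2) := fc 0.
have c1 : \forall y \near x, `|pderiv 1 f x - pderiv 1 f y| < e%:num / 2.
  by have /cvgrPdist_lt /(_ _ e2) := fc 1.
have : \forall y \near x, [/\ forall i, derivable f y (basis2 i),
    `|pderiv 0 f x - pderiv 0 f y| < e%:num / 2 &
    `|pderiv 1 f x - pderiv 1 f y| < e%:num / 2].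
  by apply: filterS3 fd c0 c1 => y ? ? ?; split.
move=> /nbhs_ballP[r /= r0 H].
apply/nbhs_ballP; exists r => //= h.
rewrite ball_sup /= !subr0 => /andP[h1 h2].
have [c cP Ec] : exists2 c, `|c - x.1| <= `|(h.1 + x.1) - x.1| &
    f (h.1 + x.1, h.2 + x.2) - f (x.1, h.2 + x.2) =
    pderiv 0 f (c, h.2 + x.2) * ((h.1 + x.1) - x.1).
  apply: (@MVT_between (fun s => f (s, h.2 + x.2))
            (fun s => pderiv 0 f (s, h.2 + x.2))) => t tb.
  apply/is_derive_horizontal; apply: derivableP.
  have [|+ _ _] := H (t, h.2 + x.2); last exact.
  rewrite ball_sup /= addrK h2 andbT.
  by apply: le_lt_trans tb _; rewrite addrK.
have [d dP Ed] : exists2 c, `|c - x.2| <= `|(h.2 + x.2) - x.2| &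
    f (x.1, h.2 + x.2) - f (x.1, x.2) =
    pderiv 1 f (x.1, c) * ((h.2 + x.2) - x.2).
  apply: (@MVT_between (fun s => f (x.1, s))
            (fun s => pderiv 1 f (x.1, s))) => t tb.
  apply/is_derive_vertical; apply: derivableP.
  have [|+ _ _] := H (x.1, t); last exact.
  rewrite ball_sup /= subrr normr0 r0 /=.
  by apply: le_lt_trans tb _; rewrite addrK.
have B0 : `|pderiv 0 f x - pderiv 0 f (c, h.2 + x.2)| < e%:num / 2.
  have [|_ + _] := H (c, h.2 + x.2); last exact.
  rewrite ball_sup /= addrK h2 andbT.
  by apply: le_lt_trans cP _; rewrite addrK.
have B1 : `|pderiv 1 f x - pderiv 1 f (x.1, d)| < e%:num / 2.
  have [|_ _ +] := H (x.1, d); last exact.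
  rewrite ball_sup /= subrr normr0 r0 /=.
  by apply: le_lt_trans dP _; rewrite addrK.
rewrite !addrK in Ec Ed.
have -> : (f \o shift x - (cst (f x) + linear2 (pderiv 0 f x) (pderiv 1 f x))) h =
   - ((pderiv 0 f x - pderiv 0 f (c, h.2 + x.2)) * h.1 +
      (pderiv 1 f x - pderiv 1 f (x.1, d)) * h.2).
  rewrite !fctE /linear2 /=.
  have -> : f (h + x) = f (h.1 + x.1, h.2 + x.2) by [].
  have -> : f (h.1 + x.1, h.2 + x.2) = (f (h.1 + x.1, h.2 + x.2) - f (x.1, h.2 + x.2))
     + (f (x.1, h.2 + x.2) - f (x.1, x.2)) + f (x.1, x.2) by ring.
  rewrite Ec Ed.
  have -> : f x = f (x.1, x.2) by case: (x).
  by ring.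
rewrite normrN.
apply: le_trans (ler_normD _ _) _.
rewrite [leRHS](_ : _ = e%:num / 2 * `|h| + e%:num / 2 * `|h|); last first.
  by rewrite -mulrDl -splitr.
have hn : `|h| = Num.max `|h.1| `|h.2| by [].
have hn1 : `|h.1| <= `|h| by rewrite hn le_max lexx.
have hn2 : `|h.2| <= `|h| by rewrite hn le_max lexx orbT.
by rewrite lerD // normrM ler_pM // ltW.
Qed.

Lemma pderiv_diff (f : R * R -> R) i x : differentiable f x ->
  pderiv i f x = 'd f x (basis2 i).
Proof. by move=> df; rewrite /pderiv deriveE. Qed.

End PlaneDerivatives.

Lemma I2P (i : 'I_2) : i = 0 \/ i = 1.
Proof. by case: i => -[|[|//]] p; [left|right]; apply: val_inj. Qed.

Lemma pair_basis2 (R : realType) (a b : R) :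
  (a, b) = a *: basis2 0 + b *: basis2 1.
Proof.
have -> : a *: basis2 0 + b *: basis2 1 = (a * 1 + b * 0, a * 0 + b * 1) :> R * R by [].
by rewrite !mulr1 !mulr0 addr0 add0r.
Qed.

Section DerivationRules.
Context {R : realType} {V : normedModType R}.
Implicit Types (f g : V -> R) (x v : V).

Lemma is_derive_mul f g x v (df dg : R) : is_derive x v f df ->
  is_derive x v g dg -> is_derive x v (fun y => f y * g y) (df * g x + f x * dg).
Proof.
move=> Hf Hg; have H := is_deriveM Hf Hg.
apply: is_derive_eq H _.
by rewrite /GRing.scale /= addrC mulrC.
Qed.

Lemma is_derive_add (W : normedModType R) (f g : V -> W) x v (df dg : W) : is_derive x v f df ->
  is_derive x v g dg -> is_derive x v (fun y => f y + g y) (df + dg).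
Proof. by move=> Hf Hg; have H := is_deriveD Hf Hg; apply: is_derive_eq H _. Qed.

Lemma is_derive_opp (W : normedModType R) (f : V -> W) x v (df : W) : is_derive x v f df ->
  is_derive x v (fun y => - f y) (- df).
Proof. by move=> Hf; have H := is_deriveN Hf; apply: is_derive_eq H _. Qed.

Lemma is_derive_sub (W : normedModType R) (f g : V -> W) x v (df dg : W) : is_derive x v f df ->
  is_derive x v g dg -> is_derive x v (fun y => f y - g y) (df - dg).
Proof. by move=> Hf /is_derive_opp; apply: is_derive_add. Qed.

Lemma is_derive_inv f x v (df : R) : f x != 0 -> is_derive x v f df ->
  is_derive x v (fun y => (f y)^-1) (- df / f x ^+ 2).
Proof.
move=> f0 [fd <-]; apply: DeriveDef; first exact: derivableV.
by rewrite deriveV // /GRing.scale /= mulrC mulrN mulNr.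
Qed.

Lemma is_derive_line1 (W : normedModType R) (f : V -> W) x v (df : W) :
  is_derive x v f df <-> is_derive (0 : R) 1 (fun h : R => f (h *: v + x)) df.
Proof.
have E : (fun h : R => h^-1 *: ((f \o shift x) (h *: v) - f x)) =
    (fun h : R => h^-1 *: (((fun h : R => f (h *: v + x)) \o shift 0) (h *: 1) -
                           f (0 *: v + x))).
  by apply/funext => h /=; rewrite addr0 scale0r add0r [_%:A]mulr1.
split=> -[d1 d2]; split.
- by rewrite /derivable -E.
- by rewrite -d2 /derive -E.
- by rewrite /derivable E.
- by rewrite -d2 /derive E.
Qed.

(** Along the line through [x] in the direction [v] this is the chain rule in one variable, so a
    directional derivative of [f] is enough. *)
Lemma is_derive_comp1 f (h : R -> R) x v (df dh : R) : is_derive x v f df ->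
  is_derive (f x) 1 h dh -> is_derive x v (fun y => h (f y)) (dh * df).
Proof.
move=> [fd fv] [hd hv].
pose F (t : R) := f (t *: v + x).
have F0 : F 0 = f x by rewrite /F scale0r add0r.
have [dF EF] : is_derive (0 : R) 1 F df by apply/is_derive_line1; split.
have dhF : derivable h (F 0) 1 by move: hd; rewrite -F0; exact.
have EhF : 'D_1 h (F 0) = dh by rewrite F0.
apply/is_derive_line1.
apply: DeriveDef.
  apply/derivable1_diffP; apply: (@differentiable_comp _ _ _ _ F h).
    exact/derivable1_diffP.
  exact/derivable1_diffP.
have := derive1_comp dF dhF.
by rewrite !derive1E EF EhF.
Qed.

Lemma is_derive_sqrt f x v (df : R) : 0 < f x -> is_derive x v f df ->
  is_derive x v (fun y => Num.sqrt (f y)) (df / (2 * Num.sqrt (f x))).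
Proof.
move=> f0 fd; have := is_derive_comp1 fd (is_derive1_sqrt f0).
by move=> H; apply: is_derive_eq H _; rewrite mulrC.
Qed.

(** The inner map is a curve in the plane that may leave every line, so full differentials are
    composed here. *)
Lemma is_derive_comp2 (h : R * R -> R) f g x v (df dg : R) :
  differentiable f x -> differentiable g x -> differentiable h (f x, g x) ->
  is_derive x v f df -> is_derive x v g dg ->
  is_derive x v (fun y => h (f y, g y))
    (df * pderiv 0 h (f x, g x) + dg * pderiv 1 h (f x, g x)).
Proof.
move=> fd gd hd [_ <-] [_ <-].
have pd : differentiable (fun y => (f y, g y)) x by apply: differentiable_pair.
have D : differentiable (h \o (fun y => (f y, g y))) x by apply: differentiable_comp.
apply: DeriveDef; first exact: diff_derivable.
have -> : 'D_v (fun y => h (f y, g y)) x = 'D_v (h \o (fun y => (f y, g y))) x by [].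
rewrite (deriveE _ D) diff_comp //= diff_pair // (deriveE _ fd) (deriveE _ gd).
rewrite /pderiv !(deriveE _ hd) /=.
have -> : ('d f x v, 'd g x v) = 'd f x v *: basis2 0 + 'd g x v *: basis2 1 :> R * R.
  exact: pair_basis2.
by rewrite linearD !linearZ.
Qed.

End DerivationRules.

Section Smooth.
Context {R : realType}.
Implicit Types (U V : set (R * R)) (x : R * R) (i j : 'I_2).

Lemma smooth_on_sub (W : normedModType R) U V (f : R * R -> W) :
  (forall x, U x -> V x) -> smooth_on V f -> smooth_on U f.
Proof. by move=> UV fV s x /UV; apply: fV. Qed.

Lemma smooth_on_eq (W : normedModType R) U (f g : R * R -> W) : open U ->
  (forall x, U x -> f x = g x) -> smooth_on U f -> smooth_on U g.
Proof.
move=> oU fg fU s.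
have E x : U x -> pderivs s f x = pderivs s g x.
  elim: s x => [|i s IH] x Ux /=; first exact: fg.
  exact: eq_on_derive IH.
move=> x Ux; have [c d] := fU s x Ux; split; first exact: eq_on_continuous E c.
by move=> i; apply: eq_on_derivable E (d i).
Qed.

Lemma smooth_on_pderiv (W : normedModType R) U (f : R * R -> W) i :
  smooth_on U f -> smooth_on U (pderiv i f).
Proof.
move=> fU s x Ux; have := fU (rcons s i) x Ux.
by rewrite /pderivs foldr_rcons.
Qed.

Lemma smooth_on_derivable (W : normedModType R) U (f : R * R -> W) x i :
  smooth_on U f -> U x -> derivable f x (basis2 i).
Proof. by move=> fU Ux; apply: (fU [::] x Ux).2. Qed.

Lemma smooth_on_is_derive (W : normedModType R) U (f : R * R -> W) x i :
  smooth_on U f -> U x -> is_derive x (basis2 i) f (pderiv i f x).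
Proof. by move=> fU Ux; apply: derivableP; apply: smooth_on_derivable Ux. Qed.

Lemma smooth_on_continuous (W : normedModType R) U (f : R * R -> W) x :
  smooth_on U f -> U x -> {for x, continuous f}.
Proof. by move=> fU Ux; apply: (fU [::] x Ux).1. Qed.

Lemma smooth_on_differentiable U (f : R * R -> R) x : open U ->
  smooth_on U f -> U x -> differentiable f x.
Proof.
move=> oU fU Ux; apply: C1_differentiable => [|i].
  by apply: filterS (open_nbhs_nbhs (conj oU Ux)) => y Uy i; apply: smooth_on_derivable Uy.
exact: (fU [:: i] x Ux).1.
Qed.

(** The mean value theorem is applied to [f (s, b + k) - f (s, b)] in [s], and then to the resulting
    difference of [pderiv 0 f] in the second variable. *)
Lemma mixed_difference (f : R * R -> R) (a b h k : R) :
  0 <= h -> 0 <= k ->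
  (forall s t, a <= s <= a + h -> b <= t <= b + k ->
    derivable f (s, t) (basis2 0) /\ derivable (pderiv 0 f) (s, t) (basis2 1)) ->
  exists2 p : R * R, a <= p.1 <= a + h /\ b <= p.2 <= b + k &
   f (a + h, b + k) - f (a + h, b) - f (a, b + k) + f (a, b)
   = pderiv 1 (pderiv 0 f) p * (h * k).
Proof.
move=> h0 k0 H.
have lek : b <= b + k by rewrite lerDl.
have leh : a <= a + h by rewrite lerDl.
pose phi s := f (s, b + k) - f (s, b).
have dphi s : a <= s <= a + h ->
    is_derive s 1 phi (pderiv 0 f (s, b + k) - pderiv 0 f (s, b)).
  move=> sP; apply: is_derive_sub.
    by apply/is_derive_horizontal/derivableP; have [] := H s (b + k) sP; rewrite ?lek ?lexx.
  by apply/is_derive_horizontal/derivableP; have [] := H s b sP; rewrite ?lek ?lexx.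
have [c cP Ec] := @MVT_segment _ phi (fun s => pderiv 0 f (s, b + k) - pderiv 0 f (s, b))
   a (a + h) leh (fun s sP => dphi s (subset_itv_oo_cc sP))
   (@derivable_within_continuous _ _ phi `[a, a + h] (fun s sP => let: DeriveDef d _ := dphi s sP
     in d)).
have dpsi t : b <= t <= b + k ->
    is_derive t 1 (fun t => pderiv 0 f (c, t)) (pderiv 1 (pderiv 0 f) (c, t)).
  move=> tP; apply/is_derive_vertical/derivableP.
  by have [] := H c t cP tP.
have [d dP Ed] := @MVT_segment _ _ _
   b (b + k) lek (fun s sP => dpsi s (subset_itv_oo_cc sP))
   (@derivable_within_continuous _ _ _ `[b, b + k] (fun s sP => let: DeriveDef d _ := dpsi s sP
     in d)).
exists (c, d); first by split.
move: Ec; rewrite /phi Ed => Ec.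
have aux (A B C D E u w : R) : A - B - (C - D) = E * (b + w - b) * (a + u - a) ->
    A - B - C + D = E * (u * w).
  move=> AE; have -> : A - B - C + D = A - B - (C - D) by ring.
  by rewrite AE; ring.
exact: aux Ec.
Qed.

(** Composition with this symmetry makes [mixed_difference] speak of the other mixed derivative. *)
Definition swap (p : R * R) : R * R := (p.2, p.1).

Lemma swap_continuous : continuous swap.
Proof. by move=> z; apply: (@cvg_pair _ _ _ _ (nbhs z.2) (nbhs z.1));
  [exact: cvg_snd|exact: cvg_fst]. Qed.

Lemma is_derive_swap (f : R * R -> R) (p : R * R) (d : R) i j : i != j ->
  is_derive p (basis2 i) (fun q => f (swap q)) d <-> is_derive (swap p) (basis2 j) f d.
Proof.
case: p => s t.
case: (I2P i) => ->; case: (I2P j) => -> // _; rewrite /swap /=.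
  by rewrite is_derive_horizontal is_derive_vertical.
by rewrite is_derive_horizontal is_derive_vertical.
Qed.

Lemma pderiv_swap (f : R * R -> R) (p : R * R) i j : i != j -> derivable f (swap p) (basis2 j) ->
  is_derive p (basis2 i) (fun q => f (swap q)) (pderiv j f (swap p)).
Proof. by move=> ij d; apply/is_derive_swap; [exact: ij|exact: derivableP]. Qed.

Lemma schwarz U (f : R * R -> R) x i j : open U -> smooth_on U f -> U x ->
  pderiv i (pderiv j f) x = pderiv j (pderiv i f) x.
Proof.
move=> oU fU Ux.
suff H : pderiv 0 (pderiv 1 f) x = pderiv 1 (pderiv 0 f) x.
  by case: (I2P i) => ->; case: (I2P j) => ->; [exact: erefl|exact: H|exact: (esym H)|exact: erefl].
apply/eqP; rewrite -subr_eq0 -normr_eq0 eq_le normr_ge0 andbT.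
apply/ler_addgt0Pr => _/posnumP[e]; rewrite add0r.
have e2 : 0 < e%:num / 2 by rewrite divr_gt0.
have c0 : \forall y \near x, `|pderiv 0 (pderiv 1 f) x - pderiv 0 (pderiv 1 f) y| < e%:num / 2.
  by have /cvgrPdist_lt /(_ _ e2) := smooth_on_continuous (smooth_on_pderiv 0 (smooth_on_pderiv 1
    fU)) Ux.
have c1 : \forall y \near x, `|pderiv 1 (pderiv 0 f) x - pderiv 1 (pderiv 0 f) y| < e%:num / 2.
  by have /cvgrPdist_lt /(_ _ e2) := smooth_on_continuous (smooth_on_pderiv 1 (smooth_on_pderiv 0
    fU)) Ux.
have : \forall y \near x, [/\ U y,
   `|pderiv 0 (pderiv 1 f) x - pderiv 0 (pderiv 1 f) y| < e%:num / 2 &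
   `|pderiv 1 (pderiv 0 f) x - pderiv 1 (pderiv 0 f) y| < e%:num / 2].
  by apply: filterS3 (open_nbhs_nbhs (conj oU Ux)) c0 c1 => y ? ? ?; split.
move=> /nbhs_ballP[r /= r0 H].
case: x Ux {c0 c1} H => a b Ux H.
(* Half of [r], so that the closed square lies in the open ball. *)
have h0 : 0 < r / 2 by rewrite divr_gt0.
have inb (s t : R) : a <= s <= a + r / 2 -> b <= t <= b + r / 2 -> ball (a, b) r (s, t).
  move=> /andP[s1 s2] /andP[t1 t2]; apply/ball_pairP => /=.
  rewrite !ger0_norm ?subr_ge0 // !ltrBlDl.
  have : r / 2 < r by rewrite gtr_pMr // invf_lt1 // ltr1n.
  by move=> rr; split; [apply: (le_lt_trans s2)|apply: (le_lt_trans t2)]; rewrite ltrD2l.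
have [|p [p1 p2] Ep] := @mixed_difference f a b _ _ (ltW h0) (ltW h0).
  move=> s t sP tP; have [Ust _ _] := H _ (inb s t sP tP).
  split; first exact: smooth_on_derivable Ust.
  exact: (@smooth_on_derivable _ U (pderiv 0 f) (s, t) 1 (smooth_on_pderiv 0 fU) Ust).
have [|q [q1 q2] Eq] := @mixed_difference (fun q => f (swap q)) b a _ _ (ltW h0) (ltW h0).
  move=> t s tP sP; have [Ust _ _] := H _ (inb s t sP tP).
  split.
    by have [] := @pderiv_swap f (t, s) 0 1 isT (@smooth_on_derivable _ U f (s, t) 1 fU Ust).
  have [d _] := @pderiv_swap (pderiv 1 f) (t, s) 1 0 isT
    (@smooth_on_derivable _ U (pderiv 1 f) (s, t) 0 (smooth_on_pderiv 1 fU) Ust).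
  have oV : open (swap @^-1` U) by apply: open_comp => // z _; exact: swap_continuous.
  have := @eq_on_derivable R R (swap @^-1` U) (fun q => pderiv 1 f (swap q))
    (pderiv 0 (fun q => f (swap q))) (t, s) (basis2 1) oV Ust _ d.
  apply.
  move=> z Uz; rewrite /pderiv.
  by have [_ ->] := @pderiv_swap f z 0 1 isT (@smooth_on_derivable _ U f (swap z) 1 fU Uz).
have Uq : U (swap q) by have [] := H _ (inb q.2 q.1 q2 q1).
have Eq' : pderiv 1 (pderiv 0 (fun q => f (swap q))) q = pderiv 0 (pderiv 1 f) (swap q).
  have [_ <-] := @pderiv_swap (pderiv 1 f) q 1 0 isT
    (@smooth_on_derivable _ U (pderiv 1 f) (swap q) 0 (smooth_on_pderiv 1 fU) Uq).
  have oV : open (swap @^-1` U) by apply: open_comp => // z _; exact: swap_continuous.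
  apply: (@eq_on_derive _ _ (swap @^-1` U) _ _ _ _ oV Uq).
  move=> z Uz; rewrite /pderiv.
  by have [_ ->] := @pderiv_swap f z 0 1 isT (@smooth_on_derivable _ U f (swap z) 1 fU Uz).
(* Both second differences are that of [f] over the same square; division by its area identifies the
   two mixed derivatives, taken at two different points near [x]. *)
have E : pderiv 1 (pderiv 0 f) p = pderiv 0 (pderiv 1 f) (swap q).
  have aux (k A B C D X Y : R) : 0 < k -> A - B - C + D = X * (k * k) ->
      A - C - B + D = Y * (k * k) -> X = Y.
    move=> k0 XE YE; apply: (@mulIf _ (k * k)); first by rewrite mulf_neq0 // gt_eqF.
    by rewrite -XE -YE; ring.
  by move: Eq; rewrite Eq'; exact: aux h0 Ep.
have [_ _ B1] := H _ (inb p.1 p.2 p1 p2).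
have [_ B0 _] := H _ (inb q.2 q.1 q2 q1).
rewrite -surjective_pairing in B1.
rewrite -[X in X - _](subrK (pderiv 0 (pderiv 1 f) (swap q))) -addrA.
apply: le_trans (ler_normD _ _) _; rewrite [leRHS]splitr.
apply: lerD; first exact: (ltW B0).
by rewrite -E distrC; exact: (ltW B1).
Qed.

End Smooth.

(** * Closure properties of smooth functions *)

Section Flat.
Context {R : realType}.

Lemma pow_le_expR (y : R) (n : nat) : 0 <= y -> y ^+ n <= n`!%:R * expR y.
Proof.
move=> y0; case: n => [|n].
  by rewrite expr0 fact0 mul1r; apply: le_trans (expR_ge1Dx y); rewrite lerDl.
have f0 : 0 < (n.+1`!%:R : R) by rewrite ltr0n fact_gt0.
rewrite -ler_pdivrMl // mulrC.
by apply: le_trans (expR_ge1Dxn n y0); rewrite lerDr.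
Qed.

Lemma poly_le_expR (p : {poly R}) :
  exists2 C : R, 0 <= C & forall y, 0 <= y -> `|p.[y]| <= C * expR y.
Proof.
exists (\sum_(i < size p) `|p`_i| * i`!%:R).
  by apply: sumr_ge0 => i _; rewrite mulr_ge0.
move=> y y0; rewrite horner_coef; apply: le_trans (ler_norm_sum _ _ _) _.
rewrite mulr_suml; apply: ler_sum => i _.
rewrite normrM -mulrA ler_wpM2l //.
by rewrite ger0_norm ?exprn_ge0 // pow_le_expR.
Qed.

Definition flat_poly (p : {poly R}) (t : R) : R :=
  if 0 < t then p.[t^-1] * expR (- t^-1) else 0.

Lemma flat_poly_derive (p : {poly R}) (t : R) :
  is_derive t 1 (flat_poly p) (flat_poly ('X^2 * (p - p^`())) t).
Proof.
have [t0|t0|->] := ltgtP t 0.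
- have -> : flat_poly ('X^2 * (p - p^`())) t = 0 by rewrite /flat_poly ltNge (ltW t0).
  apply: (@near_eq_is_derive _ R R (cst 0)).
  by near=> s; rewrite /flat_poly ifN // -leNgt ltW //; near: s; exact: lt_nbhsl.
- have tn : t != 0 by rewrite gt_eqF.
  apply: (@near_eq_is_derive _ R R (fun s => p.[s^-1] * expR (- s^-1))).
    by near=> s; rewrite /flat_poly (_ : 0 < s) //; near: s; exact: lt_nbhsr.
  have dinv : is_derive t 1 (fun s : R => s^-1) (- 1 / t ^+ 2).
    exact: (is_derive_inv tn (is_derive_id t 1)).
  have dp := is_derive_comp1 dinv (is_derive_poly p t^-1).
  have de := is_derive_comp1 (is_derive_opp dinv) (is_derive_expR (- t^-1)).
  apply: is_derive_eq (is_derive_mul dp de) _.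
  rewrite /flat_poly t0 hornerM hornerXn hornerD hornerN; field.
  exact: tn.
have -> : flat_poly ('X^2 * (p - p^`())) 0 = 0 by rewrite /flat_poly ltxx.
(* The difference quotient at 0 carries one factor 1/h. The bound is taken with two of them, so that
   the quotient is [h] times a bounded quantity. *)
have [C C0 HC] := poly_le_expR ('X^2 * p).
suff lim0 : h^-1 *: ((flat_poly p \o shift 0) (h *: 1) - flat_poly p 0) @[h --> 0^'] --> (0 : R).
  by apply: DeriveDef; [apply/cvg_ex; exists 0|exact: cvg_lim].
apply/cvgrPdist_le => e e0.
have C1 : 0 < C + 1 by rewrite ltr_wpDl.
near=> h.
have h0 : h != 0 by near: h; exact: nbhs_dnbhs_neq.
have hb : `|h| <= e / (C + 1).
  near: h; apply: dnbhs0_le; by rewrite divr_gt0.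
rewrite sub0r normrN /= addr0 [_ *: 1]mulr1 [flat_poly p 0]/flat_poly ltxx subr0.
rewrite /flat_poly; case: ifPn => hp; last first.
  by rewrite [_ *: _]mulr0 normr0 ltW.
have hi0 : 0 <= h^-1 by rewrite invr_ge0 ltW.
have := HC _ hi0.
rewrite hornerM hornerXn => B.
have -> : `|h^-1 *: (p.[h^-1] * expR (- h^-1))| = h * (`|h^-1 ^+ 2 * p.[h^-1]| / expR h^-1).
  have aux (k P E : R) : 0 < k -> 0 < E ->
      `|k^-1 * (P * E^-1)| = k * (`|k^-1 ^+ 2 * P| / E).
    move=> k0 E0; rewrite !normrM !normfV (gtr0_norm k0) (gtr0_norm E0).
    by field; rewrite !gt_eqF.
  by rewrite /GRing.scale /= expRN; apply: aux => //; exact: expR_gt0.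
apply: (@le_trans _ _ (h * C)).
  by rewrite ler_wpM2l ?(ltW hp) // ler_pdivrMr ?expR_gt0.
rewrite (ger0_norm (ltW hp)) ler_pdivlMr // in hb.
by apply: le_trans hb; rewrite ler_wpM2l ?(ltW hp) // lerDl.
Unshelve. all: by end_near. Qed.

Definition flat : R -> R := flat_poly 1.

Lemma flat_gt0 (t : R) : 0 < t -> 0 < flat t.
Proof. by move=> t0; rewrite /flat /flat_poly t0 hornerE mul1r expR_gt0. Qed.

Lemma flat_eq0 (t : R) : t <= 0 -> flat t = 0.
Proof. by move=> t0; rewrite /flat /flat_poly ltNge t0. Qed.

Lemma flat_ge0 (t : R) : 0 <= flat t.
Proof. by have [/flat_eq0 ->|/flat_gt0/ltW] := leP t 0. Qed.

End Flat.

Section SmoothClosure.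
Context {R : realType}.
Implicit Types (U V : set (R * R)) (f g h : R * R -> R) (x : R * R) (i : 'I_2).

(** A class that contains the smooth functions and is stable both under the operations of the proof
    and under partial derivation. Smoothness of a composite then follows by iterating one
    derivation. [SE_flat] keeps the polynomial of [flat_poly] because derivation changes it. *)
Inductive smooth_expr : set (R * R) -> (R * R -> R) -> Prop :=
| SE_base U f : smooth_on U f -> smooth_expr U f
| SE_linear U a b : smooth_expr U (linear2 a b)
| SE_const U (a : R) : smooth_expr U (fun=> a)
| SE_add U f g : smooth_expr U f -> smooth_expr U g ->
    smooth_expr U (fun x => f x + g x)
| SE_mul U f g : smooth_expr U f -> smooth_expr U g ->
    smooth_expr U (fun x => f x * g x)
| SE_inv U f : (forall x, U x -> f x != 0) -> smooth_expr U f ->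
    smooth_expr U (fun x => (f x)^-1)
| SE_sqrt U f : (forall x, U x -> 0 < f x) -> smooth_expr U f ->
    smooth_expr U (fun x => Num.sqrt (f x))
| SE_flat U p f : smooth_expr U f -> smooth_expr U (fun x => flat_poly p (f x))
| SE_comp U V f g h : open V -> (forall x, U x -> V (g x, h x)) ->
    smooth_expr V f -> smooth_expr U g -> smooth_expr U h ->
    smooth_expr U (fun x => f (g x, h x)).

(** Differentiability is part of the induction because the chain rule for [SE_comp] uses
    differentials. The partial derivative is only compared with an expression on [U], where the side
    conditions of inverse and square root hold. *)
Lemma smooth_expr_derive U f : smooth_expr U f -> open U ->
  (forall x, U x -> differentiable f x) /\
  forall i, exists2 g, smooth_expr U g & forall x, U x -> pderiv i f x = g x.
Proof.
have pdE (k k' : R * R -> R) x i : is_derive x (basis2 i) k (k' x) -> pderiv i k x = k' x.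
  by case.
have dd (k : R * R -> R) x i : differentiable k x -> is_derive x (basis2 i) k (pderiv i k x).
  by move=> dk; apply: derivableP; apply: diff_derivable.
elim=> {U f}.
- move=> U f fU oU; split; first by move=> x Ux; apply: smooth_on_differentiable Ux.
  by move=> i; exists (pderiv i f) => //; apply: SE_base; apply: smooth_on_pderiv.
- move=> U a b oU.
  have D x : differentiable (linear2 a b) x.
    by apply: linear_differentiable; apply: linear2_continuous.
  split => // i; exists (fun=> linear2 a b (basis2 i)); first exact: SE_const.
  move=> x Ux; rewrite pderiv_diff // diff_lin //; exact: linear2_continuous.
- move=> U a oU; split; first by move=> x _; exact: differentiable_cst.
  move=> i; exists (fun=> 0); first exact: SE_const.
  by move=> x _; rewrite /pderiv derive_cst.
- move=> U f g Ef IHf Eg IHg oU; have [fd fp] := IHf oU; have [gd gp] := IHg oU.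
  split; first by move=> x Ux; apply: differentiableD; [exact: fd|exact: gd].
  move=> i; have [f' Ef' f'E] := fp i; have [g' Eg' g'E] := gp i.
  exists (fun x => f' x + g' x); first exact: SE_add.
  move=> x Ux; rewrite -f'E // -g'E //.
  apply: (pdE _ (fun x => pderiv i f x + pderiv i g x)).
  by apply: is_derive_add; apply: dd; [exact: fd|exact: gd].
- move=> U f g Ef IHf Eg IHg oU; have [fd fp] := IHf oU; have [gd gp] := IHg oU.
  split; first by move=> x Ux; apply: differentiableM; [exact: fd|exact: gd].
  move=> i; have [f' Ef' f'E] := fp i; have [g' Eg' g'E] := gp i.
  exists (fun x => f' x * g x + f x * g' x); first by apply: SE_add; apply: SE_mul.
  move=> x Ux; rewrite -f'E // -g'E //; apply: (pdE _ (fun x => pderiv i f x * g x + f x * pderiv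
    i g x)).
  by apply: is_derive_mul; apply: dd; [exact: fd|exact: gd].
- move=> U f f0 Ef IHf oU; have [fd fp] := IHf oU.
  split; first by move=> x Ux; apply: differentiableV; [exact: fd|exact: f0].
  move=> i; have [f' Ef' f'E] := fp i.
  exists (fun x => (- 1) * (f' x * ((f x)^-1 * (f x)^-1))).
    apply: SE_mul; first exact: SE_const.
    by apply: SE_mul => //; apply: SE_mul; apply: SE_inv.
  move=> x Ux; rewrite -f'E //.
  rewrite (_ : _ * _ = - pderiv i f x / f x ^+ 2); last first.
    by rewrite -invfM -expr2 mulN1r mulNr.
  apply: (pdE _ (fun x => - pderiv i f x / f x ^+ 2)).
  by apply: is_derive_inv; [exact: f0|apply: dd; exact: fd].
- move=> U f f0 Ef IHf oU; have [fd fp] := IHf oU.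
  split.
    move=> x Ux; apply: (@differentiable_comp _ _ _ _ f Num.sqrt); first exact: fd.
    by apply/derivable1_diffP; case: (is_derive1_sqrt (f0 x Ux)).
  move=> i; have [f' Ef' f'E] := fp i.
  exists (fun x => f' x * (2 * Num.sqrt (f x))^-1).
    apply: SE_mul => //; apply: SE_inv => [x Ux|].
      by rewrite mulf_neq0 // gt_eqF // sqrtr_gt0 f0.
    by apply: SE_mul; [exact: SE_const|exact: SE_sqrt].
  move=> x Ux; rewrite -f'E //; apply: (pdE _ (fun x => pderiv i f x / (2 * Num.sqrt (f x)))).
  by apply: is_derive_sqrt; [exact: f0|apply: dd; exact: fd].
- move=> U p f Ef IHf oU; have [fd fp] := IHf oU.
  split.
    move=> x Ux; apply: (@differentiable_comp _ _ _ _ f (flat_poly p)); first exact: fd.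
    by apply/derivable1_diffP; case: (flat_poly_derive p (f x)).
  move=> i; have [f' Ef' f'E] := fp i.
  exists (fun x => flat_poly ('X^2 * (p - p^`())) (f x) * f' x).
    by apply: SE_mul => //; apply: SE_flat.
  move=> x Ux; rewrite -f'E //.
  apply: (pdE _ (fun x => flat_poly ('X^2 * (p - p^`())) (f x) * pderiv i f x)).
  by apply: is_derive_comp1; [apply: dd; exact: fd|exact: flat_poly_derive].
- move=> U V f g h oV UV Ef IHf Eg IHg Eh IHh oU.
  have [fd fp] := IHf oV; have [gd gp] := IHg oU; have [hd hp] := IHh oU.
  split.
    move=> x Ux.
    apply: (@differentiable_comp _ _ _ _ (fun x => (g x, h x)) f).
      by apply: differentiable_pair; [exact: gd|exact: hd].
    exact: fd (UV _ Ux).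
  move=> i; have [g' Eg' g'E] := gp i; have [h' Eh' h'E] := hp i.
  have [f0 Ef0 f0E] := fp 0; have [f1 Ef1 f1E] := fp 1.
  exists (fun x => g' x * f0 (g x, h x) + h' x * f1 (g x, h x)).
    by apply: SE_add; apply: SE_mul => //; apply: SE_comp oV UV _ _ _.
  move=> x Ux; rewrite -g'E // -h'E // -(f0E _ (UV _ Ux)) -(f1E _ (UV _ Ux)).
  apply: (pdE _ (fun x => pderiv i g x * pderiv 0 f (g x, h x) + pderiv i h x * pderiv 1 f (g x,
    h x))).
  apply: is_derive_comp2; try (by apply: dd; auto); auto.
Qed.

Lemma smooth_exprW U f : open U -> smooth_expr U f -> smooth_on U f.
Proof.
move=> oU Ef s.
have [g Eg gE] : exists2 g, smooth_expr U g & forall x, U x -> pderivs s f x = g x.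
  elim: s => [|i s [g Eg gE]]; first by exists f.
  have [_ /(_ i) [g' Eg' g'E]] := smooth_expr_derive Eg oU.
  exists g' => // x Ux; rewrite -g'E //=; exact: eq_on_derive gE.
have [gd _] := smooth_expr_derive Eg oU.
move=> x Ux; have gd' := gd x Ux; split.
  apply: (@eq_on_continuous _ _ U g) => //; first by move=> y Uy; rewrite gE.
  exact: differentiable_continuous.
move=> i; apply: (@eq_on_derivable _ _ U g) => //; first by move=> y Uy; rewrite gE.
exact: diff_derivable.
Qed.

End SmoothClosure.

Section SmoothOperations.
Context {R : realType}.
Implicit Types (U V : set (R * R)) (f g h : R * R -> R) (x : R * R) (i : 'I_2).

Lemma smooth_on_cst U (a : R) : open U -> smooth_on U (fun=> a).
Proof. by move=> oU; apply: smooth_exprW => //; exact: SE_const. Qed.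

Lemma smooth_on_linear2 U (a b : R) : open U -> smooth_on U (linear2 a b).
Proof. by move=> oU; apply: smooth_exprW => //; exact: SE_linear. Qed.

Lemma smooth_on_fst U : open U -> smooth_on U (fun x : R * R => x.1).
Proof.
move=> oU; apply: smooth_on_eq (smooth_on_linear2 1 0 oU) => // x _.
by rewrite /linear2 mulr1 mulr0 addr0.
Qed.

Lemma smooth_on_snd U : open U -> smooth_on U (fun x : R * R => x.2).
Proof.
move=> oU; apply: smooth_on_eq (smooth_on_linear2 0 1 oU) => // x _.
by rewrite /linear2 mulr1 mulr0 add0r.
Qed.

Lemma smooth_onD U f g : open U -> smooth_on U f -> smooth_on U g ->
  smooth_on U (fun x => f x + g x).
Proof. by move=> oU fU gU; apply: smooth_exprW => //; apply: SE_add; apply: SE_base. Qed.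

Lemma smooth_onM U f g : open U -> smooth_on U f -> smooth_on U g ->
  smooth_on U (fun x => f x * g x).
Proof. by move=> oU fU gU; apply: smooth_exprW => //; apply: SE_mul; apply: SE_base. Qed.

Lemma smooth_onN U f : open U -> smooth_on U f -> smooth_on U (fun x => - f x).
Proof.
move=> oU fU; apply: smooth_on_eq (smooth_onM oU (smooth_on_cst (-1) oU) fU) => // x _.
by rewrite mulN1r.
Qed.

Lemma smooth_onB U f g : open U -> smooth_on U f -> smooth_on U g ->
  smooth_on U (fun x => f x - g x).
Proof. by move=> oU fU gU; exact: (smooth_onD oU fU (smooth_onN oU gU)). Qed.

Lemma smooth_onV U f : open U -> (forall x, U x -> f x != 0) -> smooth_on U f ->
  smooth_on U (fun x => (f x)^-1).
Proof. by move=> oU f0 fU; apply: smooth_exprW => //; apply: SE_inv => //; apply: SE_base. Qed.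

Lemma smooth_on_sqrt U f : open U -> (forall x, U x -> 0 < f x) -> smooth_on U f ->
  smooth_on U (fun x => Num.sqrt (f x)).
Proof. by move=> oU f0 fU; apply: smooth_exprW => //; apply: SE_sqrt => //; apply: SE_base. Qed.

Lemma smooth_on_flat U f : open U -> smooth_on U f ->
  smooth_on U (fun x => flat (f x)).
Proof. by move=> oU fU; apply: smooth_exprW => //; apply: SE_flat; apply: SE_base. Qed.

Lemma smooth_on_comp U V f g h : open U -> open V ->
  (forall x, U x -> V (g x, h x)) ->
  smooth_on V f -> smooth_on U g -> smooth_on U h ->
  smooth_on U (fun x => f (g x, h x)).
Proof.
move=> oU oV UV fV gU hU; apply: smooth_exprW => //.
by apply: SE_comp oV UV _ _ _; apply: SE_base.
Qed.

Lemma smooth_on_sum U (I : Type) (r : seq I) (f : I -> R * R -> R) : open U ->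
  (forall k, smooth_on U (f k)) -> smooth_on U (fun x => \sum_(k <- r) f k x).
Proof.
move=> oU fU; elim: r => [|k r IH].
  by apply: smooth_on_eq (smooth_on_cst 0 oU) => // x _; rewrite big_nil.
by apply: smooth_on_eq (smooth_onD oU (fU k) IH) => // x _; rewrite big_cons.
Qed.

Lemma smooth_on_bigcup (W : normedModType R) U V (f : R * R -> W) :
  smooth_on U f -> smooth_on V f -> smooth_on (U `|` V) f.
Proof. by move=> fU fV s x [] h; [exact: fU|exact: fV]. Qed.

End SmoothOperations.

(** * Calculus of matrix-valued functions *)

Section MatrixDerivatives.
Context {R : realType} {V : normedModType R} {p q : nat}.
Implicit Types (x v : V) (f : V -> R) (F : V -> 'M[R]_(p, q)).

Lemma is_derive_mx F x v (D : 'M[R]_(p, q)) :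
  is_derive x v F D <-> forall a b, is_derive x v (fun y => F y a b) (D a b).
Proof.
split=> [[d <-] a b|H].
  apply: DeriveDef; first by move: d => /derivable_mxP.
  by rewrite derive_mx // mxE.
have d : derivable F x v by apply/derivable_mxP => a b; case: (H a b).
apply: DeriveDef => //; rewrite derive_mx //; apply/matrixP => a b; rewrite mxE.
by case: (H a b).
Qed.

Lemma is_derive_scale f F x v df dF : is_derive x v f df -> is_derive x v F dF ->
  is_derive x v (fun y => f y *: F y) (df *: F x + f x *: dF).
Proof.
move=> fd /is_derive_mx Fd; apply/is_derive_mx => a b; rewrite !mxE.
rewrite (_ : (fun y => _) = (fun y => f y * F y a b)).
  exact: is_derive_mul.
by apply/funext => y; rewrite mxE.
Qed.

Lemma is_derive_bigsum (W : normedModType R) (I : Type) (r : seq I) (f : I -> V ->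
  W) x v (df : I -> W) :
  (forall k, is_derive x v (f k) (df k)) ->
  is_derive x v (fun y => \sum_(k <- r) f k y) (\sum_(k <- r) df k).
Proof.
move=> H; elim: r => [|k r IH].
  rewrite big_nil (_ : (fun y => _) = cst 0); first exact: is_derive_cst.
  by apply/funext => y; rewrite big_nil.
rewrite big_cons (_ : (fun y => _) = (fun y => f k y + \sum_(k <- r) f k y)).
  exact: is_derive_add.
by apply/funext => y; rewrite big_cons.
Qed.

End MatrixDerivatives.

Section DotWedgeDerivatives.
Context {R : realType} {V : normedModType R} {m : nat}.
Implicit Types (x y : V) (u w : 'rV[R]_m) (F G : V -> 'rV[R]_m).

Lemma dotE u w : dot u w = \sum_a u 0 a * w 0 a.
Proof. by rewrite /dot mxE; apply: eq_bigr => a _; rewrite mxE. Qed.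

Lemma wedgeE u w a b : wedge u w a b = u 0 a * w 0 b - w 0 a * u 0 b.
Proof. by rewrite /wedge !mxE !big_ord1 !mxE. Qed.

Lemma is_derive_dot F G x v dF dG : is_derive x v F dF -> is_derive x v G dG ->
  is_derive x v (fun y => dot (F y) (G y)) (dot dF (G x) + dot (F x) dG).
Proof.
move=> /is_derive_mx Fd /is_derive_mx Gd.
rewrite (_ : (fun y => _) = (fun y => \sum_a F y 0 a * G y 0 a)).
  rewrite !dotE -big_split /=.
  by apply: is_derive_bigsum => a; apply: is_derive_mul.
by apply/funext => y; rewrite dotE.
Qed.

Lemma is_derive_wedge F G x v dF dG : is_derive x v F dF -> is_derive x v G dG ->
  is_derive x v (fun y => wedge (F y) (G y)) (wedge dF (G x) + wedge (F x) dG).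
Proof.
move=> /is_derive_mx Fd /is_derive_mx Gd; apply/is_derive_mx => a b.
rewrite (_ : (fun y => _) = (fun y => F y 0 a * G y 0 b - G y 0 a * F y 0 b)).
  rewrite mxE !wedgeE.
  have := is_derive_sub (is_derive_mul (Fd 0 a) (Gd 0 b)) (is_derive_mul (Gd 0 a) (Fd 0 b)).
  by move=> H; apply: is_derive_eq H _; ring.
by apply/funext => y; rewrite wedgeE.
Qed.

End DotWedgeDerivatives.

Section SmoothMatrix.
Context {R : realType} {p q : nat}.
Implicit Types (U : set (R * R)) (F G : R * R -> 'M[R]_(p, q)) (f : R * R -> R).

Lemma pderiv_mx F x i a b : derivable F x (basis2 i) ->
  pderiv i F x a b = pderiv i (fun y => F y a b) x.
Proof. by move=> d; rewrite /pderiv derive_mx // mxE. Qed.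

Lemma cvg_mx (T : Type) (l : set_system T) (H : Filter l) (G : T ->
  'M[R]_(p, q)) (A : 'M[R]_(p, q)) :
  (forall a b, G t a b @[t --> l] --> A a b) -> G t @[t --> l] --> A.
Proof.
move=> GA; apply/cvgrPdist_le => e e0; near=> t.
rewrite /Num.Def.normr/= mx_normrE (bigmax_le _ (ltW e0))//= => i _.
rewrite !mxE/=; move: i; near: t; apply: filter_forall => /= i.
by have /cvgrPdist_le := GA i.1 i.2; apply.
Unshelve. all: by end_near. Qed.

(** Taking an entry commutes with a derivative only where that derivative exists, so in both
    directions the iterated derivatives are compared by induction on their order. *)
Lemma smooth_on_mxP U F : open U ->
  smooth_on U F <-> forall a b, smooth_on U (fun x => F x a b).
Proof.
move=> oU; split=> [FU a b|FU].
  move=> s; have E x : U x -> pderivs s F x a b = pderivs s (fun y => F y a b) x.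
    elim: s x => [//|i s IH] x Ux /=.
    rewrite pderiv_mx; last by apply: (FU s x Ux).2.
    exact: eq_on_derive IH.
  move=> x Ux; have [c d] := FU s x Ux; split.
    apply: (eq_on_continuous oU Ux E).
    apply: (@continuous_comp _ _ _ (pderivs s F) (fun M : 'M[R]_(p, q) => M a b)) => //.
    exact: coord_continuous.
  move=> i; apply: (eq_on_derivable oU Ux E).
  by have /derivable_mxP := d i; exact.
move=> s.
have H : forall x, U x -> (forall a b, pderivs s F x a b = pderivs s (fun y => F y a b) x).
  elim: s => [//|i s IH] x Ux a b /=.
  rewrite pderiv_mx; first by apply: (eq_on_derive _ oU Ux) => y Uy; exact: IH.
  apply/derivable_mxP => c d.
  apply: (@eq_on_derivable _ _ U (pderivs s (fun y => F y c d)) _ _ _ oU Ux).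
    by move=> y Uy; rewrite IH.
  by apply: (FU c d s x Ux).2.
move=> x Ux; split.
  apply: cvg_mx => a b.
  apply: (@eq_on_continuous _ _ U (pderivs s (fun y => F y a b)) _ _ oU Ux).
    by move=> y Uy; rewrite H.
  by apply: (FU a b s x Ux).1.
move=> i; apply/derivable_mxP => a b.
apply: (@eq_on_derivable _ _ U (pderivs s (fun y => F y a b)) _ _ _ oU Ux).
  by move=> y Uy; rewrite H.
by apply: (FU a b s x Ux).2.
Qed.

Lemma smooth_on_mx_cst U (A : 'M[R]_(p, q)) : open U -> smooth_on U (fun=> A).
Proof. by move=> oU; apply/smooth_on_mxP => // a b; exact: smooth_on_cst. Qed.

Lemma smooth_on_mxD U F G : open U -> smooth_on U F -> smooth_on U G ->
  smooth_on U (fun x => F x + G x).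
Proof.
move=> oU /(smooth_on_mxP _ oU) FU /(smooth_on_mxP _ oU) GU.
apply/(smooth_on_mxP _ oU) => a b.
by apply: smooth_on_eq (smooth_onD oU (FU a b) (GU a b)) => // x _; rewrite mxE.
Qed.

Lemma smooth_on_scale U f F : open U -> smooth_on U f -> smooth_on U F ->
  smooth_on U (fun x => f x *: F x).
Proof.
move=> oU fU /(smooth_on_mxP _ oU) FU.
apply/(smooth_on_mxP _ oU) => a b.
by apply: smooth_on_eq (smooth_onM oU fU (FU a b)) => // x _; rewrite mxE.
Qed.

Lemma smooth_on_mxN U F : open U -> smooth_on U F -> smooth_on U (fun x => - F x).
Proof.
move=> oU FU; apply: smooth_on_eq (smooth_on_scale oU (smooth_on_cst (-1) oU) FU) => //.
by move=> x _; rewrite scaleN1r.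
Qed.

Lemma smooth_on_mxB U F G : open U -> smooth_on U F -> smooth_on U G ->
  smooth_on U (fun x => F x - G x).
Proof. by move=> oU FU GU; exact: (smooth_on_mxD oU FU (smooth_on_mxN oU GU)). Qed.

Lemma smooth_on_mx_sum U (I : Type) (r : seq I) (f : I -> R * R -> 'M[R]_(p, q)) : open U ->
  (forall k, smooth_on U (f k)) -> smooth_on U (fun x => \sum_(k <- r) f k x).
Proof.
move=> oU fU; elim: r => [|k r IH].
  by apply: smooth_on_eq (smooth_on_mx_cst 0 oU) => // x _; rewrite big_nil.
by apply: smooth_on_eq (smooth_on_mxD oU (fU k) IH) => // x _; rewrite big_cons.
Qed.

End SmoothMatrix.

Lemma smooth_on_dot (R : realType) (m : nat) (U : set (R * R)) (F G : R * R -> 'rV[R]_m) :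
  open U -> smooth_on U F -> smooth_on U G -> smooth_on U (fun x => dot (F x) (G x)).
Proof.
move=> oU /(smooth_on_mxP _ oU) FU /(smooth_on_mxP _ oU) GU.
apply: (@smooth_on_eq _ _ _ (fun x => \sum_a F x 0 a * G x 0 a)) => //.
  by move=> x _; rewrite dotE.
by apply: (smooth_on_sum _ oU) => a; exact: (smooth_onM oU).
Qed.

Lemma schwarz_mx (R : realType) (p q : nat) (U : set (R * R)) (F : R * R -> 'M[R]_(p, q))
    x i j : open U -> smooth_on U F -> U x ->
  pderiv i (pderiv j F) x = pderiv j (pderiv i F) x.
Proof.
move=> oU FU Ux; have /(smooth_on_mxP _ oU) cU := FU.
have E k l a b : pderiv k (pderiv l F) x a b = pderiv k (pderiv l (fun y => F y a b)) x.
  rewrite pderiv_mx; last exact: smooth_on_derivable (smooth_on_pderiv l FU) Ux.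
  apply: (eq_on_derive _ oU Ux) => y Uy; rewrite pderiv_mx //.
  exact: smooth_on_derivable Uy.
apply/matrixP => a b.
exact: (etrans (E i j a b) (etrans (schwarz i j oU (cU a b) Ux) (esym (E j i a b)))).
Qed.

(** * Geometry of an immersion in local coordinates *)

Lemma sum2E (W : nmodType) (f : 'I_2 -> W) : \sum_(i < 2) f i = f 0 + f 1.
Proof.
by rewrite big_ord_recl big_ord1; congr (_ + f _); apply: val_inj.
Qed.

Section DotAlgebra.
Context {R : realType} {m : nat}.
Implicit Types (u v w : 'rV[R]_m) (a : R).

Lemma dotC u v : dot u v = dot v u.
Proof. by rewrite !dotE; apply: eq_bigr => i _; rewrite mulrC. Qed.

Lemma dotDl u v w : dot (u + v) w = dot u w + dot v w.
Proof. by rewrite /dot mulmxDl mxE. Qed.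

Lemma dotNl u w : dot (- u) w = - dot u w.
Proof. by rewrite /dot mulNmx mxE. Qed.

Lemma dotZl a u w : dot (a *: u) w = a * dot u w.
Proof. by rewrite /dot -scalemxAl mxE. Qed.

Lemma dotDr u v w : dot w (u + v) = dot w u + dot w v.
Proof. by rewrite dotC dotDl !(dotC _ w). Qed.

Lemma dotNr u w : dot w (- u) = - dot w u.
Proof. by rewrite dotC dotNl dotC. Qed.

Lemma dotZr a u w : dot w (a *: u) = a * dot w u.
Proof. by rewrite dotC dotZl dotC. Qed.

Lemma dot0l u : dot 0 u = 0.
Proof. by rewrite /dot mul0mx mxE. Qed.

Lemma dot_ge0 u : 0 <= dot u u.
Proof. by rewrite dotE; apply: sumr_ge0 => i _; rewrite -expr2 sqr_ge0. Qed.

Lemma dot_eq0 u : dot u u = 0 -> u = 0.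
Proof.
rewrite dotE => /psumr_eq0P H; apply/rowP => i; rewrite mxE.
have /H : forall i, true -> 0 <= u 0 i * u 0 i by move=> j _; rewrite -expr2 sqr_ge0.
by move=> /(_ i isT) /eqP; rewrite mulf_eq0 orbb => /eqP.
Qed.

Definition dotE2 := (dotDl, dotDr, dotNl, dotNr, dotZl, dotZr).

End DotAlgebra.

(* Pointwise linear algebra of the tangent plane, for an arbitrary pair of
   vectors [P 0], [P 1] in place of the partial derivatives of an immersion. *)
Section Frame.
Context {R : realType} {m : nat}.
Variable P : 'I_2 -> 'rV[R]_m.
Implicit Types (i j k l : 'I_2) (u v : 'rV[R]_m).

Definition frame_mx : 'M[R]_(2, m) := \matrix_(i < 2) P i.

Definition gram_mx : 'M[R]_2 := \matrix_(i < 2, j < 2) dot (P i) (P j).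

Definition gram_det : R :=
  dot (P 0) (P 0) * dot (P 1) (P 1) - dot (P 0) (P 1) * dot (P 0) (P 1).

Definition gram_inv i j : R := invmx gram_mx i j.

Definition frame_normal v : 'rV[R]_m :=
  v *m proj_mx (kermx frame_mx^T) <<frame_mx>>%MS.

Lemma gram_mxE : gram_mx = frame_mx *m frame_mx^T.
Proof.
apply/matrixP => i j; rewrite [LHS]mxE [RHS]mxE dotE; apply: eq_bigr => a _.
by rewrite !mxE.
Qed.

Lemma det_gram_mx : \det gram_mx = gram_det.
Proof.
have e0 : lift (0 : 'I_2) (0 : 'I_1) = 1 by apply: val_inj.
have e1 : lift (1 : 'I_2) (0 : 'I_1) = 0 by apply: val_inj.
rewrite (expand_det_row _ 0) sum2E /cofactor !det_mx11 !mxE e0 e1.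
by rewrite expr0 expr1 mul1r mulN1r mulrN (dotC (P 1) (P 0)).
Qed.

Lemma gram_det_gt0 : row_free frame_mx -> 0 < gram_det.
Proof.
move=> fr.
have key (s t : R) : s *: P 0 + t *: P 1 = 0 -> s = 0 /\ t = 0.
  move=> st.
  pose w : 'rV[R]_2 := \row_i (if i == 0 then s else t).
  have w0 : w *m frame_mx = 0.
    by rewrite -st; apply/rowP => k; rewrite !mxE sum2E !mxE.
  have : w = 0 by apply: (row_free_inj fr); rewrite w0 mul0mx.
  move=> /rowP H; split; first by have := H 0; rewrite !mxE.
  by have := H 1; rewrite !mxE.
have a0 : 0 < dot (P 0) (P 0).
  rewrite lt_def dot_ge0 andbT; apply/eqP => /dot_eq0 F0.
  have [] := key 1 0; first by rewrite F0 scaler0 scale0r addr0.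
  by move=> /eqP; rewrite oner_eq0.
(* An unnormalized Gram-Schmidt step: the square of [v] is [dot (P 0) (P 0) * gram_det]. *)
pose v := dot (P 0) (P 0) *: P 1 - dot (P 0) (P 1) *: P 0.
have : 0 < dot v v.
  rewrite lt_def dot_ge0 andbT; apply/eqP => /dot_eq0 E.
  have [|_ a0'] := key (- dot (P 0) (P 1)) (dot (P 0) (P 0)).
    by rewrite addrC scaleNr.
  by rewrite a0' ltxx in a0.
rewrite /v !dotE2 (dotC (P 1) (P 0)).
rewrite (_ : _ + _ = dot (P 0) (P 0) * gram_det); first by rewrite pmulr_rgt0.
by rewrite /gram_det; ring.
Qed.

Hypothesis D0 : gram_det != 0.

(** The hypothesis in unfolded form, as [field] asks for it once [gram_det] is expanded. *)
Let D0' : dot (P 0) (P 0) * dot (P 1) (P 1) - dot (P 0) (P 1) * dot (P 0) (P 1) != 0.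
Proof. exact: D0. Qed.

Lemma gram_invE :
  [/\ gram_inv 0 0 = dot (P 1) (P 1) / gram_det,
      gram_inv 0 1 = - dot (P 0) (P 1) / gram_det,
      gram_inv 1 0 = - dot (P 0) (P 1) / gram_det &
      gram_inv 1 1 = dot (P 0) (P 0) / gram_det].
Proof.
pose M : 'M[R]_2 := \matrix_(i, j)
  (if i == 0 then if j == 0 then dot (P 1) (P 1) / gram_det
                  else - dot (P 0) (P 1) / gram_det
   else if j == 0 then - dot (P 0) (P 1) / gram_det
                  else dot (P 0) (P 0) / gram_det).
have ug : gram_mx \in unitmx by rewrite unitmxE det_gram_mx unitfE.
have MI : M *m gram_mx = 1%:M.
  apply/matrixP => i j; rewrite !mxE sum2E !mxE /gram_det.
  by case: (I2P i) => ->; case: (I2P j) => ->; rewrite /= ?(dotC (P 1) (P 0)); field.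
have E : invmx gram_mx = M.
  by rewrite -[RHS]mulmx1 -(mulmxV ug) mulmxA MI mul1mx.
by rewrite /gram_inv E !mxE.
Qed.

Lemma gram_invC i j : gram_inv i j = gram_inv j i.
Proof.
have [_ e1 e2 _] := gram_invE.
by case: (I2P i) => ->; case: (I2P j) => ->; rewrite // e1 e2.
Qed.

Lemma gram_invK i j : \sum_(k < 2) gram_inv i k * dot (P k) (P j) = (i == j)%:R.
Proof.
have ug : gram_mx \in unitmx by rewrite unitmxE det_gram_mx unitfE.
have := mulVmx ug => /matrixP /(_ i j); rewrite !mxE => <-.
by apply: eq_bigr => k _; rewrite [gram_mx k j]mxE.
Qed.

(* The tangential component is written in the basis [P]; the rest is orthogonal to it. *)
Lemma frame_normalE v : frame_normal v =
  v - \sum_(i < 2) \sum_(j < 2) (gram_inv i j * dot v (P i)) *: P j.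
Proof.
have [c00 c01 c10 c11] := gram_invE.
set t := \sum_(i < 2) _.
have tA : (t <= frame_mx)%MS.
  apply: summx_sub => i _; apply: summx_sub => j _; apply: scalemx_sub.
  have -> : P j = row j frame_mx by apply/rowP => k; rewrite !mxE.
  exact: row_sub.
have ndot i : dot (v - t) (P i) = 0.
  rewrite /t !sum2E !dotE2 c00 c01 c10 c11 /gram_det.
  by case: (I2P i) => ->; rewrite ?(dotC (P 1) (P 0)); field.
have nK : (v - t <= kermx frame_mx^T)%MS.
  apply/sub_kermxP/rowP => i; rewrite [LHS]mxE [RHS]mxE; apply: etrans (ndot i); rewrite dotE.
  by apply: eq_bigr => a _; rewrite !mxE.
have ug : gram_mx \in unitmx by rewrite unitmxE det_gram_mx unitfE.
have cap : (kermx frame_mx^T :&: <<frame_mx>> = 0)%MS.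
  apply/eqP; rewrite -submx0; apply/row_subP => i.
  have : (row i (kermx frame_mx^T :&: <<frame_mx>>) <=
          kermx frame_mx^T :&: <<frame_mx>>)%MS by exact: row_sub.
  move: (row i _) => u; rewrite sub_capmx => /andP[/sub_kermxP u1].
  rewrite genmxE => /submxP [w uE].
  move: u1; rewrite uE -mulmxA -gram_mxE => w0.
  have -> : w = 0 by rewrite -[w]mulmx1 -(mulmxV ug) mulmxA w0 mul0mx.
  by rewrite mul0mx sub0mx.
rewrite /frame_normal -[in LHS](subrK t v) mulmxDl.
by rewrite proj_mx_id // proj_mx_0 ?genmxE // addr0.
Qed.

Lemma frame_normal_tangent v i : dot (frame_normal v) (P i) = 0.
Proof.
have [c00 c01 c10 c11] := gram_invE.
rewrite frame_normalE !sum2E !dotE2 c00 c01 c10 c11 /gram_det.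
by case: (I2P i) => ->; rewrite ?(dotC (P 1) (P 0)); field.
Qed.

Lemma frame_normal_id v : (forall i, dot v (P i) = 0) -> frame_normal v = v.
Proof. by move=> H; rewrite frame_normalE !sum2E !H !mulr0 !scale0r !addr0 subr0. Qed.

Lemma frame_normal_frame i : frame_normal (P i) = 0.
Proof.
have [c00 c01 c10 c11] := gram_invE.
rewrite frame_normalE !sum2E c00 c01 c10 c11 /gram_det.
apply/rowP => a; rewrite !mxE.
by case: (I2P i) => ->; rewrite ?(dotC (P 1) (P 0)); field.
Qed.

Lemma frame_normalD u v : frame_normal (u + v) = frame_normal u + frame_normal v.
Proof. exact: mulmxDl. Qed.

Lemma frame_normalN u : frame_normal (- u) = - frame_normal u.
Proof. exact: mulNmx. Qed.

Lemma frame_normalZ a u : frame_normal (a *: u) = a *: frame_normal u.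
Proof. by rewrite /frame_normal -scalemxAl. Qed.

End Frame.

Section GramDerivatives.
Context {R : realType} {m : nat} {V : normedModType R}.
Variables (P : 'I_2 -> V -> 'rV[R]_m) (x v : V) (dP : 'I_2 -> 'rV[R]_m).
Hypothesis Pd : forall i, is_derive x v (P i) (dP i).
Implicit Types (i j k l : 'I_2).

Local Notation c := (gram_inv (P^~ x)).

Lemma is_derive_gram_det : is_derive x v (fun y => gram_det (P^~ y))
  (2 * (dot (dP 0) (P 0 x) * dot (P 1 x) (P 1 x) + dot (P 0 x) (P 0 x) * dot (dP 1) (P 1 x)
   - dot (P 0 x) (P 1 x) * (dot (dP 0) (P 1 x) + dot (dP 1) (P 0 x)))).
Proof.
have d i j := is_derive_dot (Pd i) (Pd j).
have H := is_derive_sub (is_derive_mul (d 0 0) (d 1 1)) (is_derive_mul (d 0 1) (d 0 1)).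
apply: is_derive_eq H _.
by rewrite (dotC (P 0 x) (dP 0)) (dotC (P 0 x) (dP 1)) (dotC (P 1 x) (dP 1)); ring.
Qed.

Hypothesis Dn : \forall y \near x, gram_det (P^~ y) != 0.

Let D0 : gram_det (P^~ x) != 0.
Proof. exact: nbhs_singleton Dn. Qed.

Let D0' : dot (P 0 x) (P 0 x) * dot (P 1 x) (P 1 x) - dot (P 0 x) (P 1 x) * dot (P 0 x) (P 1 x)
  != 0.
Proof. exact: D0. Qed.

(** The derivative of an inverse matrix, minus g^-1 dg g^-1, read off the cofactor formula entry by
    entry. The space [V] is arbitrary: the rule serves for partial derivatives on the plane and for
    the derivative in the parameter of a variation. *)
Lemma is_derive_gram_inv i j : is_derive x v (fun y => gram_inv (P^~ y) i j)
  (- \sum_(k < 2) \sum_(l < 2) c i k * c j l *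
      (dot (dP k) (P l x) + dot (P k x) (dP l))).
Proof.
have d i' j' := is_derive_dot (Pd i') (Pd j').
have dinv := @is_derive_inv _ _ (fun y => gram_det (P^~ y)) x v _ D0 is_derive_gram_det.
have [c00 c01 c10 c11] := gram_invE D0.
have E00 : \forall y \near x, dot (P 1 y) (P 1 y) * (gram_det (P^~ y))^-1 = gram_inv (P^~ y) 0 0.
  by apply: filterS Dn => y Dy; have [-> _ _ _] := gram_invE Dy.
have E01 : \forall y \near x, - dot (P 0 y) (P 1 y) * (gram_det (P^~ y))^-1 = gram_inv (P^~ y) 0 1.
  by apply: filterS Dn => y Dy; have [_ -> _ _] := gram_invE Dy.
have E10 : \forall y \near x, - dot (P 0 y) (P 1 y) * (gram_det (P^~ y))^-1 = gram_inv (P^~ y) 1 0.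
  by apply: filterS Dn => y Dy; have [_ _ -> _] := gram_invE Dy.
have E11 : \forall y \near x, dot (P 0 y) (P 0 y) * (gram_det (P^~ y))^-1 = gram_inv (P^~ y) 1 1.
  by apply: filterS Dn => y Dy; have [_ _ _ ->] := gram_invE Dy.
have H00 := near_eq_is_derive E00 (is_derive_mul (d 1 1) dinv).
have H01 := near_eq_is_derive E01 (is_derive_mul (is_derive_opp (d 0 1)) dinv).
have H10 := near_eq_is_derive E10 (is_derive_mul (is_derive_opp (d 0 1)) dinv).
have H11 := near_eq_is_derive E11 (is_derive_mul (d 0 0) dinv).
case: (I2P i) => ->; case: (I2P j) => ->;
  [apply: is_derive_eq H00 _|apply: is_derive_eq H01 _|
   apply: is_derive_eq H10 _|apply: is_derive_eq H11 _];
  rewrite !sum2E ?c00 ?c01 ?c10 ?c11 /gram_det ?(dotC (P 1 x) (P 0 x))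
    ?(dotC (P 0 x) (dP 0)) ?(dotC (P 0 x) (dP 1)) ?(dotC (P 1 x) (dP 1)) ?(dotC (P 1 x) (dP 0));
  by field.
Qed.

(** Jacobi's formula for the determinant. The factor 1/2 from the square root disappears because
    both arguments of each scalar product are differentiated. *)
Lemma is_derive_gram_density : 0 < gram_det (P^~ x) ->
  is_derive x v (fun y => Num.sqrt (gram_det (P^~ y)))
   (Num.sqrt (gram_det (P^~ x)) *
    \sum_(k < 2) \sum_(l < 2) c k l * dot (P k x) (dP l)).
Proof.
move=> Dpos; have [c00 c01 c10 c11] := gram_invE D0.
apply: is_derive_eq (@is_derive_sqrt _ _ (fun y => gram_det (P^~ y)) x v _ Dpos
  is_derive_gram_det) _.
set r := Num.sqrt _.
have r0 : r != 0 by rewrite gt_eqF // sqrtr_gt0.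
have r2 : gram_det (P^~ x) = r ^+ 2 by rewrite sqr_sqrtr // ltW.
rewrite !sum2E c00 c01 c10 c11 r2
    (dotC (P 0 x) (dP 0)) (dotC (P 0 x) (dP 1)) (dotC (P 1 x) (dP 1)) (dotC (P 1 x) (dP 0)).
by field.
Qed.

End GramDerivatives.

Section LocalExpressions.
Context {R : realType} {m : nat}.
Variables (U : set (R * R)) (F : R * R -> 'rV[R]_m).
Variables (P : 'I_2 -> R * R -> 'rV[R]_m) (Q : 'I_2 -> 'I_2 -> R * R -> 'rV[R]_m).
Implicit Types (i j k l : 'I_2) (y : R * R).

(* [P i] and [Q i j] name the partial derivatives of [F] of order one and two; as
   variables, they cannot be unfolded by unification. *)
Hypothesis oU : open U.
Hypothesis HP : forall y i, U y -> pderiv i F y = P i y.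
Hypothesis HQ : forall y i j, U y -> pderiv i (pderiv j F) y = Q i j y.
Hypothesis Pd : forall y i j, U y -> is_derive y (basis2 i) (P j) (Q i j y).
Hypothesis QC : forall y i j, U y -> Q i j y = Q j i y.
Hypothesis D0 : forall y, U y -> gram_det (P^~ y) != 0.

Local Notation c := (fun i j y => gram_inv (P^~ y) i j).

Let Dnear y : U y -> \forall z \near y, gram_det (P^~ z) != 0.
Proof. by move=> Uy; apply: filterS D0 _; apply: open_nbhs_nbhs. Qed.

Lemma frame_at y : U y -> (fun i => pderiv i F y) = P^~ y.
Proof. by move=> Uy; apply/funext => i; exact: HP. Qed.

Lemma metric_frame y i j : U y -> metric F i j y = dot (P i y) (P j y).
Proof. by move=> Uy; rewrite /metric mxE !HP. Qed.

Lemma metric_mx_frame y : U y -> metric_mx F y = gram_mx (P^~ y).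
Proof. by move=> Uy; rewrite -frame_at. Qed.

Lemma cometric_frame y i j : U y -> cometric F i j y = gram_inv (P^~ y) i j.
Proof. by move=> Uy; rewrite /cometric metric_mx_frame. Qed.

Lemma normal_proj_frame y v : U y -> normal_proj F y v = frame_normal (P^~ y) v.
Proof. by move=> Uy; rewrite -frame_at. Qed.

(** The Christoffel symbols of an induced metric: the derivatives of the metric are replaced by
    scalar products of derivatives of the immersion. *)
Definition christoffel_frame k i j y : R := \sum_(l < 2) c k l y * dot (Q i j y) (P l y).

(** The trace of the Christoffel symbols, which is also the logarithmic derivative of the volume
    density. *)
Definition trace_frame k y : R := \sum_(i < 2) \sum_(j < 2) c i j y * dot (P i y) (Q j k y).

Lemma metric_derivE y l i j : U y ->
  pderiv l (metric F i j) y = dot (Q l i y) (P j y) + dot (P i y) (Q l j y).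
Proof.
move=> Uy; have E : 'D_(basis2 l) (metric F i j) y = 'D_(basis2 l) (fun z => dot (P i z) (P j z)) y.
  by apply: (eq_on_derive _ oU Uy) => z Uz; exact: metric_frame.
rewrite /pderiv E.
by have [_ ->] := is_derive_dot (Pd l i Uy) (Pd l j Uy).
Qed.

(** By the symmetry of [Q], four of the six products in the derivatives of the metric cancel, and
    the other two are equal. *)
Lemma christoffelE y k i j : U y -> christoffel F k i j y = christoffel_frame k i j y.
Proof.
move=> Uy; rewrite /christoffel /christoffel_frame mulr_sumr; apply: eq_bigr => l _.
rewrite !metric_derivE // cometric_frame // (QC j i) // (QC l j) // (QC l i) //.
rewrite (dotC (P j y)) (dotC (P i y)).
by field.
Qed.

Lemma second_ffE y i j : U y ->
  second_ff F i j y = Q i j y - \sum_(k < 2) christoffel_frame k i j y *: P k y.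
Proof.
move=> Uy; rewrite /second_ff /nabla_covector HQ //; congr (_ - _).
by apply: eq_bigr => k _; rewrite christoffelE // HP.
Qed.

Lemma divergenceE (W : normedModType R) (X : 'I_2 -> R * R -> W) (dX : 'I_2 -> W) y : U y ->
  (forall j, is_derive y (basis2 j) (X j) (dX j)) ->
  divergence F X y = \sum_(j < 2) (dX j + trace_frame j y *: X j y).
Proof.
move=> Uy Xd; rewrite /divergence /nabla_vector !sum2E.
have pE j : pderiv j (X j) y = dX j by case: (Xd j).
rewrite !pE !christoffelE // !addrA [in LHS]addrAC.
rewrite -!addrA; congr (_ + _); rewrite !addrA.
set a := _ *: X 0 y; set b := _ *: X 1 y; set a' := _ *: X 0 y; set b' := _ *: X 1 y.
have -> : trace_frame 0 y = christoffel_frame 0 0 0 y + christoffel_frame 1 1 0 y.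
  rewrite /trace_frame /christoffel_frame !sum2E (gram_invC (D0 Uy) 1 0) ?(QC 1 0 Uy).
  by rewrite !(dotC (P _ y)); ring.
have -> : trace_frame 1 y = christoffel_frame 0 0 1 y + christoffel_frame 1 1 1 y.
  rewrite /trace_frame /christoffel_frame !sum2E (gram_invC (D0 Uy) 1 0) ?(QC 1 0 Uy).
  by rewrite !(dotC (P _ y)); ring.
rewrite !scalerDl -/a -/b -/a' -/b'.
by rewrite [LHS](ACl (1*5*3*2*4)%AC) /= !addrA.
Qed.

Lemma is_derive_on (W : normedModType R) (f g : R * R -> W) y v df : U y ->
  (forall z, U z -> f z = g z) -> is_derive y v f df -> is_derive y v g df.
Proof. by move=> Uy fg; apply: near_eq_is_derive; exact: eq_on_near fg. Qed.

Definition cometric_deriv k i j y : R := - \sum_(p < 2) \sum_(q < 2) c i p y * c j q y *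
  (dot (Q k p y) (P q y) + dot (P p y) (Q k q y)).

Lemma is_derive_cometric y k i j : U y ->
  is_derive y (basis2 k) (c i j) (cometric_deriv k i j y).
Proof.
move=> Uy.
exact: (is_derive_gram_inv (fun p => Pd k p Uy) (Dnear Uy) i j).
Qed.

(** Both sides are the Laplacian of the [k]-th coordinate function. It collects the first-order
    terms whenever the divergence of a gradient is expanded. *)
Lemma div_cometric k y : U y ->
  \sum_(i < 2) (cometric_deriv i i k y + trace_frame i y * c i k y) =
  - \sum_(i < 2) \sum_(j < 2) c i j y * christoffel_frame k i j y.
Proof.
move=> Uy; rewrite /cometric_deriv /trace_frame /christoffel_frame !sum2E.
rewrite ?(gram_invC (D0 Uy) 1 0) ?(QC 1 0 Uy).
case: (I2P k) => ->; rewrite ?(gram_invC (D0 Uy) 1 0) !(dotC (P _ y)); ring.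
Qed.

Lemma div_gradE (p q : nat) (u : R * R -> 'M[R]_(p, q)) (du : 'I_2 -> R * R -> 'M[R]_(p, q))
    (ddu : 'I_2 -> 'I_2 -> 'M[R]_(p, q)) y : U y ->
  (forall z i, U z -> pderiv i u z = du i z) ->
  (forall i j, is_derive y (basis2 i) (du j) (ddu i j)) ->
  divergence F (grad F u) y = \sum_(i < 2) \sum_(j < 2)
    c i j y *: (ddu i j - \sum_(k < 2) christoffel_frame k i j y *: du k y).
Proof.
move=> Uy uE ud.
pose X j z := \sum_(k < 2) c j k z *: du k z.
have gE j z : U z -> X j z = grad F u j z.
  by move=> Uz; apply: eq_bigr => k _; rewrite cometric_frame // uE.
have Xd j : is_derive y (basis2 j) (X j)
    (\sum_(k < 2) (cometric_deriv j j k y *: du k y + c j k y *: ddu j k)).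
  apply: is_derive_bigsum => k; apply: is_derive_scale (ud j k).
  exact: is_derive_cometric.
have gd j := is_derive_on Uy (gE j) (Xd j).
rewrite (divergenceE Uy gd) !sum2E -!gE // /X !sum2E.
have e0 := div_cometric 0 Uy; have e1 := div_cometric 1 Uy.
rewrite !sum2E in e0 e1.
apply/matrixP => a b; rewrite !mxE.
have lin (s0 s1 w0 w1 r : R) (u0 u1 : R) :
  s0 = - w0 -> s1 = - w1 -> r + s0 * u0 + s1 * u1 = r - w0 * u0 - w1 * u1.
  by move=> -> ->; ring.
move: (lin _ _ _ _ (c 0 0 y * ddu 0 0 a b + c 0 1 y * ddu 0 1 a b +
   (c 1 0 y * ddu 1 0 a b + c 1 1 y * ddu 1 1 a b)) (du 0 y a b) (du 1 y a b) e0 e1).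
set e := (X in X = _ -> _); set e' := (X in _ = X -> _).
move=> E; transitivity e; first by rewrite /e; ring.
by rewrite E /e'; ring.
Qed.

(** The second fundamental form: the subtracted sum is the tangential part of [Q i j]. *)
Definition second_frame i j y := Q i j y - \sum_(k < 2) christoffel_frame k i j y *: P k y.

Lemma second_frame_normal i j l y : U y -> dot (second_frame i j y) (P l y) = 0.
Proof.
move=> Uy; rewrite /second_frame /christoffel_frame dotDl dotNl.
rewrite (_ : dot (\sum_(k < 2) _) _ = dot (Q i j y) (P l y)) ?subrr //.
rewrite !sum2E !dotDl !dotZl.
have e0 := gram_invK (D0 Uy) 0 l; have e1 := gram_invK (D0 Uy) 1 l.
rewrite !sum2E in e0 e1.
rewrite (gram_invC (D0 Uy) 1 0) in e1 *.
have : dot (Q i j y) (P 0 y) * (c 0 0 y * dot (P 0 y) (P l y) + c 0 1 y * dot (P 1 y) (P l y))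
  + dot (Q i j y) (P 1 y) * (c 0 1 y * dot (P 0 y) (P l y) + c 1 1 y * dot (P 1 y) (P l y))
  = dot (Q i j y) (P l y).
  by rewrite e0 e1; case: (I2P l) => -> /=; ring.
by move=> <-; ring.
Qed.

Lemma mean_curvature_frame y : U y ->
  mean_curvature F y = 2^-1 *: \sum_(i < 2) \sum_(j < 2) c i j y *: second_frame i j y.
Proof.
move=> Uy; congr (_ *: _); apply: eq_bigr => i _; apply: eq_bigr => j _.
by rewrite cometric_frame // second_ffE.
Qed.

Lemma mean_curvature_normal l y : U y -> dot (mean_curvature F y) (P l y) = 0.
Proof.
move=> Uy; rewrite mean_curvature_frame //.
have: forall i j, dot (second_frame i j y) (P l y) = 0 by move=> i j; exact: second_frame_normal.
move: second_frame => s s0.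
by rewrite !sum2E !dotE2 !s0 !mulr0 !addr0 mulr0.
Qed.

Lemma div_gradF y : U y -> divergence F (grad F F) y = 2 *: mean_curvature F y.
Proof.
move=> Uy; rewrite (div_gradE Uy HP (fun i j => Pd i j Uy)).
by rewrite mean_curvature_frame // scalerA mulfV ?scale1r.
Qed.

Lemma is_derive_grad (p q : nat) (u : R * R -> 'M[R]_(p, q)) (du : 'I_2 -> R * R -> 'M[R]_(p, q))
    (ddu : 'I_2 -> 'I_2 -> 'M[R]_(p, q)) y i j : U y ->
  (forall z i, U z -> pderiv i u z = du i z) ->
  (forall i j, is_derive y (basis2 i) (du j) (ddu i j)) ->
  is_derive y (basis2 i) (grad F u j)
    (\sum_(k < 2) (cometric_deriv i j k y *: du k y + c j k y *: ddu i k)).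
Proof.
move=> Uy uE ud.
have gE z : U z -> \sum_(k < 2) c j k z *: du k z = grad F u j z.
  by move=> Uz; apply: eq_bigr => k _; rewrite cometric_frame // uE.
apply: (is_derive_on Uy gE).
apply: is_derive_bigsum => k; apply: is_derive_scale (ud i k).
exact: is_derive_cometric.
Qed.


(** Opaque names once more: [N] and [M] for the derivatives of the mean curvature of order one and
    two, [T3] for the third derivatives of the immersion. Together with [QC], the hypothesis [T3C]
    makes [T3] symmetric in all its indices. *)
Variables (H : R * R -> 'rV[R]_m) (N : 'I_2 -> R * R -> 'rV[R]_m).
Variables (M : 'I_2 -> 'I_2 -> R * R -> 'rV[R]_m).
Variable T3 : 'I_2 -> 'I_2 -> 'I_2 -> R * R -> 'rV[R]_m.
Hypothesis HH : mean_curvature F = H.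
Hypothesis Fd : forall y i, U y -> is_derive y (basis2 i) F (P i y).
Hypothesis Hd : forall y i, U y -> is_derive y (basis2 i) H (N i y).
Hypothesis HN : forall y i, U y -> pderiv i H y = N i y.
Hypothesis Nd : forall y i j, U y -> is_derive y (basis2 i) (N j) (M i j y).
Hypothesis Qd : forall y i j k, U y -> is_derive y (basis2 k) (Q i j) (T3 k i j y).
Hypothesis T3C : forall y i j k, U y -> T3 k i j y = T3 i k j y.

Local Notation b := (fun i j y => dot (H y) (Q i j y)).

Let HP0 l y : U y -> dot (H y) (P l y) = 0.
Proof. by move=> Uy; rewrite -HH; exact: mean_curvature_normal. Qed.

Let T3C' y i j k : U y -> T3 k i j y = T3 k j i y.
Proof.
move=> Uy; have [_ <-] := Qd i j k Uy; have [_ <-] := Qd j i k Uy.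
by apply: (eq_on_derive _ oU Uy) => z Uz; exact: QC.
Qed.

Let HE y : U y -> H y = 2^-1 *: \sum_(i < 2) \sum_(j < 2) c i j y *: second_frame i j y.
Proof. by move=> Uy; rewrite -HH mean_curvature_frame. Qed.

Lemma second_frame_dot i j y : U y -> dot (second_frame i j y) (H y) = b i j y.
Proof.
move=> Uy; rewrite /second_frame dotDl dotNl sum2E dotDl !dotZl.
by rewrite !(dotC (P _ y)) !HP0 // !mulr0 addr0 subr0 dotC.
Qed.

(** The Weingarten relation, obtained by differentiating [dot H (P j) = 0]. *)
Lemma dN_P i j y : U y -> dot (N i y) (P j y) = - b i j y.
Proof.
move=> Uy; have [_ E1] := is_derive_dot (Hd i Uy) (Pd i j Uy).
have E0 : 'D_(basis2 i) (fun z => dot (H z) (P j z)) y = 0.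
  rewrite -[RHS](derive_cst (0 : R) y (basis2 i)).
  by apply: (eq_on_derive _ oU Uy) => z Uz; exact: HP0.
by apply/eqP; rewrite -addr_eq0 -E1 E0.
Qed.

Lemma trace_b y : U y ->
  \sum_(i < 2) \sum_(j < 2) c i j y * b i j y = 2 * dot (H y) (H y).
Proof.
move=> Uy; transitivity (2 * dot (2^-1 *: \sum_(i < 2) \sum_(j < 2) c i j y *: second_frame i j
  y) (H y)); last by rewrite -HE.
have: forall i j, dot (second_frame i j y) (H y) = b i j y by move=> i j; exact: second_frame_dot.
move: second_frame => s sb; rewrite !sum2E.
by rewrite !dotE2 !sb; field.
Qed.

(* Trace of the Codazzi equation, tested against [H]. *)
Lemma codazzi_trace l y : U y ->
  \sum_(i < 2) \sum_(j < 2) (cometric_deriv l i j y * b i j y + c i j y * dot (H y) (T3 l i j y)) =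
  2 * dot (N l y) (H y) +
  \sum_(k < 2) (\sum_(i < 2) \sum_(j < 2) c i j y * christoffel_frame k i j y) * b l k y.
Proof.
move=> Uy.
(* [X] is [2 *: H] plus a tangent vector, so its product with [H] is twice the square of [H]. This
   identity is differentiated in the direction [l]. *)
pose X z := \sum_(i < 2) \sum_(j < 2) c i j z *: Q i j z.
have Xd : is_derive y (basis2 l) X (\sum_(i < 2) \sum_(j < 2)
    (cometric_deriv l i j y *: Q i j y + c i j y *: T3 l i j y)).
  apply: is_derive_bigsum => i; apply: is_derive_bigsum => j.
  by apply: is_derive_scale (Qd i j l Uy); exact: is_derive_cometric.
have [_ E1] := is_derive_dot (Hd l Uy) Xd.
have [_ E2] := is_derive_mul (is_derive_cst (2 : R) y (basis2 l)) (is_derive_dot (Hd l Uy) (Hd l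
  Uy)).
have E : 'D_(basis2 l) (fun z => dot (H z) (X z)) y = 'D_(basis2 l) (fun z => 2 * dot (H z) (H
  z)) y.
  apply: (eq_on_derive _ oU Uy) => z Uz; rewrite -trace_b //.
  by rewrite /X !sum2E !dotDr !dotZr.
move: E; rewrite E1 E2 /X => {E1 E2 Xd X}.
(* The derivative [N l] of [H] is not normal: it sees the tangential part of [X], through the
   Weingarten relation. *)
have NH : dot (N l y) (\sum_(i < 2) \sum_(j < 2) c i j y *: Q i j y) =
   2 * dot (N l y) (H y) - \sum_(k < 2) (\sum_(i < 2) \sum_(j < 2) c i j y * christoffel_frame k
     i j y) * b l k y.
  have -> : dot (N l y) (H y) = dot (N l y) (2^-1 *: \sum_(i < 2) \sum_(j < 2) c i j y *:
    second_frame i j y).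
    by rewrite -HE.
  rewrite /second_frame.
  have E i k : dot (N i y) (P k y) = - b i k y by exact: dN_P.
  move: christoffel_frame => G.
  by rewrite !sum2E !dotE2 !E; field.
rewrite NH !sum2E !dotE2 (dotC (H y) (N l y)) mul0r add0r => E.
apply/eqP; rewrite -subr_eq0; apply/eqP.
move/eqP: E; rewrite -subr_eq0 => /eqP E; rewrite -[RHS]E; ring.
Qed.

(** By the Weingarten relation, the coefficients of the tangential part of the gradient of [H]:
    minus [b] with both indices raised. *)
Definition tangential_coef j l y : R :=
  - \sum_(i < 2) \sum_(k < 2) c j i y * b i k y * c k l y.

Definition tangential j y := \sum_(l < 2) tangential_coef j l y *: P l y.

Lemma gradH_frame j y : U y -> grad F H j y = \sum_(k < 2) c j k y *: N k y.
Proof. by move=> Uy; apply: eq_bigr => k _; rewrite cometric_frame // HN. Qed.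

Lemma gradF_frame j y : U y -> grad F F j y = \sum_(k < 2) c j k y *: P k y.
Proof. by move=> Uy; apply: eq_bigr => k _; rewrite cometric_frame // HP. Qed.

Lemma normal_gradH j y : U y ->
  normal_proj F y (grad F H j y) = \sum_(k < 2) c j k y *: N k y - tangential j y.
Proof.
move=> Uy; rewrite normal_proj_frame // frame_normalE ?D0 // gradH_frame //.
congr (_ - _); rewrite /tangential /tangential_coef.
have E i k : dot (N i y) (P k y) = - b i k y by exact: dN_P.
rewrite !sum2E !dotE2 !E ?(QC 1 0 Uy) (gram_invC (D0 Uy) 1 0).
apply/rowP => a; rewrite !mxE.
by case: (I2P j) => ->; rewrite ?(gram_invC (D0 Uy) 1 0); ring.
Qed.

Lemma stress_frame j y : U y -> stress F j y =
  2 *: tangential j y - \sum_(k < 2) c j k y *: N k y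
  + dot (H y) (H y) *: \sum_(k < 2) c j k y *: P k y.
Proof.
move=> Uy; rewrite /stress HH normal_gradH // gradH_frame // gradF_frame //.
congr (_ + _); apply/rowP => a; rewrite !mxE; ring.
Qed.

(** Subtracting the normal part twice reflects it. In this form the normal part of [div T] can be
    read off term by term, the projected gradient giving the normal Laplacian. *)
Lemma stress_split j y : U y -> stress F j y =
  tangential j y - normal_proj F y (grad F H j y) + dot (H y) (H y) *: grad F F j y.
Proof.
move=> Uy; rewrite stress_frame // normal_gradH // gradF_frame //.
congr (_ + _); apply/rowP => a; rewrite !mxE; ring.
Qed.

Lemma stress_P j l y : U y ->
  dot (stress F j y) (P l y) =
  - \sum_(k < 2) c j k y * b k l y + (j == l)%:R * dot (H y) (H y).
Proof.
move=> Uy; rewrite stress_frame // !dotDl dotNl !dotZl.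
have E i k : dot (N i y) (P k y) = - b i k y by exact: dN_P.
have cP k l' := gram_invK (D0 Uy) k l'.
have -> : dot (\sum_(k < 2) c j k y *: P k y) (P l y) = (j == l)%:R.
  by rewrite -(cP j l) !sum2E !dotE2.
have -> : dot (tangential j y) (P l y) = - \sum_(i < 2) c j i y * b i l y.
  have e0 := cP 0 l; have e1 := cP 1 l.
  rewrite /tangential /tangential_coef !sum2E in e0 e1 *.
  rewrite !dotE2.
  transitivity (- (c j 0 y * (b 0 0 y * (c 0 0 y * dot (P 0 y) (P l y) + c 0 1 y * dot (P 1 y) (P
    l y))
     + b 0 1 y * (c 1 0 y * dot (P 0 y) (P l y) + c 1 1 y * dot (P 1 y) (P l y))) +
     c j 1 y * (b 1 0 y * (c 0 0 y * dot (P 0 y) (P l y) + c 0 1 y * dot (P 1 y) (P l y))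
     + b 1 1 y * (c 1 0 y * dot (P 0 y) (P l y) + c 1 1 y * dot (P 1 y) (P l y))))).
    by ring.
  by rewrite e0 e1; case: (I2P l) => -> /=; ring.
by rewrite !sum2E !dotE2 !E; ring.
Qed.

Variable dT : 'I_2 -> 'I_2 -> R * R -> 'rV[R]_m.
Hypothesis Td : forall y i j, U y -> is_derive y (basis2 i) (stress F j) (dT i j y).

(** Differentiating [stress_P] gives the tangential components of the derivatives of the stress
    without computing these derivatives. *)
Lemma dstress_P i j l y : U y ->
  dot (dT i j y) (P l y) + dot (stress F j y) (Q i l y) =
  - \sum_(k < 2) (cometric_deriv i j k y * b k l y +
       c j k y * (dot (N i y) (Q k l y) + dot (H y) (T3 i k l y)))
  + (j == l)%:R * (2 * dot (N i y) (H y)).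
Proof.
move=> Uy; have [_ <-] := is_derive_dot (Td i j Uy) (Pd i l Uy).
have E : 'D_(basis2 i) (fun z => dot (stress F j z) (P l z)) y =
  'D_(basis2 i) (fun z => - \sum_(k < 2) c j k z * dot (H z) (Q k l z) +
      (j == l)%:R * dot (H z) (H z)) y.
  by apply: (eq_on_derive _ oU Uy) => z Uz; exact: stress_P.
rewrite E.
have d1 := is_derive_opp (is_derive_bigsum (index_enum 'I_2)
  (fun k => is_derive_mul (is_derive_cometric i j k Uy) (is_derive_dot (Hd i Uy) (Qd k l i Uy)))).
have d2 := is_derive_mul (is_derive_cst ((j == l)%:R : R) y (basis2 i))
   (is_derive_dot (Hd i Uy) (Hd i Uy)).
have [_ ->] := is_derive_add d1 d2.
rewrite (dotC (H y) (N i y)); congr (_ + _); ring.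
Qed.

(** Contraction of [dstress_P] produces third derivatives of [F] tested against [H]; their symmetry
    turns them into the trace that [codazzi_trace] evaluates as a derivative of the square of
    [H]. *)
Lemma div_stress_P l y : U y -> dot (divergence F (stress F) y) (P l y) = 0.
Proof.
move=> Uy; rewrite (divergenceE Uy (fun j => Td j j Uy)).
have Ed j := dstress_P j j l Uy.
have Ep j := stress_P j l Uy.
have Es j : dot (stress F j y) (Q j l y) = dot (2 *: tangential j y - \sum_(k < 2) c j k y *: N k y
  + dot (H y) (H y) *: \sum_(k < 2) c j k y *: P k y) (Q j l y) by rewrite stress_frame.
have E0 := div_cometric 0 Uy; have E1 := div_cometric 1 Uy; have ET := codazzi_trace l Uy.
(* The free index [l] is moved to the place that it has in [codazzi_trace]. *)
have Tl i k : T3 k i l y = T3 l k i y by rewrite -T3C' // T3C.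
have Ed' j : dot (dT j j y) (P l y) = - \sum_(k < 2) (cometric_deriv j j k y * b k l y +
       c j k y * (dot (N j y) (Q k l y) + dot (H y) (T3 l j k y)))
  + (j == l)%:R * (2 * dot (N j y) (H y)) - dot (2 *: tangential j y - \sum_(k < 2) c j k y *: N k y
  + dot (H y) (H y) *: \sum_(k < 2) c j k y *: P k y) (Q j l y).
  rewrite -Es; apply: (@addIr _ (dot (stress F j y) (Q j l y))); rewrite subrK Ed; congr (- _ + _).
  by apply: eq_bigr => k _; rewrite Tl.
move: Ed' Ep; clear Ed Es; move: (stress F) => St Ed Ep.
rewrite sum2E !dotDl !dotZl !Ed !Ep.
rewrite !sum2E in E0 E1 ET *.
set w0 := (c 0 0 y * _ + _ + _) in E0 ET; set w1 := (c 0 0 y * _ + _ + _) in E1 ET.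
move: w0 w1 E0 E1 ET => w0 w1 E0 E1 ET.
set X0 := dot (_ + _) (Q 0 l y); set X1 := dot (_ + _) (Q 1 l y).
(* What is left once the differential identities are used up: a polynomial identity in [P], [Q],
   [H], [N] and the cometric. *)
have rest : cometric_deriv l 0 0 y * b 0 0 y + cometric_deriv l 0 1 y * b 0 1 y +
    (cometric_deriv l 1 0 y * b 1 0 y + cometric_deriv l 1 1 y * b 1 1 y)
   - (c 0 0 y * dot (N 0 y) (Q 0 l y) + c 0 1 y * dot (N 0 y) (Q 1 l y) +
     (c 1 0 y * dot (N 1 y) (Q 0 l y) + c 1 1 y * dot (N 1 y) (Q 1 l y))) - X0 - X1
   + trace_frame l y * dot (H y) (H y) = 0.
  rewrite /X0 /X1 /tangential /tangential_coef /cometric_deriv /trace_frame !sum2E !dotE2.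
  rewrite (gram_invC (D0 Uy) 1 0).
  by case: (I2P l) => ->; rewrite ?(QC 1 0 Uy) !(dotC (P _ y)); ring.
have := rest; move/eqP: E0; rewrite -subr_eq0 => /eqP E0.
move/eqP: E1; rewrite -subr_eq0 => /eqP E1.
move/eqP: ET; rewrite -subr_eq0 => /eqP ET.
move=> rest0; rewrite -[RHS]rest0.
apply/eqP; rewrite -subr_eq0; apply/eqP.
(* The goal minus [rest] is this combination of the two components of [div_cometric] and of
   [codazzi_trace]. *)
have comb (x0 x1 x2 : R) : x0 = 0 -> x1 = 0 -> x2 = 0 ->
  (0 : R) = - b 0 l y * x0 - b 1 l y * x1 - x2 by move=> -> -> ->; ring.
rewrite [RHS](comb _ _ _ E0 E1 ET).
move: X0 X1 {rest rest0 E0 E1 ET Ed Ep} => X0 X1.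
by case: (I2P l) => -> /=; rewrite ?(QC 1 0 Uy); ring.
Qed.

Lemma div_stress_dot y : U y ->
  divergence F (fun j z => dot (stress F j z) (F z)) y = dot (divergence F (stress F) y) (F y).
Proof.
move=> Uy.
have d j := is_derive_dot (Td j j Uy) (Fd j Uy).
rewrite (divergenceE Uy d) (divergenceE Uy (fun j => Td j j Uy)).
have Ep j : dot (stress F j y) (P j y) = - \sum_(k < 2) c j k y * b k j y + dot (H y) (H y).
  by rewrite stress_P // eqxx mul1r.
move: Ep; move: (stress F) => St Ep; have tr := trace_b Uy.
rewrite !sum2E in tr *; rewrite !dotDl !dotZl !Ep !sum2E.
apply/eqP; rewrite -subr_eq0; apply/eqP.
move/eqP: tr; rewrite -subr_eq0 => /eqP tr; transitivity (- (0 : R)); last by rewrite oppr0.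
rewrite -[X in _ = - X]tr /GRing.scale /= ?(QC 1 0 Uy) ?(gram_invC (D0 Uy) 1 0); ring.
Qed.

Lemma div_stress_wedge y : U y ->
  divergence F (fun j z => wedge (stress F j z) (F z) + wedge (H z) (grad F F j z)) y
  = wedge (divergence F (stress F) y) (F y).
Proof.
move=> Uy.
have gd j := is_derive_grad j j Uy HP (fun i j => Pd i j Uy).
have d j := is_derive_add (is_derive_wedge (Td j j Uy) (Fd j Uy)) (is_derive_wedge (Hd j Uy) (gd
  j)).
rewrite (divergenceE Uy d) (divergenceE Uy (fun j => Td j j Uy)).
have := div_gradF Uy; rewrite (divergenceE Uy gd) HH.
have Es j := stress_frame j Uy; have Eg j := gradF_frame j Uy.
move: (stress F) (grad F F) Es Eg => St Gr Es Eg.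
rewrite !sum2E !Eg !sum2E => E.
have Ea a : _ = _ := congr1 (fun v : 'rV_m => v 0 a) E.
apply/matrixP => a e.
have E0 := Ea a; have E1 := Ea e.
have aD (p q : nat) (A B : 'M[R]_(p, q)) (i : 'I_p) (j : 'I_q) : (A + B) i j = A i j + B i j by
  rewrite mxE.
have aN (p q : nat) (A : 'M[R]_(p, q)) (i : 'I_p) (j : 'I_q) : (- A) i j = - A i j by rewrite mxE.
have aZ (p q : nat) (A : 'M[R]_(p, q)) (k : R) (i : 'I_p) (j : 'I_q) : (k *: A) i j = k * A i j
  by rewrite mxE.
rewrite !(aD, aZ) in E0 E1.
move/eqP: E0; rewrite -subr_eq0 => /eqP E0; move/eqP: E1; rewrite -subr_eq0 => /eqP E1.
apply/eqP; rewrite -subr_eq0; apply/eqP.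
(* The component (a, e) of the wedge product of [H] with [Laplacian F - 2 *: H], which vanishes. *)
have comb (x0 x1 : R) : x0 = 0 -> x1 = 0 -> (0 : R) = H y 0 a * x1 - H y 0 e * x0.
  by move=> -> ->; ring.
rewrite [RHS](comb _ _ E0 E1).
have := @wedgeE R m; move: (@wedge R m) => W WE.
rewrite !(aD, aZ) !WE !(aD, aZ) !Es /tangential /tangential_coef !sum2E.
rewrite !(aD, aZ, aN) ?(QC 1 0 Uy) ?(gram_invC (D0 Uy) 1 0).
ring.
Qed.

Lemma frame_normal_Q i j y : U y -> frame_normal (P^~ y) (Q i j y) = second_frame i j y.
Proof.
move=> Uy; have -> : Q i j y = second_frame i j y + \sum_(k < 2) christoffel_frame k i j y *: P k y.
  by rewrite /second_frame subrK.
rewrite frame_normalD frame_normal_id ?D0 //; last by move=> l; exact: second_frame_normal.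
by rewrite sum2E frame_normalD !frame_normalZ !(frame_normal_frame (D0 Uy)) !scaler0 !addr0.
Qed.

(** The quadratic term of the Willmore vector. The right-hand side is, up to sign, the normal part
    of the derivative of the tangential half of the stress. *)
Lemma second_ff_square y : U y ->
  \sum_(i < 2) \sum_(j < 2) dot (second_ff_mixed F i j y) (H y) *: second_ff_mixed F j i y =
  - \sum_(j < 2) \sum_(l < 2) tangential_coef j l y *: second_frame j l y.
Proof.
move=> Uy.
have E i j : second_ff_mixed F i j y = \sum_(k < 2) c i k y *: second_frame k j y.
  by apply: eq_bigr => k _; rewrite cometric_frame // second_ffE.
have Ed i j : dot (second_ff_mixed F i j y) (H y) = \sum_(k < 2) c i k y * b k j y.
  by rewrite E sum2E dotDl !dotZl !second_frame_dot // sum2E.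
have SC i j : second_frame i j y = second_frame j i y.
  by rewrite /second_frame /christoffel_frame (QC i j Uy).
move: (second_ff_mixed F) second_frame E Ed SC => s2 s E Ed SC.
rewrite !sum2E !Ed !E.
rewrite /tangential_coef !sum2E (SC 1 0) (QC 1 0 Uy) (gram_invC (D0 Uy) 1 0).
apply/rowP => a; rewrite !mxE; ring.
Qed.

Lemma div_stressE y : U y -> divergence F (stress F) y = - willmore_vector F y.
Proof.
move=> Uy.
have ds j l := is_derive_opp (is_derive_bigsum (index_enum 'I_2) (fun i =>
  is_derive_bigsum (index_enum 'I_2) (fun k => is_derive_mul
    (is_derive_mul (is_derive_cometric j j i Uy) (is_derive_dot (Hd j Uy) (Qd i k j Uy)))
    (is_derive_cometric j k l Uy)))).
(* These derivatives only multiply tangent vectors, so their values can be forgotten before the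
   projection. *)
have [s' ds'] : exists s', forall j l, is_derive y (basis2 j) (tangential_coef j l) (s' j l).
  by eexists; move=> j l; exact: ds.
have dS j : is_derive y (basis2 j) (tangential j)
    (\sum_(l < 2) (s' j l *: P l y + tangential_coef j l y *: Q j l y)).
  by apply: is_derive_bigsum => l; apply: is_derive_scale (ds' j l) (Pd j l Uy).
have dGH j := is_derive_grad j j Uy HN (fun i j => Nd i j Uy).
have [n' dN] : exists n', forall j,
    is_derive y (basis2 j) (fun z => normal_proj F z (grad F H j z)) (n' j).
  exists (fun j => \sum_(k < 2) (cometric_deriv j j k y *: N k y + c j k y *: M j k y)
     - \sum_(l < 2) (s' j l *: P l y + tangential_coef j l y *: Q j l y)) => j.
  apply: (is_derive_on Uy _ (is_derive_sub (dGH j) (dS j))) => z Uz.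
  by rewrite normal_gradH // gradH_frame.
have [h' dh] : exists h', forall j, is_derive y (basis2 j) (fun z => dot (H z) (H z)) (h' j).
  by exists (fun j => dot (N j y) (H y) + dot (H y) (N j y)) => j;
    apply: is_derive_dot (Hd j Uy) (Hd j Uy).
have dG j := is_derive_grad j j Uy HP (fun i j => Pd i j Uy).
have dstress j := is_derive_on Uy (fun z Uz => esym (stress_split j Uz))
   (is_derive_add (is_derive_sub (dS j) (dN j)) (is_derive_scale (dh j) (dG j))).
set D := divergence F (stress F) y.
have DE : D = \sum_(j < 2) (\sum_(l < 2) (s' j l *: P l y + tangential_coef j l y *: Q j l y)
      + trace_frame j y *: tangential j y)
   - divergence F (fun j z => normal_proj F z (grad F H j z)) y
   + \sum_(j < 2) h' j *: grad F F j y + dot (H y) (H y) *: (2 *: H y).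
  rewrite /D (divergenceE Uy dstress) (divergenceE Uy dN) -HH -div_gradF // (divergenceE Uy dG) HH.
  have Es j := stress_split j Uy.
  move: (stress F) (grad F F) (fun j z => normal_proj F z (grad F H j z)) (tangential) Es
    => St Gr Nn Tg Es.
  rewrite !sum2E !Es; apply/rowP => a.
  by rewrite !mxE; ring.
(* By [div_stress_P] nothing is lost by projecting to the normal space. *)
have <- : frame_normal (P^~ y) D = D.
  by apply: (frame_normal_id (D0 Uy)) => l; exact: div_stress_P.
rewrite DE !(frame_normalD, frame_normalN).
have -> : frame_normal (P^~ y) (dot (H y) (H y) *: (2 *: H y)) = dot (H y) (H y) *: (2 *: H y).
  by apply: (frame_normal_id (D0 Uy)) => l; rewrite !dotZl HP0 // !mulr0.
have -> : frame_normal (P^~ y) (\sum_(j < 2) h' j *: grad F F j y) = 0.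
  rewrite !sum2E !gradF_frame // !sum2E !(frame_normalD, frame_normalZ).
  by rewrite !(frame_normal_frame (D0 Uy)) !(scaler0, addr0).
have -> : frame_normal (P^~ y) (\sum_(j < 2) (\sum_(l < 2) (s' j l *: P l y + tangential_coef j l
  y *: Q j l y)
      + trace_frame j y *: tangential j y)) = \sum_(j < 2) \sum_(l < 2) tangential_coef j l y *:
        second_frame j l y.
  rewrite /tangential !sum2E !(frame_normalD, frame_normalZ).
  by rewrite !(frame_normal_frame (D0 Uy)) !frame_normal_Q // !(scaler0, add0r, addr0).
rewrite /willmore_vector HH second_ff_square // /normal_laplacian normal_proj_frame //.
move: (frame_normal _ _) (\sum_(j < 2) _) => X Y.
by apply/rowP => a; rewrite !mxE; ring.
Qed.

Variables (V : R * R -> 'rV[R]_m) (v : 'I_2 -> R * R -> 'rV[R]_m).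
Variable vv : 'I_2 -> 'I_2 -> R * R -> 'rV[R]_m.
Hypothesis Vd : forall y i, U y -> is_derive y (basis2 i) V (v i y).
Hypothesis Vv : forall y i, U y -> pderiv i V y = v i y.
Hypothesis vd : forall y i j, U y -> is_derive y (basis2 i) (v j) (vv i j y).

Definition variation_field j y : R := dot (H y) (grad F V j y) + dot (V y) (stress F j y).

(** The right-hand side is the first variation of the energy density divided by the volume density;
    compare [jet_variation]. Second derivatives of [V] enter the divergence through
    [dot H (Laplacian V)]. By the sign of the gradient of [H] in [T], the products of derivatives of
    [H] and of [V] cancel; twice the tangential part of that gradient is left, which gives the
    variation of the cometric, and a multiple of the square of [H], which gives the variation of the
    area. *)
Lemma div_variation_field y : U y ->
  divergence F variation_field y - dot (V y) (divergence F (stress F) y) =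
  \sum_(i < 2) \sum_(j < 2) c i j y * dot (H y) (vv i j y - \sum_(k < 2) christoffel_frame k i j
    y *: v k y)
  + \sum_(i < 2) \sum_(j < 2) (- \sum_(k < 2) \sum_(l < 2) c i k y * c j l y *
      (dot (v k y) (P l y) + dot (P k y) (v l y))) * b i j y
  + dot (H y) (H y) * \sum_(i < 2) \sum_(j < 2) c i j y * dot (P i y) (v j y).
Proof.
move=> Uy.
have [gv gd] : exists gv, forall j, is_derive y (basis2 j) (grad F V j) (gv j).
  exists (fun j => \sum_(k < 2) (cometric_deriv j j k y *: v k y + c j k y *: vv j k y)) => j.
  exact: (is_derive_grad j j Uy Vv (fun i j => vd i j Uy)).
have d j := is_derive_add (is_derive_dot (Hd j Uy) (gd j)) (is_derive_dot (Vd j Uy) (Td j j Uy)).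
rewrite (divergenceE Uy d) (divergenceE Uy (fun j => Td j j Uy)).
have L : dot (H y) (divergence F (grad F V) y) = \sum_(i < 2) \sum_(j < 2) c i j y *
   dot (H y) (vv i j y - \sum_(k < 2) christoffel_frame k i j y *: v k y).
  rewrite (div_gradE Uy Vv (fun i j => vd i j Uy)).
  move: christoffel_frame => G; rewrite !sum2E.
  by rewrite !dotE2; ring.
rewrite -L (divergenceE Uy gd) /variation_field.
have Es j := stress_frame j Uy.
have Eg j : grad F V j y = \sum_(k < 2) c j k y *: v k y.
  by apply: eq_bigr => k _; rewrite cometric_frame // Vv.
move: (stress F) (grad F V) Es Eg => St Gr Es Eg.
rewrite /GRing.scale /= !sum2E !Es !Eg /tangential /tangential_coef !sum2E !dotE2.
rewrite (QC 1 0 Uy) (gram_invC (D0 Uy) 1 0).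
rewrite (dotC (v 0 y) (P 0 y)) (dotC (v 0 y) (P 1 y)) (dotC (v 1 y) (P 0 y)) (dotC (v 1 y) (P 1 y)).
rewrite !(dotC (v _ y) (N _ y)).
ring.
Qed.

End LocalExpressions.

(** * Smoothness of the geometric quantities *)

Section GeometrySmooth.
Context {R : realType} {m : nat}.
Variables (U : set (R * R)) (F : R * R -> 'rV[R]_m).
Hypothesis oU : open U.
Hypothesis FU : smooth_on U F.
Hypothesis Fimm : forall y, U y -> row_free (diff_mx F y).
Implicit Types (i j k l : 'I_2) (y : R * R).

Lemma immersion_det_gt0 y : U y -> 0 < gram_det (fun i => pderiv i F y).
Proof. by move=> Uy; apply: gram_det_gt0; exact: Fimm. Qed.

Lemma immersion_det_neq0 y : U y -> gram_det (fun i => pderiv i F y) != 0.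
Proof. by move=> Uy; rewrite gt_eqF // immersion_det_gt0. Qed.

Lemma smooth_metric i j : smooth_on U (metric F i j).
Proof.
apply: (smooth_on_eq oU _ (smooth_on_dot oU (smooth_on_pderiv i FU) (smooth_on_pderiv j FU))).
by move=> y _; rewrite /metric mxE.
Qed.

Lemma smooth_det : smooth_on U (fun y => gram_det (fun i => pderiv i F y)).
Proof.
have d i j := smooth_on_dot oU (smooth_on_pderiv i FU) (smooth_on_pderiv j FU).
exact: (smooth_onB oU (smooth_onM oU (d 0 0) (d 1 1)) (smooth_onM oU (d 0 1) (d 0 1))).
Qed.

Lemma smooth_cometric i j : smooth_on U (cometric F i j).
Proof.
have d k l := smooth_on_dot oU (smooth_on_pderiv k FU) (smooth_on_pderiv l FU).
have dV := smooth_onV oU immersion_det_neq0 smooth_det.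
have E y : cometric F i j y = gram_inv (fun i => pderiv i F y) i j by [].
case: (I2P i) (I2P j) => -> [] ->.
- apply: (smooth_on_eq oU _ (smooth_onM oU (d 1 1) dV)) => y Uy.
  by have [H _ _ _] := gram_invE (immersion_det_neq0 Uy); rewrite [RHS]H.
- apply: (smooth_on_eq oU _ (smooth_onM oU (smooth_onN oU (d 0 1)) dV)) => y Uy.
  by have [_ H _ _] := gram_invE (immersion_det_neq0 Uy); rewrite [RHS]H.
- apply: (smooth_on_eq oU _ (smooth_onM oU (smooth_onN oU (d 0 1)) dV)) => y Uy.
  by have [_ _ H _] := gram_invE (immersion_det_neq0 Uy); rewrite [RHS]H.
- apply: (smooth_on_eq oU _ (smooth_onM oU (d 0 0) dV)) => y Uy.
  by have [_ _ _ H] := gram_invE (immersion_det_neq0 Uy); rewrite [RHS]H.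
Qed.

Lemma volume_densityE y : volume_density F y = Num.sqrt (gram_det (fun i => pderiv i F y)).
Proof. by rewrite /volume_density -det_gram_mx. Qed.

Lemma smooth_volume_density : smooth_on U (volume_density F).
Proof.
apply: (smooth_on_eq oU _ (smooth_on_sqrt oU immersion_det_gt0 smooth_det)) => y Uy.
by rewrite volume_densityE.
Qed.

Lemma smooth_christoffel k i j : smooth_on U (christoffel F k i j).
Proof.
apply: (smooth_onM oU (smooth_on_cst 2^-1 oU)).
apply: (smooth_on_sum _ oU) => l; apply: (smooth_onM oU (smooth_cometric k l)).
apply: (smooth_onB oU); last exact: smooth_on_pderiv (smooth_metric i j).
by apply: (smooth_onD oU); apply: smooth_on_pderiv; exact: smooth_metric.
Qed.

Lemma smooth_second_ff i j : smooth_on U (second_ff F i j).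
Proof.
apply: (smooth_on_mxB oU); first exact: smooth_on_pderiv (smooth_on_pderiv _ FU).
apply: (smooth_on_mx_sum _ oU) => k.
by apply: (smooth_on_scale oU (smooth_christoffel _ _ _)); exact: smooth_on_pderiv.
Qed.

Lemma smooth_mean_curvature : smooth_on U (mean_curvature F).
Proof.
apply: (smooth_on_scale oU (smooth_on_cst 2^-1 oU)).
apply: (smooth_on_mx_sum _ oU) => i; apply: (smooth_on_mx_sum _ oU) => j.
exact: (smooth_on_scale oU (smooth_cometric _ _) (smooth_second_ff _ _)).
Qed.

Lemma smooth_grad (p q : nat) (u : R * R -> 'M[R]_(p, q)) j :
  smooth_on U u -> smooth_on U (grad F u j).
Proof.
move=> uU; apply: (smooth_on_mx_sum _ oU) => k.
exact: (smooth_on_scale oU (smooth_cometric _ _) (smooth_on_pderiv k uU)).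
Qed.

Lemma smooth_normal_proj (u : R * R -> 'rV[R]_m) :
  smooth_on U u -> smooth_on U (fun y => normal_proj F y (u y)).
Proof.
move=> uU.
have H : smooth_on U (fun y => u y - \sum_(i < 2) \sum_(j < 2)
   (cometric F i j y * dot (u y) (pderiv i F y)) *: pderiv j F y).
  apply: (smooth_on_mxB oU uU); apply: (smooth_on_mx_sum _ oU) => i.
  apply: (smooth_on_mx_sum _ oU) => j.
  apply: (smooth_on_scale oU _ (smooth_on_pderiv j FU)).
  apply: (smooth_onM oU (smooth_cometric _ _)).
  exact: (smooth_on_dot oU uU (smooth_on_pderiv i FU)).
apply: (smooth_on_eq oU _ H) => y Uy.
by rewrite -[RHS]/(frame_normal (fun i => pderiv i F y) (u y)) frame_normalE // immersion_det_neq0.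
Qed.

Lemma smooth_stress j : smooth_on U (stress F j).
Proof.
have gH := smooth_grad j smooth_mean_curvature.
apply: (smooth_on_mxD oU).
  apply: (smooth_on_mxB oU gH).
  exact: (smooth_on_scale oU (smooth_on_cst 2 oU) (smooth_normal_proj gH)).
apply: (smooth_on_scale oU _ (smooth_grad j FU)).
exact: (smooth_on_dot oU smooth_mean_curvature smooth_mean_curvature).
Qed.

Let P i := pderiv i F.
Let Q i j := pderiv i (pderiv j F).
Let H := mean_curvature F.
Let HU : smooth_on U H := smooth_mean_curvature.

Lemma conservation_laws y : U y ->
  [/\ divergence F (stress F) y = - willmore_vector F y,
      divergence F (fun j z => wedge (stress F j z) (F z) + wedge (H z) (grad F F j z)) y
        = wedge (divergence F (stress F) y) (F y)
    & divergence F (fun j z => dot (stress F j z) (F z)) y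
        = dot (divergence F (stress F) y) (F y)].
Proof.
move=> Uy.
have HP z i : U z -> pderiv i F z = P i z by [].
have HQ z i j : U z -> pderiv i (pderiv j F) z = Q i j z by [].
have Pd z i j : U z -> is_derive z (basis2 i) (P j) (Q i j z).
  by move=> Uz; exact: (smooth_on_is_derive i (smooth_on_pderiv j FU) Uz).
have QC z i j : U z -> Q i j z = Q j i z.
  by move=> Uz; exact: (schwarz_mx i j oU FU Uz).
have Fd z i : U z -> is_derive z (basis2 i) F (P i z).
  by move=> Uz; exact: (smooth_on_is_derive i FU Uz).
have Hd z i : U z -> is_derive z (basis2 i) H (pderiv i H z).
  by move=> Uz; exact: (smooth_on_is_derive i HU Uz).
have HN z i : U z -> pderiv i H z = pderiv i H z by [].
have Nd z i j : U z -> is_derive z (basis2 i) (pderiv j H) (pderiv i (pderiv j H) z).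
  by move=> Uz; exact: (smooth_on_is_derive i (smooth_on_pderiv j HU) Uz).
have Qd z i j k : U z -> is_derive z (basis2 k) (Q i j) (pderiv k (pderiv i (pderiv j F)) z).
  by move=> Uz; exact: (smooth_on_is_derive k (smooth_on_pderiv i (smooth_on_pderiv j FU)) Uz).
have T3C z i j k : U z ->
    pderiv k (pderiv i (pderiv j F)) z = pderiv i (pderiv k (pderiv j F)) z.
  by move=> Uz; exact: (schwarz_mx k i oU (smooth_on_pderiv j FU) Uz).
have Td z i j : U z -> is_derive z (basis2 i) (stress F j) (pderiv i (stress F j) z).
  by move=> Uz; exact: (smooth_on_is_derive i (smooth_stress j) Uz).
have D0 z : U z -> gram_det (P^~ z) != 0 by exact: immersion_det_neq0.
split.
- exact: (@div_stressE R m U F P Q oU HP HQ Pd QC D0 H (fun i => pderiv i H)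
    (fun i j => pderiv i (pderiv j H)) (fun k i j => pderiv k (Q i j)) erefl
    Hd HN Nd Qd T3C (fun i j => pderiv i (stress F j)) Td y Uy).
- exact: (@div_stress_wedge R m U F P Q oU HP HQ Pd QC D0 H (fun i => pderiv i H) erefl
    Fd Hd HN (fun i j => pderiv i (stress F j)) Td y Uy).
- exact: (@div_stress_dot R m U F P Q oU HP HQ Pd QC D0 H (fun i => pderiv i H) erefl
    Fd Hd HN (fun i j => pderiv i (stress F j)) Td y Uy).
Qed.

End GeometrySmooth.

Lemma wedgeNl (R : realType) (m : nat) (u v : 'rV[R]_m) : wedge (- u) v = - wedge u v.
Proof. by apply/matrixP => a b; rewrite [RHS]mxE !wedgeE !mxE; ring. Qed.

(** * First variation of the energy density *)

Section Jets.
Context {R : realType} {m : nat}.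
Implicit Types (p dp : 'I_2 -> 'rV[R]_m) (q dq : 'I_2 -> 'I_2 -> 'rV[R]_m) (i j k l : 'I_2).

(** The local geometry as a function of the 2-jet at one point. The jet of [Phi + t V] is affine in
    [t], so the first variation becomes a derivative in one real variable. *)
Definition jet_christoffel p q k i j : R := \sum_(l < 2) gram_inv p k l * dot (q i j) (p l).

Definition jet_second p q i j : 'rV[R]_m := q i j - \sum_(k < 2) jet_christoffel p q k i j *: p k.

Definition jet_H p q : 'rV[R]_m :=
  2^-1 *: \sum_(i < 2) \sum_(j < 2) gram_inv p i j *: jet_second p q i j.

Definition jet_energy p q : R := dot (jet_H p q) (jet_H p q) * Num.sqrt (gram_det p).

Definition jet_variation p q dp dq : R :=
  Num.sqrt (gram_det p) *
  (\sum_(i < 2) \sum_(j < 2) gram_inv p i j *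
      dot (jet_H p q) (dq i j - \sum_(k < 2) jet_christoffel p q k i j *: dp k)
  + \sum_(i < 2) \sum_(j < 2) (- \sum_(k < 2) \sum_(l < 2) gram_inv p i k * gram_inv p j l *
      (dot (dp k) (p l) + dot (p k) (dp l))) * dot (jet_H p q) (q i j)
  + dot (jet_H p q) (jet_H p q) * \sum_(i < 2) \sum_(j < 2) gram_inv p i j * dot (p i) (dp j)).

Lemma jet_H_normal p q l : gram_det p != 0 -> dot (jet_H p q) (p l) = 0.
Proof.
move=> D0.
have sn i j : dot (jet_second p q i j) (p l) = 0.
  rewrite /jet_second /jet_christoffel dotDl dotNl.
  rewrite (_ : dot (\sum_(k < 2) _) _ = dot (q i j) (p l)) ?subrr //.
  rewrite !sum2E !dotDl !dotZl.
  have e0 := gram_invK D0 0 l; have e1 := gram_invK D0 1 l.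
  rewrite !sum2E in e0 e1; rewrite (gram_invC D0 1 0) in e1 *.
  have : dot (q i j) (p 0) * (gram_inv p 0 0 * dot (p 0) (p l) + gram_inv p 0 1 * dot (p 1) (p l))
    + dot (q i j) (p 1) * (gram_inv p 0 1 * dot (p 0) (p l) + gram_inv p 1 1 * dot (p 1) (p l))
    = dot (q i j) (p l).
    by rewrite e0 e1; case: (I2P l) => -> /=; ring.
  by move=> <-; ring.
rewrite /jet_H; move: (jet_second p q) sn => s sn.
by rewrite !sum2E !dotE2 !sn !mulr0 !addr0 mulr0.
Qed.

(* The variation of the Christoffel symbols is not needed, because it only
   contributes a tangent vector to the variation of [H]. *)
Lemma is_derive_jet_energy (p : 'I_2 -> R -> 'rV[R]_m) (q : 'I_2 -> 'I_2 -> R -> 'rV[R]_m)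
    dp dq (t : R) :
  (forall i, is_derive t 1 (p i) (dp i)) ->
  (forall i j, is_derive t 1 (q i j) (dq i j)) ->
  (\forall s \near t, 0 < gram_det (p^~ s)) ->
  is_derive t 1 (fun s => jet_energy (p^~ s) (fun i j => q i j s))
    (jet_variation (p^~ t) (fun i j => q i j t) dp dq).
Proof.
move=> pd qd Dpos.
have Dn : \forall s \near t, gram_det (p^~ s) != 0.
  by apply: filterS Dpos => s; rewrite lt0r => /andP[].
have D0 := nbhs_singleton Dn; have Dt := nbhs_singleton Dpos.
have [c' cd c'E] : exists2 c' : 'I_2 -> 'I_2 -> R,
    forall i j, is_derive t 1 (fun s => gram_inv (p^~ s) i j) (c' i j) &
    forall i j, - (\sum_(k < 2) \sum_(l < 2) gram_inv (p^~ t) i k * gram_inv (p^~ t) j l *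
      (dot (dp k) (p l t) + dot (p k t) (dp l))) = c' i j.
  by eexists; [move=> i j; exact: (is_derive_gram_inv pd Dn i j)|].
have gd := is_derive_gram_density pd Dn Dt.
have Gd k i j := is_derive_bigsum (index_enum 'I_2)
   (fun l => is_derive_mul (cd k l) (is_derive_dot (qd i j) (pd l))).
have [C' Cd] : exists C', forall k i j, is_derive t 1
    (fun s => jet_christoffel (p^~ s) (fun i j => q i j s) k i j) (C' k i j).
  by eexists; move=> k i j; exact: (Gd k i j).
have Hd0 := is_derive_scale (is_derive_cst (2^-1 : R) t 1) (is_derive_bigsum (index_enum 'I_2)
  (fun i =>
   is_derive_bigsum (index_enum 'I_2) (fun j => is_derive_scale (cd i j)
     (is_derive_sub (qd i j) (is_derive_bigsum (index_enum 'I_2)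
       (fun k => is_derive_scale (Cd k i j) (pd k))))))).
have [H' Hd HH'] : exists2 H', is_derive t 1 (fun s => jet_H (p^~ s) (fun i j => q i j s)) H' &
    2 * dot (jet_H (p^~ t) (fun i j => q i j t)) H' =
    \sum_(i < 2) \sum_(j < 2) (c' i j * dot (jet_H (p^~ t) (fun i j => q i j t)) (q i j t) +
       gram_inv (p^~ t) i j * dot (jet_H (p^~ t) (fun i j => q i j t))
        (dq i j - \sum_(k < 2) jet_christoffel (p^~ t) (fun i j => q i j t) k i j *: dp k)).
  eexists; first exact: Hd0.
  have Hp l : dot (jet_H (p^~ t) (fun i j => q i j t)) (p l t) = 0 by apply: (@jet_H_normal (p^~
    t)).
  move: (jet_H _ _) (jet_christoffel _ _) Hp => H C Hp.
  by rewrite scale0r add0r !sum2E !dotE2 !Hp /cst; field.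
apply: is_derive_eq (is_derive_mul (is_derive_dot Hd Hd) gd) _.
rewrite /jet_variation.
move: (jet_H _ _) (jet_christoffel _ _) HH' => H C HH'.
rewrite (dotC H' H) -mulr2n -mulr_natl HH' !sum2E -!c'E !sum2E.
by ring.
Qed.

End Jets.

Section EnergyDensity.
Context {R : realType} {m : nat}.
Variable U : set (R * R).
Hypothesis oU : open U.
Implicit Types (F V : R * R -> 'rV[R]_m) (i j k l : 'I_2) (y : R * R).

Definition energy_density F y : R :=
  dot (mean_curvature F y) (mean_curvature F y) * volume_density F y.

Definition jet1 F y i := pderiv i F y.
Definition jet2 F y i j := pderiv i (pderiv j F) y.

(** A perturbed map need not be an immersion on all of [U]. The local formulas are applied to it on
    this smaller open set. *)
Lemma regular_open F : smooth_on U F ->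
  open [set y | U y /\ gram_det (jet1 F y) != 0].
Proof.
move=> FU; rewrite openE => y [Uy Dy]; rewrite /interior /=.
have c : {for y, continuous (fun y => gram_det (jet1 F y))}.
  exact: (smooth_on_continuous (smooth_det oU FU) Uy).
have N0 : \forall z \near y, gram_det (jet1 F z) != 0.
  exact: (cvgr_neq0 _ c Dy).
by apply: filterS2 (open_nbhs_nbhs (conj oU Uy)) N0 => z ? ?; split.
Qed.

Lemma mean_curvature_jet F y : smooth_on U F -> U y -> gram_det (jet1 F y) != 0 ->
  mean_curvature F y = jet_H (jet1 F y) (jet2 F y).
Proof.
move=> FU Uy Dy.
pose P i := pderiv i F; pose Q i j := pderiv i (pderiv j F).
pose U' := [set y | U y /\ gram_det (jet1 F y) != 0].
have oU' : open U' by exact: regular_open.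
have HP z i : U' z -> pderiv i F z = P i z by [].
have HQ z i j : U' z -> pderiv i (pderiv j F) z = Q i j z by [].
have Pd z i j : U' z -> is_derive z (basis2 i) (P j) (Q i j z).
  by move=> [Uz _]; exact: (smooth_on_is_derive i (smooth_on_pderiv j FU) Uz).
have QC z i j : U' z -> Q i j z = Q j i z.
  by move=> [Uz _]; exact: (schwarz_mx i j oU FU Uz).
exact: (@mean_curvature_frame R m U' F P Q oU' HP HQ Pd QC y (conj Uy Dy)).
Qed.

Lemma energy_density_jet F y : smooth_on U F -> U y -> gram_det (jet1 F y) != 0 ->
  energy_density F y = jet_energy (jet1 F y) (jet2 F y).
Proof.
by move=> FU Uy Dy; rewrite /energy_density (mean_curvature_jet FU Uy Dy) volume_densityE.
Qed.

Definition perturb F V (t : R) y := F y + t *: V y.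

Lemma smooth_perturb F V t : smooth_on U F -> smooth_on U V -> smooth_on U (perturb F V t).
Proof.
move=> FU VU; apply: (smooth_on_mxD oU FU).
exact: (smooth_on_scale oU (smooth_on_cst t oU) VU).
Qed.

Lemma jet1_perturb F V t y i : smooth_on U F -> smooth_on U V -> U y ->
  jet1 (perturb F V t) y i = jet1 F y i + t *: jet1 V y i.
Proof.
move=> FU VU Uy.
have := is_derive_add (smooth_on_is_derive i FU Uy)
  (is_derive_scale (is_derive_cst t y (basis2 i)) (smooth_on_is_derive i VU Uy)).
by rewrite scale0r add0r => -[].
Qed.

Lemma jet2_perturb F V t y i j : smooth_on U F -> smooth_on U V -> U y ->
  jet2 (perturb F V t) y i j = jet2 F y i j + t *: jet2 V y i j.
Proof.
move=> FU VU Uy.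
have E : jet2 (perturb F V t) y i j = pderiv i (perturb (pderiv j F) (pderiv j V) t) y.
  by apply: (eq_on_derive _ oU Uy) => z Uz; exact: jet1_perturb.
rewrite E; exact: (jet1_perturb _ _ (smooth_on_pderiv j FU) (smooth_on_pderiv j VU) Uy).
Qed.

Definition energy_variation F V t y : R :=
  jet_variation (jet1 (perturb F V t) y) (jet2 (perturb F V t) y) (jet1 V y) (jet2 V y).

Lemma perturb_det_near F V t y : smooth_on U F -> smooth_on U V -> U y ->
  0 < gram_det (jet1 (perturb F V t) y) ->
  \forall s \near t, 0 < gram_det (jet1 (perturb F V s) y).
Proof.
move=> FU VU Uy Dt; pose p i (s : R) := jet1 F y i + s *: jet1 V y i.
have pE s : jet1 (perturb F V s) y = p^~ s.
  by apply/funext => i; exact: (jet1_perturb s i FU VU Uy).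
have pd i : is_derive t 1 (p i) (jet1 V y i).
  have := is_derive_add (is_derive_cst (jet1 F y i) t 1)
    (is_derive_scale (is_derive_id t 1) (is_derive_cst (jet1 V y i) t 1)).
  by rewrite scaler0 addr0 scale1r add0r.
have c : {for t, continuous (fun s => gram_det (p^~ s))}.
  apply: differentiable_continuous; apply/derivable1_diffP.
  by case: (is_derive_gram_det pd).
have Dt' : 0 < gram_det (p^~ t) by rewrite -pE.
have H : \forall s \near t, 0 < gram_det (p^~ s) by exact: (cvgr_gt _ c _ Dt').
by apply: filterS H => s; rewrite pE.
Qed.

Lemma is_derive_energy_density F V t y : smooth_on U F -> smooth_on U V -> U y ->
  0 < gram_det (jet1 (perturb F V t) y) ->
  is_derive t 1 (fun s => energy_density (perturb F V s) y) (energy_variation F V t y).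
Proof.
move=> FU VU Uy Dt.
pose p i s := jet1 F y i + s *: jet1 V y i.
pose q i j s := jet2 F y i j + s *: jet2 V y i j.
have lin (a b : 'rV[R]_m) : is_derive t 1 (fun s : R => a + s *: b) b.
  have := is_derive_add (is_derive_cst a t 1) (is_derive_scale (is_derive_id t 1) (is_derive_cst
    b t 1)).
  by rewrite scaler0 addr0 scale1r add0r.
have pE s : jet1 (perturb F V s) y = p^~ s by apply/funext => i; exact: jet1_perturb.
have qE s : jet2 (perturb F V s) y = fun i j => q i j s.
  by apply/funext => i; apply/funext => j; exact: jet2_perturb.
have pd i : is_derive t 1 (p i) (jet1 V y i) by exact: lin.
have qd i j : is_derive t 1 (q i j) (jet2 V y i j) by exact: lin.
have Dnear : \forall s \near t, 0 < gram_det (p^~ s).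
  by apply: filterS (perturb_det_near FU VU Uy Dt) => s; rewrite pE.
have := is_derive_jet_energy pd qd Dnear.
rewrite -pE -qE; apply: near_eq_is_derive.
apply: filterS Dnear => s Ds.
have Ds' : gram_det (jet1 (perturb F V s) y) != 0 by rewrite pE gt_eqF.
by rewrite (energy_density_jet (smooth_perturb s FU VU) Uy Ds') pE qE.
Qed.

(** By Jacobi's formula the logarithmic derivative of the volume density is [trace_frame], the
    zero-order coefficient of the divergence. The Euclidean divergence on the left integrates to
    zero over the plane when the field has compact support. *)
Lemma flat_divergence F (X : 'I_2 -> R * R -> R) (dX : 'I_2 -> R) y : smooth_on U F ->
  (forall y, U y -> row_free (diff_mx F y)) -> U y ->
  (forall j, is_derive y (basis2 j) (X j) (dX j)) ->
  \sum_(j < 2) pderiv j (fun z => volume_density F z * X j z) y =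
  volume_density F y * divergence F X y.
Proof.
move=> FU Fimm Uy Xd.
pose P i := pderiv i F; pose Q i j := pderiv i (pderiv j F).
have HP z i : U z -> pderiv i F z = P i z by [].
have Pd z i j : U z -> is_derive z (basis2 i) (P j) (Q i j z).
  by move=> Uz; exact: (smooth_on_is_derive i (smooth_on_pderiv j FU) Uz).
have QC z i j : U z -> Q i j z = Q j i z.
  by move=> Uz; exact: (schwarz_mx i j oU FU Uz).
have D0 z : U z -> gram_det (P^~ z) != 0 by exact: immersion_det_neq0.
have Dpos : 0 < gram_det (P^~ y) by exact: (immersion_det_gt0 Fimm Uy).
have Dn : \forall z \near y, gram_det (P^~ z) != 0.
  by apply: filterS D0 _; exact: (open_nbhs_nbhs (conj oU Uy)).
have vold j : is_derive y (basis2 j) (volume_density F) (volume_density F y * trace_frame P Q j y).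
  have G0 := is_derive_gram_density (fun i => Pd y j i Uy) Dn Dpos.
  have nE : \forall z \near y, Num.sqrt (gram_det (P^~ z)) = volume_density F z.
    by apply: filterS (open_nbhs_nbhs (conj oU Uy)) => z _; exact: (esym (volume_densityE F z)).
  have G1 := near_eq_is_derive nE G0.
  have tE : \sum_(k < 2) \sum_(l < 2) gram_inv (P^~ y) k l * dot (P k y) (Q j l y) = trace_frame
    P Q j y.
    by apply: eq_bigr => k _; apply: eq_bigr => l _; rewrite (QC y j l Uy).
  apply: is_derive_eq G1 _.
  exact: (f_equal2 *%R (esym (volume_densityE F y)) tE).
rewrite (divergenceE oU HP Pd QC D0 Uy Xd) [RHS]mulr_sumr; apply: eq_bigr => j _.
have [_ E] := is_derive_mul (vold j) (Xd j).
refine (etrans E _).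
move: (trace_frame _ _ _ _) (dX j) (volume_density F y) (X j y) => a b r c.
by rewrite /GRing.scale /=; ring.
Qed.

Lemma energy_variation_divergence F V y : smooth_on U F -> smooth_on U V ->
  (forall y, U y -> row_free (diff_mx F y)) -> U y ->
  energy_variation F V 0 y =
  \sum_(j < 2) pderiv j (fun z => volume_density F z *
     (dot (mean_curvature F z) (grad F V j z) + dot (V z) (stress F j z))) y
  - volume_density F y * dot (V y) (divergence F (stress F) y).
Proof.
move=> FU VU Fimm Uy.
pose P i := pderiv i F; pose Q i j := pderiv i (pderiv j F).
pose H := mean_curvature F.
have HU : smooth_on U H by exact: smooth_mean_curvature.
have HP z i : U z -> pderiv i F z = P i z by [].
have HQ z i j : U z -> pderiv i (pderiv j F) z = Q i j z by [].
have Pd z i j : U z -> is_derive z (basis2 i) (P j) (Q i j z).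
  by move=> Uz; exact: (smooth_on_is_derive i (smooth_on_pderiv j FU) Uz).
have QC z i j : U z -> Q i j z = Q j i z.
  by move=> Uz; exact: (schwarz_mx i j oU FU Uz).
have Hd z i : U z -> is_derive z (basis2 i) H (pderiv i H z).
  by move=> Uz; exact: (smooth_on_is_derive i HU Uz).
have HN z i : U z -> pderiv i H z = pderiv i H z by [].
have Td z i j : U z -> is_derive z (basis2 i) (stress F j) (pderiv i (stress F j) z).
  by move=> Uz; exact: (smooth_on_is_derive i (smooth_stress oU FU Fimm j) Uz).
have D0 z : U z -> gram_det (P^~ z) != 0 by exact: immersion_det_neq0.
have Vd z i : U z -> is_derive z (basis2 i) V (pderiv i V z).
  by move=> Uz; exact: (smooth_on_is_derive i VU Uz).
have Vv z i : U z -> pderiv i V z = pderiv i V z by [].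
have vd z i j : U z -> is_derive z (basis2 i) (pderiv j V) (pderiv i (pderiv j V) z).
  by move=> Uz; exact: (smooth_on_is_derive i (smooth_on_pderiv j VU) Uz).
have key := @div_variation_field R m U F P Q oU HP HQ Pd QC D0 H (fun i => pderiv i H) erefl
  Hd HN (fun i j => pderiv i (stress F j)) Td V (fun i => pderiv i V)
  (fun i j => pderiv i (pderiv j V)) Vd Vv vd y Uy.
set X := fun j z => dot (mean_curvature F z) (grad F V j z) + dot (V z) (stress F j z).
have XU j : smooth_on U (X j).
  apply: (smooth_onD oU).
    exact: (smooth_on_dot oU HU (smooth_grad oU FU Fimm j VU)).
  exact: (smooth_on_dot oU VU (smooth_stress oU FU Fimm j)).
have Xd j : is_derive y (basis2 j) (X j) (pderiv j (X j) y) by exact: (smooth_on_is_derive j (XU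
  j) Uy).
have flat := flat_divergence FU Fimm Uy Xd.
have e1 : jet1 (perturb F V 0) y = P^~ y.
  apply/funext => i; refine (etrans (jet1_perturb 0 i FU VU Uy) _).
  by rewrite scale0r addr0.
have e2 : jet2 (perturb F V 0) y = fun i j => Q i j y.
  apply/funext => i; apply/funext => j; refine (etrans (jet2_perturb 0 i j FU VU Uy) _).
  by rewrite scale0r addr0.
have HE : jet_H (P^~ y) (fun i j => Q i j y) = H y.
  exact: (esym (mean_curvature_jet FU Uy (D0 y Uy))).
refine (etrans _ (esym (congr1 (fun r => r - _) flat))).
rewrite -mulrBr.
rewrite /energy_variation e1 e2 /jet_variation HE.
exact: (f_equal2 *%R (esym (volume_densityE F y)) (esym key)).
Qed.

End EnergyDensity.

(** * Integration on the plane *)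

Section PlaneMeasure.
Context {R : realType}.
Local Notation T2 := (measurableTypeR R * measurableTypeR R)%type.
Local Notation mu2 := (@lebesgue2 R).

Definition square (r : R) : set (R * R) := `[- r, r] `*` `[- r, r].

Lemma squareP (r : R) (x : R * R) : square r x <-> `|x.1| <= r /\ `|x.2| <= r.
Proof. by rewrite /square /= !in_itv /= -!ler_norml. Qed.

(** The sigma-algebra of [lebesgue2] is generated by products, so an open set is written as a
    countable union of boxes with rational corners. *)
Lemma open_measurable2 (U : set (R * R)) : open U -> measurable (U : set T2).
Proof.
move=> oU.
pose box (q : rat * rat * (rat * rat)) : set (R * R) :=
  `]ratr q.1.1, ratr q.1.2[ `*` `]ratr q.2.1, ratr q.2.2[.
have UE : U = \bigcup_q (if `[< box q `<=` U >] then box q else set0).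
  apply/seteqP; split=> [x Ux|x [q _]]; last by case: asboolP => // H /H.
  have /nbhs_ballP[r /= r0 H] : nbhs x U by exact: open_nbhs_nbhs.
  have rat_near (s : R) : exists q : rat * rat, [/\ s - r < ratr q.1, ratr q.1 < s,
      s < ratr q.2 & ratr q.2 < s + r].
    have [q1] := @rat_in_itvoo R (s - r) s ltac:(by rewrite ltrBlDr ltrDl).
    rewrite in_itv /= => /andP[? ?].
    have [q2] := @rat_in_itvoo R s (s + r) ltac:(by rewrite ltrDl).
    by rewrite in_itv /= => /andP[? ?]; exists (q1, q2).
  have [q1 [a1 b1 c1 d1]] := rat_near x.1; have [q2 [a2 b2 c2 d2]] := rat_near x.2.
  exists (q1, q2) => //; case: asboolP => [_|[]].
    by split; rewrite /= in_itv /= ?b1 ?b2.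
  move=> y [/=]; rewrite !in_itv /= => /andP[y1 y1'] /andP[y2 y2']; apply: H.
  apply/ball_pairP; split; rewrite ltr_norml ltrBlDl ltrBrDl.
    by rewrite (lt_trans a1 y1) (lt_trans y1' d1).
  by rewrite (lt_trans a2 y2) (lt_trans y2' d2).
rewrite UE; apply: countable_bigcupT_measurable => // q.
case: ifP => // _; apply: measurableX; exact: measurable_itv.
Qed.

Lemma closed_measurable2 (C : set (R * R)) : closed C -> measurable (C : set T2).
Proof. by move/closed_openC/open_measurable2/measurableC; rewrite setCK. Qed.

Lemma hausdorff_plane : hausdorff_space (R * R)%type.
Proof. exact: norm_hausdorff. Qed.

Lemma compact_measurable2 (C : set (R * R)) : compact C -> measurable (C : set T2).
Proof. by move/(compact_closed hausdorff_plane); exact: closed_measurable2. Qed.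

Lemma measurable_square (r : R) : measurable (square r : set T2).
Proof. by apply: measurableX; exact: measurable_itv. Qed.

Lemma square_measure_lty (r : R) : (mu2 (square r) < +oo)%E.
Proof.
have E : mu2 (square r) =
    (lebesgue_measure (`[(- r)%R, r]%classic : set R) * lebesgue_measure (`[(- r)%R, r]%classic :
      set R))%E.
  by apply: product_measure1E; exact: measurable_itv.
by rewrite E lebesgue_measure_itv /=; case: ifP => _; rewrite ?mule0 // -!EFinD -EFinM ltry.
Qed.

Lemma compact_in_square (C : set (R * R)) : compact C -> exists2 r : R, 0 < r & C `<=` square r.
Proof.
move=> /compact_bounded [M [Mr HM]].
exists (`|M| + 1); first by rewrite ltr_wpDl.
move=> x Cx; have M1 : M < `|M| + 1 by rewrite (le_lt_trans (ler_norm M)) // ltrDl.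
have := HM _ M1 x Cx; rewrite /= => xM; apply/squareP.
have xE : `|x| = Num.max `|x.1| `|x.2| by [].
by move: xM; rewrite xE ge_max => /andP[].
Qed.

Lemma compact_square (r : R) : compact (square r).
Proof. by apply: compact_setX; exact: segment_compact. Qed.

Lemma compact_measure_lty (C : set (R * R)) : compact C -> (mu2 C < +oo)%E.
Proof.
move=> cC; have [r r0 Cr] := compact_in_square cC.
apply: le_lt_trans (square_measure_lty r).
apply: le_measure => //; rewrite inE; [exact: compact_measurable2|exact: measurable_square].
Qed.

Lemma within_continuous_measurable2 (D : set (R * R)) (f : R * R -> R) :
  measurable (D : set T2) -> {within D, continuous f} ->
  measurable_fun (D : set T2) (f : T2 -> measurableTypeR R).
Proof.
move=> mD /continuousP cf; apply: (measurability _ (RGenOpens.measurableE R)).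
move=> _ [_ [a [b ->] <-]].
have /cf /open_subspaceP [V oV VD] : open (`]a, b[%classic : set R) by exact: interval_open.
by rewrite setIC -VD; apply: measurableI => //; exact: open_measurable2.
Qed.

Lemma continuous_compact_integrable2 (C : set (R * R)) (f : R * R -> R) :
  compact C -> {within C, continuous f} -> mu2.-integrable (C : set T2) (EFin \o f).
Proof.
move=> cC cf; apply: measurable_bounded_integrable.
- exact: compact_measurable2.
- exact: compact_measure_lty.
- by apply: within_continuous_measurable2 => //; exact: compact_measurable2.
- have /compact_bounded[M [_ mrt]] := continuous_compact cf cC.
  by exists M; split; rewrite ?num_real // => ? ? ? ?; exact: mrt.
Qed.

Definition continuous_supp (f : R * R -> R) (r : R) : Prop :=
  continuous f /\ forall x, ~ square r x -> f x = 0.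

Lemma continuous_supp_restrict f r : continuous_supp f r -> f \_ (square r) = f.
Proof.
move=> [_ f0]; apply/funext => x; rewrite patchE; case: ifPn => // /negP xr.
by rewrite f0 // => H; apply: xr; rewrite inE.
Qed.

Lemma continuous_supp_integrable f r : continuous_supp f r ->
  mu2.-integrable [set: T2] (EFin \o f).
Proof.
move=> fr; have [cf _] := fr; rewrite -(continuous_supp_restrict fr) -restrict_EFin.
apply: (integrable_mkcond _ (measurable_square r)).1.
apply: continuous_compact_integrable2; first exact: compact_square.
by apply: continuous_subspaceT.
Qed.

Lemma integral_derivative_eq0 (f f' : R -> R) (r : R) :
  (forall s : R, is_derive s 1 f (f' s)) -> continuous f' ->
  (forall s, r < `|s| -> f s = 0) -> (forall s, r < `|s| -> f' s = 0) ->
  (\int[lebesgue_measure]_s (f' s)%:E = 0)%E.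
Proof.
move=> fd cf' f0 f'0.
(* Strictly beyond [r], so that [f] vanishes at both ends, and positive whatever the sign of [r]. *)
pose M : R := `|r| + 1.
have rM : r < M by rewrite (le_lt_trans (ler_norm r)) // ltrDl.
have M0 : 0 < M by rewrite ltr_wpDl.
have cf : continuous f.
  by move=> s; apply: differentiable_continuous; apply/derivable1_diffP; case: (fd s).
have E : (\int[lebesgue_measure]_s (f' s)%:E = \int[lebesgue_measure]_(s in `[(- M)%R, M]) (f'
  s)%:E)%E.
  rewrite [RHS]integral_mkcond; apply: eq_integral => s _; rewrite patchE.
  case: ifPn => // /negP sM; rewrite f'0 //.
  apply: (lt_le_trans rM); rewrite leNgt; apply/negP => H; apply: sM.
  by rewrite inE /= in_itv /= -ler_norml ltW.
rewrite E (@continuous_FTC2 _ f' f).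
- by rewrite !f0 ?subee // ?normrN gtr0_norm.
- by rewrite gt0_cp.
- exact: continuous_subspaceT.
- split.
  + by move=> x _; case: (fd x).
  + by apply: cvg_at_right_filter; exact: cf.
  + by apply: cvg_at_left_filter; exact: cf.
- by move=> x _; rewrite derive1E; case: (fd x).
Qed.

Lemma horizontal_continuous (t : R) : continuous (fun s : R => (s, t)).
Proof. by move=> s; apply: (@cvg_pair _ _ _ _ (nbhs s) (nbhs t));
  [exact: cvg_id|exact: cvg_cst]. Qed.

Lemma vertical_continuous (s : R) : continuous (fun t : R => (s, t)).
Proof. by move=> t; apply: (@cvg_pair _ _ _ _ (nbhs s) (nbhs t));
  [exact: cvg_cst|exact: cvg_id]. Qed.

(** By Fubini's theorem, with the variable of differentiation integrated first. *)
Lemma integral_pderiv_eq0 (i : 'I_2) (f : R * R -> R) (r : R) :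
  (forall x, derivable f x (basis2 i)) -> continuous (pderiv i f) ->
  (forall x, ~ square r x -> f x = 0) ->
  continuous_supp (pderiv i f) r ->
  \int[mu2]_x pderiv i f x = 0.
Proof.
move=> fd cf f0 fsupp.
have int := continuous_supp_integrable fsupp.
have mf : measurable_fun [set: T2] (EFin \o pderiv i f) by case/integrableP: int.
have f'0 := fsupp.2.
rewrite /Rintegral /lebesgue2.
have out1 (s t : R) : r < `|s| -> ~ square r (s, t).
  by move=> rs /squareP /= [h _]; move: rs; rewrite ltNge h.
have out2 (s t : R) : r < `|t| -> ~ square r (s, t).
  by move=> rs /squareP /= [_ h]; move: rs; rewrite ltNge h.
case: (I2P i) => iE; rewrite {}iE in fd cf fsupp int mf f'0 *.
  rewrite -(integral21_prod_meas1 int) /fubini_G.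
  rewrite (eq_integral (cst 0%E)) ?integral_cst ?mul0e //.
  move=> t _; apply: (@integral_derivative_eq0 (fun s => f (s, t)) _ r).
  - by move=> s; apply/is_derive_horizontal; apply: derivableP.
  - move=> s; apply: (@continuous_comp _ _ _ (fun s => (s, t)) (pderiv 0 f)); last exact: cf.
    exact: horizontal_continuous.
  - by move=> s rs; apply: f0; exact: out1.
  - by move=> s rs; apply: f'0; exact: out1.
rewrite -(integral12_prod_meas1 int) /fubini_F.
rewrite (eq_integral (cst 0%E)) ?integral_cst ?mul0e //.
move=> s _; apply: (@integral_derivative_eq0 (fun t => f (s, t)) _ r).
- by move=> t; apply/is_derive_vertical; apply: derivableP.
- move=> t; apply: (@continuous_comp _ _ _ (fun t => (s, t)) (pderiv 1 f)); last exact: cf.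
  exact: vertical_continuous.
- by move=> t rt; apply: f0; exact: out2.
- by move=> t rt; apply: f'0; exact: out2.
Qed.

End PlaneMeasure.

(** * Differentiation under the integral sign *)

Section ParameterIntegral.
Context {R : realType}.
Local Notation T2 := (measurableTypeR R * measurableTypeR R)%type.
Local Notation mu2 := (@lebesgue2 R).

Lemma compact_locally_bounded (C : set (R * R)) (Psi : R -> R * R -> R) (a : R) :
  compact C -> (forall x, C x -> {for (a, x), continuous (fun z => Psi z.1 z.2)}) ->
  exists M : R, \forall t \near a, forall x, C x -> `|Psi t x| <= M.
Proof.
move=> /compact_near_coveringP cC cPsi.
(* The bound is a second parameter that tends to infinity, so compactness yields one bound and one
   neighbourhood of [a] for all points of [C]. *)
pose F := filter_prod (nbhs a) (pinfty_nbhs R).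
have FF : Filter F by exact: filter_prod_filter.
have H x : C x -> \forall x' \near x & i \near F, `|Psi i.1 x'| <= i.2.
  move=> Cx; have /cvgrPdist_lt /(_ _ ltr01) := cPsi x Cx.
  case=> -[A B] /= [Aa Bx] AB.
  exists (B, [set i : R * R | A i.1 /\ `|Psi a x| + 1 <= i.2]) => /=.
    split=> //; exists (A, [set M : R | `|Psi a x| + 1 <= M]) => //=.
    split=> //; exists (`|Psi a x| + 1); split; first exact: num_real.
    by move=> y /ltW.
  move=> [x' [t M]] [/= Bx' [At tM]]; apply: le_trans tM.
  have := AB (t, x') (conj At Bx'); rewrite /= distrC => /ltW d.
  rewrite -[X in `|X|](subrK (Psi a x)); apply: le_trans (ler_normD _ _) _.
  by rewrite addrC lerD2l.
have [[A B] /= [Aa [M [_ MB]]] AB] := cC _ F _ FF H.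
exists (M + 1); apply: filterS Aa => t At x Cx.
by apply: (AB (t, M + 1)) => //; split => //=; apply: MB; rewrite ltrDl.
Qed.

(** The dominating function is the constant of [compact_locally_bounded], which is integrable over a
    compact set. *)
Lemma is_derive_integral_compact (C : set (R * R)) (Phi Psi : R -> R * R -> R) (a : R) :
  compact C ->
  (\forall t \near a, forall x, C x -> is_derive (t : R) (1 : R) (Phi^~ x) (Psi t x)) ->
  (\forall t \near a, {within C, continuous (Phi t)}) ->
  (forall x, C x -> {for (a, x), continuous (fun z => Psi z.1 z.2)}) ->
  is_derive a 1 (fun t => \int[mu2]_(x in C) Phi t x) (\int[mu2]_(x in C) Psi a x).
Proof.
move=> cC Phid Phic Psic.
have [M HM] := compact_locally_bounded cC Psic.
have : \forall t \near a, [/\ forall x, C x -> is_derive (t : R) (1 : R) (Phi^~ x) (Psi t x),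
    {within C, continuous (Phi t)} & forall x, C x -> `|Psi t x| <= M].
  by apply: filterS3 Phid Phic HM => t ? ? ?; split.
move=> /nbhs_ballP [e /= e0 He].
have He' t : (`](a - e), (a + e)[%classic : set R) t ->
   [/\ forall x, C x -> is_derive (t : R) (1 : R) (Phi^~ x) (Psi t x),
    {within C, continuous (Phi t)} & forall x, C x -> `|Psi t x| <= M].
  move=> /=; rewrite in_itv /= => /andP[t1 t2]; apply: He.
  by rewrite -ball_normE /ball_ /= distrC ltr_norml ltrBlDl ltrBrDl t1 t2.
have Ia : (`](a - e), (a + e)[%classic : set R) a.
  by rewrite /= in_itv /= ltrBlDr ltrDl e0.
have mC := compact_measurable2 cC.
have intPhi t : (`](a - e), (a + e)[%classic : set R) t ->
    mu2.-integrable (C : set T2) (EFin \o (Phi t : T2 -> R)).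
  by move=> /He' [_ c _]; exact: continuous_compact_integrable2.
have derPhi t (x : T2) : (`](a - e), (a + e)[%classic : set R) t -> C x ->
    derivable (Phi^~ x) t 1.
  by move=> /He' [d _ _] Cx; case: (d x Cx).
have M0 : 0 <= `|M| by [].
have intM : mu2.-integrable (C : set T2) (EFin \o (fun _ : T2 => `|M|)).
  apply: continuous_compact_integrable2 => //.
  by apply: continuous_subspaceT => z; exact: cvg_cst.
have bnd t (x : T2) : (`](a - e), (a + e)[%classic : set R) t -> C x ->
    `|partial1of2 (Phi : R -> T2 -> R) t x| <= `|M|.
  move=> It Cx; have [d _ b] := He' t It.
  rewrite partial1of2E; have [_ ->] := d x Cx.
  by apply: le_trans (b x Cx) _; exact: ler_norm.
have D := @derivable_under_integral R _ T2 mu2 Phi C mC a (a - e) (a + e) Ia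
  intPhi derPhi (fun=> `|M|) (fun=> M0) intM bnd.
have E := @differentiation_under_integral R _ T2 mu2 Phi C mC a (a - e) (a + e) Ia
  intPhi derPhi (fun=> `|M|) (fun=> M0) intM bnd.
apply: DeriveDef => //.
rewrite -derive1E E; apply: eq_Rintegral => x; rewrite inE => Cx.
rewrite partial1of2E; have [d _ _] := He' a Ia.
by case: (d x Cx).
Qed.

End ParameterIntegral.

(** * Continuity of the jet expressions along a filter *)

Section JetContinuity.
Context {R : realType} {m : nat} {T : Type} (l : set_system T) {Fl : Filter l}.
Variables (p dp : 'I_2 -> T -> 'rV[R]_m) (q dq : 'I_2 -> 'I_2 -> T -> 'rV[R]_m).
Variables (p0 dp0 : 'I_2 -> 'rV[R]_m) (q0 dq0 : 'I_2 -> 'I_2 -> 'rV[R]_m).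

Lemma cvg_bigsum (W : normedModType R) (I : Type) (r : seq I) (f : I -> T -> W) (f0 : I -> W) :
  (forall k, f k t @[t --> l] --> f0 k) ->
  \sum_(k <- r) f k t @[t --> l] --> \sum_(k <- r) f0 k.
Proof.
move=> H; elim: r => [|k r IH].
  rewrite big_nil; under eq_fun do rewrite big_nil; exact: cvg_cst.
rewrite big_cons; under eq_fun do rewrite big_cons; exact: (cvgD (H k) IH).
Qed.

Lemma cvg_dot (n : nat) (u v : T -> 'rV[R]_n) (u0 v0 : 'rV[R]_n) :
  u t @[t --> l] --> u0 -> v t @[t --> l] --> v0 ->
  dot (u t) (v t) @[t --> l] --> dot u0 v0.
Proof.
move=> uu vv; rewrite dotE; under eq_fun do rewrite dotE.
have c (w : T -> 'rV[R]_n) (w0 : 'rV[R]_n) a : w t @[t --> l] --> w0 -> w t 0 a @[t --> l] -->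
  w0 0 a.
  move=> ww; apply: (@continuous_cvg _ _ _ _ _ w (fun M : 'rV[R]_n => M 0 a)) => //.
  exact: coord_continuous.
by apply: cvg_bigsum => a; apply: cvgM; exact: c.
Qed.

Hypothesis pc : forall i, p i t @[t --> l] --> p0 i.
Hypothesis qc : forall i j, q i j t @[t --> l] --> q0 i j.
Hypothesis dpc : forall i, dp i t @[t --> l] --> dp0 i.
Hypothesis dqc : forall i j, dq i j t @[t --> l] --> dq0 i j.

Lemma cvg_gram_det : gram_det (p^~ t) @[t --> l] --> gram_det p0.
Proof.
have d i j := cvg_dot (@pc i) (@pc j).
exact: (cvgB (cvgM (d 0 0) (d 1 1)) (cvgM (d 0 1) (d 0 1))).
Qed.

Hypothesis D0 : gram_det p0 != 0.

Lemma cvg_eq_near (f g : T -> R) (a : R) : (\forall t \near l, f t = g t) ->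
  f t @[t --> l] --> a -> g t @[t --> l] --> a.
Proof. by move=> fg fa; apply: cvg_trans fa; exact: near_eq_cvg. Qed.

Lemma cvg_gram_inv i j : gram_inv (p^~ t) i j @[t --> l] --> gram_inv p0 i j.
Proof.
have d i' j' := cvg_dot (@pc i') (@pc j').
have dV : (gram_det (p^~ t))^-1 @[t --> l] --> (gram_det p0)^-1 by exact: (cvgV D0 cvg_gram_det).
have Dn : \forall t \near l, gram_det (p^~ t) != 0 by exact: (cvgr_neq0 _ cvg_gram_det D0).
have [c00 c01 c10 c11] := gram_invE D0.
case: (I2P i) (I2P j) => -> [] ->.
- rewrite c00; apply: (cvg_eq_near _ (cvgM (d 1 1) dV)).
  by apply: filterS Dn => t Dt; have [-> _ _ _] := gram_invE Dt.
- rewrite c01; apply: (cvg_eq_near _ (cvgM (cvgN (d 0 1)) dV)).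
  by apply: filterS Dn => t Dt; have [_ -> _ _] := gram_invE Dt.
- rewrite c10; apply: (cvg_eq_near _ (cvgM (cvgN (d 0 1)) dV)).
  by apply: filterS Dn => t Dt; have [_ _ -> _] := gram_invE Dt.
- rewrite c11; apply: (cvg_eq_near _ (cvgM (d 0 0) dV)).
  by apply: filterS Dn => t Dt; have [_ _ _ ->] := gram_invE Dt.
Qed.

Lemma cvg_jet_christoffel k i j :
  jet_christoffel (p^~ t) (fun i j => q i j t) k i j @[t --> l] --> jet_christoffel p0 q0 k i j.
Proof.
apply: cvg_bigsum => n; exact: (cvgM (@cvg_gram_inv k n) (cvg_dot (@qc i j) (@pc n))).
Qed.

Lemma cvg_jet_H :
  jet_H (p^~ t) (fun i j => q i j t) @[t --> l] --> jet_H p0 q0.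
Proof.
apply: (cvgZ (cvg_cst (2^-1 : R))); apply: cvg_bigsum => i; apply: cvg_bigsum => j.
apply: (cvgZ (@cvg_gram_inv i j)); apply: (cvgB (@qc i j)); apply: cvg_bigsum => k.
exact: (cvgZ (@cvg_jet_christoffel k i j) (@pc k)).
Qed.

Lemma cvg_jet_density :
  Num.sqrt (gram_det (p^~ t)) @[t --> l] --> Num.sqrt (gram_det p0).
Proof.
apply: (@continuous_cvg _ _ _ _ _ (fun t => gram_det (p^~ t)) Num.sqrt).
  exact: sqrt_continuous.
exact: cvg_gram_det.
Qed.

Lemma cvg_jet_energy :
  jet_energy (p^~ t) (fun i j => q i j t) @[t --> l] --> jet_energy p0 q0.
Proof. exact: (cvgM (cvg_dot cvg_jet_H cvg_jet_H) cvg_jet_density). Qed.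

Lemma cvg_jet_variation :
  jet_variation (p^~ t) (fun i j => q i j t) (dp^~ t) (fun i j => dq i j t) @[t --> l]
    --> jet_variation p0 q0 dp0 dq0.
Proof.
apply: (cvgM cvg_jet_density); apply: cvgD; first apply: cvgD.
- apply: cvg_bigsum => i; apply: cvg_bigsum => j.
  apply: (cvgM (@cvg_gram_inv i j)); apply: (cvg_dot cvg_jet_H).
  apply: (cvgB (@dqc i j)); apply: cvg_bigsum => k.
  exact: (cvgZ (@cvg_jet_christoffel k i j) (@dpc k)).
- apply: cvg_bigsum => i; apply: cvg_bigsum => j.
  apply: (@cvgM _ _ _ _ _ _ _ _ _ (cvg_dot cvg_jet_H (@qc i j))).
  apply: cvgN; apply: cvg_bigsum => k; apply: cvg_bigsum => n.
  apply: (cvgM (cvgM (@cvg_gram_inv i k) (@cvg_gram_inv j n))).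
  exact: (cvgD (cvg_dot (@dpc k) (@pc n)) (cvg_dot (@pc k) (@dpc n))).
apply: (cvgM (cvg_dot cvg_jet_H cvg_jet_H)).
apply: cvg_bigsum => i; apply: cvg_bigsum => j.
exact: (cvgM (@cvg_gram_inv i j) (cvg_dot (@pc i) (@dpc j))).
Qed.

End JetContinuity.

(** * Cut-off functions *)

Section Plateau.
Context {R : realType}.

(** A smooth transition from 0 to 1 on the unit interval. The denominator is positive because [t]
    and [1 - t] are never both nonpositive. *)
Definition step (t : R) : R := flat t / (flat t + flat (1 - t)).

Lemma step_den_gt0 (t : R) : 0 < flat t + flat (1 - t).
Proof.
have [t0|t0] := ltP 0 t.
  by rewrite ltr_pwDl ?flat_ge0 // flat_gt0.
by rewrite ltr_wpDl ?flat_ge0 // flat_gt0 // subr_gt0 (le_lt_trans t0).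
Qed.

Lemma step_ge0 t : 0 <= step t.
Proof. by rewrite divr_ge0 ?flat_ge0 // ltW // step_den_gt0. Qed.

Lemma step_eq0 t : t <= 0 -> step t = 0.
Proof. by move=> t0; rewrite /step flat_eq0 // mul0r. Qed.

Lemma step_eq1 t : 1 <= t -> step t = 1.
Proof.
move=> t1; have t0 : 0 < t by rewrite (lt_le_trans _ t1).
rewrite /step [flat (1 - t)]flat_eq0 ?subr_le0 // addr0 divff //.
by rewrite gt_eqF // flat_gt0.
Qed.

Lemma smooth_step (U : set (R * R)) (f : R * R -> R) : open U -> smooth_on U f ->
  smooth_on U (fun x => step (f x)).
Proof.
move=> oU fU; apply: (smooth_onM oU (smooth_on_flat oU fU)).
apply: (smooth_onV oU); first by move=> x _; rewrite gt_eqF // step_den_gt0.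
apply: (smooth_onD oU (smooth_on_flat oU fU)); apply: (smooth_on_flat oU).
exact: (smooth_onB oU (smooth_on_cst 1 oU) fU).
Qed.

(** Equal to 1 where the absolute value of [s] is at most [r], and to 0 where it is at least
    [2 * r]; the two factors are the two flanks. *)
Definition plateau1 (r s : R) : R := step ((2 * r - s) / r) * step ((2 * r + s) / r).

Lemma plateau1_ge0 r s : 0 <= plateau1 r s.
Proof. by rewrite mulr_ge0 ?step_ge0. Qed.

Lemma plateau1_eq1 r s : 0 < r -> `|s| <= r -> plateau1 r s = 1.
Proof.
move=> r0; rewrite ler_norml => /andP[h1 h2].
by rewrite /plateau1 !step_eq1 ?mulr1 // ler_pdivlMr // mul1r; lra.
Qed.

Lemma plateau1_eq0 r s : 0 < r -> 2 * r <= `|s| -> plateau1 r s = 0.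
Proof.
move=> r0; rewrite ler_normr /plateau1 => /orP[h|h].
  by rewrite step_eq0 ?mul0r // ler_pdivrMr // mul0r; lra.
by rewrite [X in _ * X]step_eq0 ?mulr0 // ler_pdivrMr // mul0r; lra.
Qed.

Definition plateau (p : R * R) (r : R) (x : R * R) : R :=
  plateau1 r (x.1 - p.1) * plateau1 r (x.2 - p.2).

Lemma plateau_ge0 p r x : 0 <= plateau p r x.
Proof. by rewrite mulr_ge0 ?plateau1_ge0. Qed.

Definition csquare (p : R * R) (r : R) : set (R * R) :=
  [set x | `|x.1 - p.1| <= r /\ `|x.2 - p.2| <= r].

Lemma plateau_eq1 p r x : 0 < r -> csquare p r x -> plateau p r x = 1.
Proof. by move=> r0 [h1 h2]; rewrite /plateau !plateau1_eq1 ?mulr1. Qed.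

Lemma plateau_eq0 p r x : 0 < r -> ~ ball p (2 * r) x -> plateau p r x = 0.
Proof.
move=> r0; rewrite ball_sup => /negP; rewrite negb_and -!leNgt /plateau.
by case/orP => h; [rewrite plateau1_eq0 ?mul0r|rewrite [X in _ * X]plateau1_eq0 ?mulr0].
Qed.

Lemma smooth_plateau (U : set (R * R)) p r : open U -> smooth_on U (plateau p r).
Proof.
move=> oU.
have H (f : R * R -> R) (a : R) : smooth_on U f -> smooth_on U (fun x => plateau1 r (f x - a)).
  move=> fU; have gU : smooth_on U (fun x => f x - a) by exact: (smooth_onB oU fU (smooth_on_cst
    a oU)).
  have c2 : smooth_on U (fun=> 2 * r) by exact: smooth_on_cst.
  have cV : smooth_on U (fun=> r^-1) by exact: smooth_on_cst.
  apply: (smooth_onM oU); apply: (smooth_step oU); apply: (smooth_onM oU _ cV).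
    exact: (smooth_onB oU c2 gU).
  exact: (smooth_onD oU c2 gU).
exact: (smooth_onM oU (H _ p.1 (smooth_on_fst oU)) (H _ p.2 (smooth_on_snd oU))).
Qed.

Lemma csquareE (p : R * R) (r : R) :
  csquare p r = `[p.1 - r, p.1 + r]%classic `*` `[p.2 - r, p.2 + r]%classic.
Proof.
have E (s c : R) : (`|s - c| <= r) = (s \in `[c - r, c + r]%R).
  by rewrite in_itv /= ler_distl.
apply/seteqP; split => x [h1 h2]; split.
- by move: h1; rewrite /= E.
- by move: h2; rewrite /= E.
- by move: h1; rewrite /= -E.
- by move: h2; rewrite /= -E.
Qed.

Lemma compact_csquare (p : R * R) (r : R) : compact (csquare p r).
Proof. by rewrite csquareE; apply: compact_setX; exact: segment_compact. Qed.

Lemma csquare_measure (p : R * R) (r : R) : 0 < r ->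
  @lebesgue2 R (csquare p r) = ((2 * r) * (2 * r))%:E.
Proof.
move=> r0; rewrite csquareE; set A := `[p.1 - r, p.1 + r]%classic;
  set B := `[p.2 - r, p.2 + r]%classic.
have side (c : R) : (lebesgue_measure (`[(c - r)%R, (c + r)%R]%classic : set R) = (2 * r)%:E)%E.
  rewrite lebesgue_measure_itv /= lte_fin ifT; last by lra.
  by rewrite -EFinB; congr EFin; ring.
have E : @lebesgue2 R (A `*` B) = (lebesgue_measure (A : set R) * lebesgue_measure (B : set R))%E.
  by apply: product_measure1E; exact: measurable_itv.
by rewrite E !side EFinM.
Qed.

End Plateau.

(** * Extension by zero of compactly supported functions *)

Section CompactSupport.
Context {R : realType}.
Local Notation T2 := (measurableTypeR R * measurableTypeR R)%type.
Local Notation mu2 := (@lebesgue2 R).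
Variables (W C : set (R * R)).
Hypothesis oW : open W.
Hypothesis cC : compact C.
Hypothesis CW : C `<=` W.

Lemma open_compactC : open (~` C).
Proof. exact: (closed_openC (compact_closed hausdorff_plane cC)). Qed.

Lemma restrict_in (f : R * R -> R) x : C x -> (f \_ C) x = f x.
Proof. by move=> Cx; rewrite patchE ifT // inE. Qed.

Lemma restrict_out (f : R * R -> R) x : ~ C x -> (f \_ C) x = 0.
Proof. by move=> Cx; rewrite patchE ifF //; apply/negP; rewrite inE. Qed.

Variable f : R * R -> R.
Hypothesis fW : smooth_on W f.
Hypothesis f0 : forall x, W x -> ~ C x -> f x = 0.

Lemma restrict_eq x : W x -> (f \_ C) x = f x.
Proof.
move=> Wx; have [Cx|Cx] := pselect (C x); first by rewrite restrict_in.
by rewrite restrict_out // f0.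
Qed.

(** Smoothness is local, and the plane is covered by [W], where the extension is [f], and by the
    open complement of [C], where it is 0. *)
Lemma smooth_restrict : smooth_on setT (f \_ C).
Proof.
have h1 : smooth_on W (f \_ C).
  by apply: (smooth_on_eq oW _ fW) => x Wx; rewrite restrict_eq.
have h2 : smooth_on (~` C) (f \_ C).
  by apply: (smooth_on_eq open_compactC _ (smooth_on_cst 0 open_compactC)) => x Cx;
    rewrite restrict_out.
apply: smooth_on_sub (smooth_on_bigcup h1 h2) => x _.
by have [Cx|Cx] := pselect (C x); [left; exact: CW|right].
Qed.

Lemma pderiv_restrict i : pderiv i (f \_ C) = (pderiv i f) \_ C.
Proof.
apply/funext => x; have [Cx|Cx] := pselect (C x).
  rewrite restrict_in //; apply: (eq_on_derive _ oW (CW Cx)) => y Wy.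
  exact: restrict_eq.
rewrite restrict_out // -[RHS](derive_cst (0 : R) x (basis2 i)).
by apply: (eq_on_derive _ open_compactC Cx) => y Cy; exact: restrict_out.
Qed.

Lemma smooth_restrict_supp : exists r, continuous_supp (f \_ C) r.
Proof.
have [r r0 Cr] := compact_in_square cC.
exists r; split=> [x|x xr]; first exact: (smooth_on_continuous smooth_restrict Logic.I).
by apply: restrict_out => /Cr.
Qed.

Lemma integral_pderiv_compact i : \int[mu2]_(x in C) pderiv i f x = 0.
Proof.
rewrite Rintegral_mkcond -pderiv_restrict.
have [r r0 Cr] := compact_in_square cC.
apply: (@integral_pderiv_eq0 _ i (f \_ C) r).
- by move=> x; exact: (smooth_on_derivable (i := i) smooth_restrict Logic.I).
- by move=> x; exact: (smooth_on_continuous (smooth_on_pderiv i smooth_restrict) Logic.I).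
- by move=> x xr; apply: restrict_out => /Cr.
split=> [x|x xr]; first exact: (smooth_on_continuous (smooth_on_pderiv i smooth_restrict) Logic.I).
by rewrite pderiv_restrict restrict_out // => /Cr.
Qed.

Lemma integral_restrict_open : \int[mu2]_x ((f \_ W) x) = \int[mu2]_(x in C) f x.
Proof.
rewrite [RHS]Rintegral_mkcond; congr (Rintegral _ _ _); apply/funext => x.
have [Wx|Wx] := pselect (W x).
  by rewrite restrict_eq // patchE ifT // inE.
rewrite patchE ifF; last by apply/negP; rewrite inE.
by rewrite restrict_out // => /CW.
Qed.

End CompactSupport.

(** * Change of variables *)

Section Homotopy.
Context {R : realType}.
Local Notation T2 := (measurableTypeR R * measurableTypeR R)%type.
Local Notation mu2 := (@lebesgue2 R).

Definition jac (a b : R * R -> R) x : R :=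
  pderiv 0 a x * pderiv 1 b x - pderiv 0 b x * pderiv 1 a x.

Variables (W C : set (R * R)) (a b c d g : R * R -> R).
Hypotheses (oW : open W) (cC : compact C) (CW : C `<=` W).
Hypotheses (aW : smooth_on W a) (bW : smooth_on W b).
Hypotheses (cW : smooth_on W c) (dW : smooth_on W d).
Hypothesis gS : smooth_on setT g.

Let xi x := c x - a x.
Let eta x := d x - b x.
Let a_ s x := a x + s * xi x.
Let b_ s x := b x + s * eta x.

(** During the homotopy the support of the integrand stays in one compact set, so no boundary term
    appears. *)
Hypothesis supp : forall s x, 0 <= s <= 1 -> W x -> g (a_ s x, b_ s x) != 0 -> C x.

Let xiW : smooth_on W xi. Proof. exact: (smooth_onB oW cW aW). Qed.
Let etaW : smooth_on W eta. Proof. exact: (smooth_onB oW dW bW). Qed.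
Let a_W s : smooth_on W (a_ s).
Proof. exact: (smooth_onD oW aW (smooth_onM oW (smooth_on_cst s oW) xiW)). Qed.
Let b_W s : smooth_on W (b_ s).
Proof. exact: (smooth_onD oW bW (smooth_onM oW (smooth_on_cst s oW) etaW)). Qed.
Let G s x := g (a_ s x, b_ s x).
Let GW s : smooth_on W (G s).
Proof. exact: (smooth_on_comp oW openT (fun _ _ => Logic.I) gS (a_W s) (b_W s)). Qed.
Let ga s x := pderiv 0 g (a_ s x, b_ s x).
Let gb s x := pderiv 1 g (a_ s x, b_ s x).
Let A i s x := pderiv i (a_ s) x.
Let B i s x := pderiv i (b_ s) x.
(** [X0] and [X1] are the components of [G s] times the cofactor matrix of the differential, applied
    to the velocity [(xi, eta)]. *)
Let X0 s x := G s x * (xi x * B 1 s x - eta x * A 1 s x).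
Let X1 s x := G s x * (eta x * A 0 s x - xi x * B 0 s x).
(** Explicitly affine in [s], unlike [A] and [B]: [Phi] can then be differentiated in [s] at every
    point of the plane, and the agreement with [A] and [B] is only used on [W]. *)
Let A' i s x := pderiv i a x + s * pderiv i xi x.
Let B' i s x := pderiv i b x + s * pderiv i eta x.
Let Phi s x := G s x * (A' 0 s x * B' 1 s x - B' 0 s x * A' 1 s x).
Let Psi s x := (ga s x * xi x + gb s x * eta x) * (A' 0 s x * B' 1 s x - B' 0 s x * A' 1 s x)
  + G s x * (pderiv 0 xi x * B' 1 s x + A' 0 s x * pderiv 1 eta x
             - (pderiv 0 eta x * A' 1 s x + B' 0 s x * pderiv 1 xi x)).

Let dAE i s x : W x -> A i s x = A' i s x.
Proof.
move=> Wx; have H := is_derive_add (smooth_on_is_derive i aW Wx)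
  (is_derive_mul (is_derive_cst s x (basis2 i)) (smooth_on_is_derive i xiW Wx)).
by have [_ E] := H; rewrite /A; refine (etrans E _); rewrite mul0r add0r.
Qed.

Let dBE i s x : W x -> B i s x = B' i s x.
Proof.
move=> Wx; have H := is_derive_add (smooth_on_is_derive i bW Wx)
  (is_derive_mul (is_derive_cst s x (basis2 i)) (smooth_on_is_derive i etaW Wx)).
by have [_ E] := H; rewrite /B; refine (etrans E _); rewrite mul0r add0r.
Qed.

Let Gd i s x : W x -> is_derive x (basis2 i) (G s) (A i s x * ga s x + B i s x * gb s x).
Proof.
move=> Wx.
exact: (is_derive_comp2 (smooth_on_differentiable oW (a_W s) Wx)
  (smooth_on_differentiable oW (b_W s) Wx)
  (smooth_on_differentiable openT gS (Logic.I : setT (a_ s x, b_ s x)))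
  (smooth_on_is_derive i (a_W s) Wx) (smooth_on_is_derive i (b_W s) Wx)).
Qed.

Let X0W s : smooth_on W (X0 s).
Proof.
exact: (smooth_onM oW (GW s) (smooth_onB oW
  (smooth_onM oW xiW (smooth_on_pderiv 1 (b_W s)))
  (smooth_onM oW etaW (smooth_on_pderiv 1 (a_W s))))).
Qed.

Let X1W s : smooth_on W (X1 s).
Proof.
exact: (smooth_onM oW (GW s) (smooth_onB oW
  (smooth_onM oW etaW (smooth_on_pderiv 0 (a_W s)))
  (smooth_onM oW xiW (smooth_on_pderiv 0 (b_W s))))).
Qed.

(* By the symmetry of second derivatives. *)
Let PsiE s x : W x -> Psi s x = pderiv 0 (X0 s) x + pderiv 1 (X1 s) x.
Proof.
move=> Wx.
have AS i := smooth_on_pderiv i (a_W s); have BS i := smooth_on_pderiv i (b_W s).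
have d0 := is_derive_mul (Gd 0 s Wx) (is_derive_sub
  (is_derive_mul (smooth_on_is_derive 0 xiW Wx) (smooth_on_is_derive 0 (BS 1) Wx))
  (is_derive_mul (smooth_on_is_derive 0 etaW Wx) (smooth_on_is_derive 0 (AS 1) Wx))).
have d1 := is_derive_mul (Gd 1 s Wx) (is_derive_sub
  (is_derive_mul (smooth_on_is_derive 1 etaW Wx) (smooth_on_is_derive 1 (AS 0) Wx))
  (is_derive_mul (smooth_on_is_derive 1 xiW Wx) (smooth_on_is_derive 1 (BS 0) Wx))).
have [_ e0] := d0; have [_ e1] := d1.
refine (etrans _ (esym (f_equal2 +%R e0 e1))).
have sa := schwarz 0 1 oW (a_W s) Wx; have sb := schwarz 0 1 oW (b_W s) Wx.
rewrite {}sa {}sb /Psi -!(dAE _ _ Wx) -!(dBE _ _ Wx) /A /B.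
move: (pderiv 1 (pderiv 0 (a_ s)) x) (pderiv 1 (pderiv 0 (b_ s)) x) (G s x) (ga s x) (gb s x).
move: (pderiv 0 (a_ s) x) (pderiv 1 (a_ s) x) (pderiv 0 (b_ s) x) (pderiv 1 (b_ s) x).
move: (pderiv 0 xi x) (pderiv 1 xi x) (pderiv 0 eta x) (pderiv 1 eta x) (xi x) (eta x).
by move=> *; ring.
Qed.


Let derive_affine (p q s : R) : is_derive (s : R) (1 : R) (fun t => p + t * q) q.
Proof.
have := is_derive_add (is_derive_cst p s (1 : R))
  (is_derive_mul (is_derive_id s (1 : R)) (is_derive_cst q s (1 : R))).
by rewrite mul1r mulr0 addr0 add0r.
Qed.

Let derive_G s x : is_derive (s : R) (1 : R) (fun t => G t x) (ga s x * xi x + gb s x * eta x).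
Proof.
have da := derive_affine (a x) (xi x) s; have db := derive_affine (b x) (eta x) s.
have fa : differentiable (fun t => a_ t x) s by apply/derivable1_diffP; case: da.
have fb : differentiable (fun t => b_ t x) s by apply/derivable1_diffP; case: db.
have := is_derive_comp2 fa fb
  (smooth_on_differentiable openT gS (Logic.I : setT (a_ s x, b_ s x))) da db.
by rewrite mulrC [X in _ + X]mulrC.
Qed.

Let derive_Phi s x : is_derive (s : R) (1 : R) (fun t => Phi t x) (Psi s x).
Proof.
have dA i := derive_affine (pderiv i a x) (pderiv i xi x) s.
have dB i := derive_affine (pderiv i b x) (pderiv i eta x) s.
exact: (is_derive_mul (derive_G s x)
  (is_derive_sub (is_derive_mul (dA 0) (dB 1)) (is_derive_mul (dB 0) (dA 1)))).
Qed.

Let cont2 (f : R * R -> R) (s : R) (x : R * R) : smooth_on W f -> W x ->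
  f z.2 @[z --> (s, x)] --> f x.
Proof.
move=> fW Wx; apply: (@continuous_cvg _ _ _ _ _ (fun z : R * (R * R) => z.2) f).
  exact: (smooth_on_continuous fW Wx).
exact: cvg_snd.
Qed.

Let cont_affine (f h : R * R -> R) (s : R) (x : R * R) : smooth_on W f -> smooth_on W h -> W x ->
  f z.2 + z.1 * h z.2 @[z --> (s, x)] --> f x + s * h x.
Proof.
move=> fW hW Wx; apply: (cvgD (@cont2 _ s _ fW Wx) (cvgM _ (@cont2 _ s _ hW Wx))).
exact: cvg_fst.
Qed.

Let cont_g (f : R * R -> R) (s : R) (x : R * R) : smooth_on setT f -> W x ->
  f (a_ z.1 z.2, b_ z.1 z.2) @[z --> (s, x)] --> f (a_ s x, b_ s x).
Proof.
move=> fS Wx.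
apply: (@continuous_cvg _ _ _ _ _ (fun z : R * (R * R) => (a_ z.1 z.2, b_ z.1 z.2)) f).
  exact: (smooth_on_continuous fS Logic.I).
have c1 := @cont_affine _ _ s _ aW xiW Wx; have c2 := @cont_affine _ _ s _ bW etaW Wx.
apply: (@cvg_pair _ _ _ _ (nbhs (a_ s x)) (nbhs (b_ s x)) _ _ _ _ _ c1 c2).
Qed.

Let cont_Psi s x : W x -> {for (s, x), continuous (fun z => Psi z.1 z.2)}.
Proof.
move=> Wx.
have cA i := @cont_affine _ _ s _ (smooth_on_pderiv i aW) (smooth_on_pderiv i xiW) Wx.
have cB i := @cont_affine _ _ s _ (smooth_on_pderiv i bW) (smooth_on_pderiv i etaW) Wx.
have cxi i := @cont2 _ s _ (smooth_on_pderiv i xiW) Wx.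
have ceta i := @cont2 _ s _ (smooth_on_pderiv i etaW) Wx.
have cg := @cont_g _ s _ gS Wx.
have cga := @cont_g _ s _ (smooth_on_pderiv 0 gS) Wx.
have cgb := @cont_g _ s _ (smooth_on_pderiv 1 gS) Wx.
have cx := @cont2 _ s _ xiW Wx; have ce := @cont2 _ s _ etaW Wx.
exact: (cvgD (cvgM (cvgD (cvgM cga cx) (cvgM cgb ce))
    (cvgB (cvgM (cA 0) (cB 1)) (cvgM (cB 0) (cA 1))))
  (cvgM cg (cvgB (cvgD (cvgM (cxi 0) (cB 1)) (cvgM (cA 0) (ceta 1)))
    (cvgD (cvgM (ceta 0) (cA 1)) (cvgM (cB 0) (cxi 1)))))).
Qed.

Let cont_Phi s : {within C, continuous (Phi s)}.
Proof.
have AW' i : smooth_on W (A' i s).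
  exact: (smooth_onD oW (smooth_on_pderiv i aW) (smooth_onM oW (smooth_on_cst s oW)
    (smooth_on_pderiv i xiW))).
have BW' i : smooth_on W (B' i s).
  exact: (smooth_onD oW (smooth_on_pderiv i bW) (smooth_onM oW (smooth_on_cst s oW)
    (smooth_on_pderiv i etaW))).
have PW : smooth_on W (Phi s) := smooth_onM oW (GW s)
  (smooth_onB oW (smooth_onM oW (AW' 0) (BW' 1)) (smooth_onM oW (BW' 0) (AW' 1))).
apply: continuous_in_subspaceT => x; rewrite inE => Cx.
exact: (smooth_on_continuous PW (CW Cx)).
Qed.

Let derive_integral s : is_derive (s : R) (1 : R)
  (fun t => \int[mu2]_(x in C) Phi t x) (\int[mu2]_(x in C) Psi s x).
Proof.
apply: (is_derive_integral_compact cC).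
- by apply: filterE => t x _; exact: derive_Phi.
- by apply: filterE => t; exact: cont_Phi.
- by move=> x Cx; exact: (@cont_Psi s x (CW Cx)).
Qed.

Let integral_Psi s : 0 <= s <= 1 -> \int[mu2]_(x in C) Psi s x = 0.
Proof.
move=> s01.
have G0 x : W x -> ~ C x -> G s x = 0.
  by move=> Wx Cx; apply/eqP/negPn/negP => /(supp s01 Wx).
have i0 : \int[mu2]_(x in C) pderiv 0 (X0 s) x = 0.
  by apply: (integral_pderiv_compact oW cC CW (X0W s)) => x Wx Cx; rewrite /X0 G0 ?mul0r.
have i1 : \int[mu2]_(x in C) pderiv 1 (X1 s) x = 0.
  by apply: (integral_pderiv_compact oW cC CW (X1W s)) => x Wx Cx; rewrite /X1 G0 ?mul0r.
have cint (f : R * R -> R) : smooth_on W f -> mu2.-integrable (C : set T2) (EFin \o f).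
  move=> fW; apply: (continuous_compact_integrable2 cC); apply: continuous_in_subspaceT => x.
  by rewrite inE => Cx; exact: (smooth_on_continuous fW (CW Cx)).
transitivity (\int[mu2]_(x in C) (pderiv 0 (X0 s) x + pderiv 1 (X1 s) x)).
  by apply: eq_Rintegral => x; rewrite inE => Cx; exact: (@PsiE s x (CW Cx)).
have mC := compact_measurable2 cC.
have int0 := cint _ (smooth_on_pderiv 0 (X0W s)).
have int1 := cint _ (smooth_on_pderiv 1 (X1W s)).
exact: (etrans (RintegralD mC int0 int1) (etrans (f_equal2 +%R i0 i1) (addr0 0))).
Qed.

Lemma homotopy_integral :
  \int[mu2]_(x in C) (g (a x, b x) * jac a b x) = \int[mu2]_(x in C) (g (c x, d x) * jac c d x).
Proof.
pose I s := \int[mu2]_(x in C) Phi s x.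
have I0 : I 0 = \int[mu2]_(x in C) (g (a x, b x) * jac a b x).
  apply: eq_Rintegral => x _.
  rewrite /Phi /G /a_ /b_ /A' /B' !mul0r !addr0; exact: erefl.
have I1 : I 1 = \int[mu2]_(x in C) (g (c x, d x) * jac c d x).
  apply: eq_Rintegral => x; rewrite inE => /CW Wx.
  have exi i : pderiv i xi x = pderiv i c x - pderiv i a x.
    by have [_ E] := is_derive_sub (smooth_on_is_derive i cW Wx) (smooth_on_is_derive i aW Wx).
  have eeta i : pderiv i eta x = pderiv i d x - pderiv i b x.
    by have [_ E] := is_derive_sub (smooth_on_is_derive i dW Wx) (smooth_on_is_derive i bW Wx).
  have e (p q : R) : p + 1 * (q - p) = q by rewrite mul1r addrC subrK.
  have eA i : A' i 1 x = pderiv i c x by rewrite /A' exi e.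
  have eB i : B' i 1 x = pderiv i d x by rewrite /B' eeta e.
  have eG : G 1 x = g (c x, d x) := f_equal2 (fun u v => g (u, v)) (e _ _) (e _ _).
  exact: (f_equal2 *%R eG (f_equal2 (fun u v => u - v)
    (f_equal2 *%R (eA 0) (eB 1)) (f_equal2 *%R (eB 0) (eA 1)))).
have [s /andP[s0 s1] E] := @MVT R I (fun s => \int[mu2]_(x in C) Psi s x) 0 1 ltr01
   (fun s _ => derive_integral s) ltac:(by apply: derivable_within_continuous => s _;
     case: (derive_integral s)).
move: E; rewrite subr0 mulr1 integral_Psi; last first.
  by move: s0 s1; rewrite !bnd_simp => /ltW -> /ltW ->.
rewrite I0 I1 => /eqP; rewrite subr_eq0 => /eqP E; exact: (esym E).
Qed.

End Homotopy.

Section Affine.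
Context {R : realType}.
Local Notation T2 := (measurableTypeR R * measurableTypeR R)%type.
Local Notation mu2 := (@lebesgue2 R).

Definition affine (e a b : R) (x : R * R) : R := e + linear2 a b x.

Lemma smooth_affine (U : set (R * R)) e a b : open U -> smooth_on U (affine e a b).
Proof. by move=> oU; exact: (smooth_onD oU (smooth_on_cst e oU) (smooth_on_linear2 a b oU)). Qed.

Lemma pderiv_affine i e a b x : pderiv i (affine e a b) x = linear2 a b (basis2 i).
Proof.
have H : is_derive x (basis2 i) (linear2 a b) (linear2 a b (basis2 i)).
  have D : differentiable (linear2 a b) x.
    by apply: linear_differentiable; apply: linear2_continuous.
  apply: DeriveDef; first exact: diff_derivable.
  have E := pderiv_diff i D; refine (etrans E _).
  by rewrite diff_lin //; exact: linear2_continuous.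
have [_ E] := is_derive_add (is_derive_cst e x (basis2 i)) H.
by refine (etrans E _); rewrite add0r.
Qed.

Lemma jac_affine e f a b c d x : jac (affine e a b) (affine f c d) x = a * d - b * c.
Proof. by rewrite /jac !pderiv_affine /linear2 /basis2 /=; ring. Qed.

Lemma integral_support (D : set (R * R)) (f : R * R -> R) : (forall x, f x != 0 -> D x) ->
  \int[mu2]_(x in D) f x = \int[mu2]_x f x.
Proof.
move=> f0; rewrite Rintegral_mkcond; congr (Rintegral _ _ _); apply/funext => x.
rewrite patchE; case: ifPn => // /negP Dx; apply/esym/eqP/negPn/negP => /f0 h.
by apply: Dx; rewrite inE.
Qed.

Variables (g : R * R -> R) (M : R).
Hypothesis gS : smooth_on setT g.
Hypothesis gM : forall x, ~ square M x -> g x = 0.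

Definition affine_integral e f a b c d : R :=
  \int[mu2]_x (g (affine e a b x, affine f c d x) * (a * d - b * c)).

(** Cramer's rule. It bounds preimages uniformly along a path of matrices whose determinants stay
    above [D]. *)
Lemma det_bound (a b c d e f x y S N D : R) : 0 < D -> D <= a * d - b * c ->
  `|a| <= S -> `|b| <= S -> `|c| <= S -> `|d| <= S -> `|e| <= N -> `|f| <= N ->
  a * x + b * y = e -> c * x + d * y = f ->
  `|x| <= 2 * S * N / D /\ `|y| <= 2 * S * N / D.
Proof.
move=> D0 Ddet aS bS cS dS eN fN xe yf.
have E1 : (a * d - b * c) * x = d * e - b * f by rewrite -xe -yf; ring.
have E2 : (a * d - b * c) * y = a * f - c * e by rewrite -xe -yf; ring.
have prod (p q : R) : `|p| <= S -> `|q| <= N -> `|p * q| <= S * N.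
  by move=> h1 h2; rewrite normrM ler_pM.
have key (z u v : R) : (a * d - b * c) * z = u - v -> `|u| <= S * N -> `|v| <= S * N ->
    `|z| <= 2 * S * N / D.
  move=> E hu hv; rewrite ler_pdivlMr // mulrC; apply: (@le_trans _ _ `|(a * d - b * c) * z|).
    by rewrite normrM ler_wpM2r // (le_trans Ddet) // ler_norm.
  rewrite E; apply: le_trans (ler_normB _ _) _.
  by rewrite -mulrA mulr2n mulrDl mul1r lerD.
by split; [apply: key E1 _ _|apply: key E2 _ _]; exact: prod.
Qed.

Lemma affine_homotopy e f a b c d e' f' a' b' c' d' D : 0 < D ->
  (forall s, 0 <= s <= 1 -> D <= (a + s * (a' - a)) * (d + s * (d' - d))
                               - (b + s * (b' - b)) * (c + s * (c' - c))) ->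
  affine_integral e f a b c d = affine_integral e' f' a' b' c' d'.
Proof.
move=> D0 HD.
(* [S] bounds all the interpolated coefficients, [N] the points of the support after the translation
   is removed, and [r] is the resulting bound of [det_bound]. *)
pose S := `|a| + `|b| + `|c| + `|d| + `|a'| + `|b'| + `|c'| + `|d'|.
pose N := `|M| + `|e| + `|f| + `|e'| + `|f'|.
pose r := 2 * S * N / D.
have supp s x : 0 <= s <= 1 -> setT x ->
   g (affine e a b x + s * (affine e' a' b' x - affine e a b x),
      affine f c d x + s * (affine f' c' d' x - affine f c d x)) != 0 -> square r x.
  move=> /andP[s0 s1] _ gx.
  have interp (p q P : R) : `|p| + `|q| <= P -> `|p + s * (q - p)| <= P.
    move=> h; apply: le_trans h; rewrite (_ : p + _ = (1 - s) * p + s * q); last by ring.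
    apply: le_trans (ler_normD _ _) _; rewrite !normrM (ger0_norm s0) ger0_norm ?subr_ge0 //.
    by apply: lerD; rewrite ler_piMl // gerBl.
  have := contrapT (fun H => negP gx (introT eqP (gM H))).
  move=> /squareP /= [u1 v1]; apply/squareP.
  have n0 (z : R) : 0 <= `|z| by [].
  have := (n0 a, n0 b, n0 c, n0 d, (n0 a', n0 b', n0 c', n0 d'), (n0 e, n0 f, n0 e', n0 f')).
  move=> [[[[[[? ?] ?] ?] [[[? ?] ?] ?]] [[[? ?] ?] ?]]].
  have Mn := ler_norm M.
  apply: (det_bound D0 (HD s _) (interp a a' S _) (interp b b' S _) (interp c c' S _)
    (interp d d' S _) (e := affine e a b x + s * (affine e' a' b' x - affine e a b x) - (e + s *
      (e' - e)))
    (f := affine f c d x + s * (affine f' c' d' x - affine f c d x) - (f + s * (f' - f))) (N := N)).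
  - by rewrite s0.
  - by rewrite /S; lra.
  - by rewrite /S; lra.
  - by rewrite /S; lra.
  - by rewrite /S; lra.
  - apply: le_trans (ler_normB _ _) _; have := interp e e' _ (lexx _); rewrite /N; lra.
  - apply: le_trans (ler_normB _ _) _; have := interp f f' _ (lexx _); rewrite /N; lra.
  - by rewrite /affine /linear2; ring.
  - by rewrite /affine /linear2; ring.
have J e1 f1 a1 b1 c1 d1 : (forall x, g (affine e1 a1 b1 x, affine f1 c1 d1 x) != 0 ->
  square r x) ->
    \int[mu2]_(x in square r) (g (affine e1 a1 b1 x, affine f1 c1 d1 x)
       * jac (affine e1 a1 b1) (affine f1 c1 d1) x) = affine_integral e1 f1 a1 b1 c1 d1.
  move=> H; transitivity (\int[mu2]_(x in square r)
      (g (affine e1 a1 b1 x, affine f1 c1 d1 x) * (a1 * d1 - b1 * c1))).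
    apply: eq_Rintegral => x _; have E := jac_affine e1 f1 a1 b1 c1 d1 x.
    exact: (f_equal2 *%R erefl E).
  apply: integral_support => x; rewrite mulf_eq0 negb_or => /andP[gx _]; exact: H.
have H0 x : g (affine e a b x, affine f c d x) != 0 -> square r x.
  move=> gx; apply: (supp 0 x _ Logic.I); first by rewrite lexx ler01.
  by rewrite !mul0r !addr0.
have H1 x : g (affine e' a' b' x, affine f' c' d' x) != 0 -> square r x.
  move=> gx; apply: (supp 1 x _ Logic.I); first by rewrite lexx ler01.
  by rewrite !mul1r ![_ + (_ - _)]addrC !subrK.
have := @homotopy_integral R setT (square r) _ _ _ _ g openT (@compact_square R r) (fun _ _ =>
  Logic.I)
  (smooth_affine e a b openT) (smooth_affine f c d openT)
  (smooth_affine e' a' b' openT) (smooth_affine f' c' d' openT) gS supp => E.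
exact: (etrans (esym (J _ _ _ _ _ _ H0)) (etrans E (J _ _ _ _ _ _ H1))).
Qed.

(** The determinant is affine in each row, so it stays above the smaller of its end values while a
    single row moves along a segment. *)
Lemma min_le_interp (s p q : R) : 0 <= s <= 1 -> Num.min p q <= p + s * (q - p).
Proof.
move=> /andP[s0 s1]; rewrite (_ : p + _ = (1 - s) * p + s * q); last by ring.
rewrite -[leLHS]mul1r -[X in X * _](subrK s) mulrDl; apply: lerD; apply: ler_wpM2l => //.
- by rewrite subr_ge0.
- by rewrite ge_min lexx.
- by rewrite ge_min lexx orbT.
Qed.

Lemma affine_row1 e f a b c d a' b' : 0 < a * d - b * c -> 0 < a' * d - b' * c ->
  affine_integral e f a b c d = affine_integral e f a' b' c d.
Proof.
move=> h h'; apply: (@affine_homotopy _ _ _ _ _ _ _ _ _ _ _ _ (Num.min (a * d - b * c) (a' * d -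
  b' * c))).
  by rewrite lt_min h.
move=> s s01; apply: le_trans (min_le_interp _ _ s01) _.
rewrite le_eqVlt; apply/orP; left; apply/eqP; ring.
Qed.

Lemma affine_row2 e f a b c d c' d' : 0 < a * d - b * c -> 0 < a * d' - b * c' ->
  affine_integral e f a b c d = affine_integral e f a b c' d'.
Proof.
move=> h h'; apply: (@affine_homotopy _ _ _ _ _ _ _ _ _ _ _ _ (Num.min (a * d - b * c) (a * d' -
  b * c'))).
  by rewrite lt_min h.
move=> s s01; apply: le_trans (min_le_interp _ _ s01) _.
rewrite le_eqVlt; apply/orP; left; apply/eqP; ring.
Qed.

(* The matrix is joined to the identity inside of the set of matrices with positive
   determinant by changing one row at a time. *)
Lemma affine_change_of_variables e f a b c d : 0 < a * d - b * c ->
  affine_integral e f a b c d = \int[mu2]_x g x.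
Proof.
move=> D0.
have I1 : affine_integral 0 0 1 0 0 1 = \int[mu2]_x g x.
  apply: eq_Rintegral => x _.
  have -> : (affine 0 1 0 x, affine 0 0 1 x) = x.
    by case: x => u v; rewrite /affine /linear2 /= !mulr1 !mulr0 !addr0 !add0r.
  by rewrite !mulr1 mulr0 subr0 mulr1.
rewrite -I1.
transitivity (affine_integral 0 0 a b c d).
  apply: (@affine_homotopy _ _ _ _ _ _ _ _ _ _ _ _ _ D0) => s _.
  by rewrite !subrr !mulr0 !addr0.
(* With a positive lower right entry, the first row can be moved to (1, 0), and then the second to
   (0, 1). *)
have pos_d a0 b0 c0 d0 : 0 < a0 * d0 - b0 * c0 -> 0 < d0 ->
    affine_integral 0 0 a0 b0 c0 d0 = affine_integral 0 0 1 0 0 1.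
  move=> h hd; transitivity (affine_integral 0 0 1 0 c0 d0).
    by apply: affine_row1 => //; rewrite mul1r mul0r subr0.
  by apply: affine_row2; rewrite mul0r subr0 mul1r.
(* The new second row ((a0 - 1) / b0, 1) gives determinant 1 and leads back to [pos_d]. *)
have nz_b a0 b0 c0 d0 : 0 < a0 * d0 - b0 * c0 -> b0 != 0 ->
    affine_integral 0 0 a0 b0 c0 d0 = affine_integral 0 0 1 0 0 1.
  move=> h hb; have h' : 0 < a0 * 1 - b0 * ((a0 - 1) / b0).
    by rewrite mulrCA divff // !mulr1 subKr.
  by rewrite (affine_row2 _ _ h h'); exact: pos_d.
have [d0|d0] := ltP 0 d; first exact: pos_d.
have [b0|b0] := eqVneq b 0; last exact: nz_b.
(* Here [b = 0]. It is replaced by 1 or -1, with the sign that does not decrease the determinant, in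
   order to reach [nz_b]. *)
have h : 0 < a * d - (if c <= 0 then 1 else -1) * c.
  move: D0; rewrite b0 mul0r subr0; case: (leP c 0) => c0 D0 /=.
    by rewrite mul1r subr_gt0 (le_lt_trans c0).
  by rewrite mulN1r opprK addr_gt0.
rewrite (affine_row1 _ _ D0 h); apply: nz_b h _.
by case: ifP; rewrite ?oppr_eq0 oner_eq0.
Qed.

End Affine.

Section ChangeOfVariables.
Context {R : realType}.
Local Notation T2 := (measurableTypeR R * measurableTypeR R)%type.
Local Notation mu2 := (@lebesgue2 R).
Variables (U V : set (R * R)) (a b : R * R -> R) (sigma : R * R -> R * R).
Hypotheses (oU : open U) (oV : open V).
Hypotheses (aU : smooth_on U a) (bU : smooth_on U b).
Hypothesis UV : forall x, U x -> V (a x, b x).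
Hypothesis VU : forall y, V y -> U (sigma y).
Hypothesis sigmaK : forall x, U x -> sigma (a x, b x) = x.
Hypothesis Ksigma : forall y, V y -> (a (sigma y), b (sigma y)) = y.
Hypothesis sigma_cont : forall y, V y -> {for y, continuous sigma}.
Hypothesis jac_gt0 : forall x, U x -> 0 < jac a b x.

Definition pullback (g : R * R -> R) : R * R -> R :=
  (fun x => g (a x, b x) * jac a b x) \_ U.

Lemma sum_norm4 (p q s t : R) : let S := 1 + `|p| + `|q| + `|s| + `|t| in
  [/\ 0 < S, `|p| <= S, `|q| <= S & `|s| <= S /\ `|t| <= S].
Proof.
have := (normr_ge0 p, normr_ge0 q, normr_ge0 s, normr_ge0 t).
by move=> [[[? ?] ?] ?] S; rewrite /S; split; [lra|lra|lra|split; lra].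
Qed.

Lemma first_order (f : R * R -> R) (p : R * R) (e : R) : 0 < e -> differentiable f p ->
  \forall x \near p, `|f x - f p - linear2 (pderiv 0 f p) (pderiv 1 f p) (x - p)| <= e * `|x - p|.
Proof.
move=> e0 fp.
have := diff_locally fp; rewrite funeqE => E.
have /eqaddoP /(_ _ e0) : f \o shift p = cst (f p) + 'd f p +o_ (0 : R * R) id.
  by rewrite -diff_locally.
move=> H.
have : \forall h \near (0 : R * R), `|f (h + p) - f p - 'd f p h| <= e * `|h|.
  apply: filterS H => h /=; rewrite /= => H; apply: le_trans H.
  by rewrite /cst /= -addrA -opprD.
move=> /nbhs_ballP [r /= r0 Hr]; apply/nbhs_ballP; exists r => //= x px.
have B : ball (0 : R * R) r (x - p).
  by move: px; rewrite -!ball_normE /ball_ /= sub0r normrN distrC.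
have := Hr _ B; rewrite subrK; apply: le_trans.
rewrite (_ : linear2 _ _ (x - p) = 'd f p (x - p)) //.
rewrite (pderiv_diff 0 fp) (pderiv_diff 1 fp) /linear2.
have -> : x - p = ((x - p).1, (x - p).2) by case: (x - p).
by rewrite /= pair_basis2 linearD !linearZ.
Qed.

Lemma pullback_support (g : R * R -> R) (D : set (R * R)) : D `<=` U ->
  (forall x, U x -> g (a x, b x) != 0 -> D x) ->
  \int[mu2]_x pullback g x = \int[mu2]_(x in D) (g (a x, b x) * jac a b x).
Proof.
move=> DU gD; rewrite [RHS]Rintegral_mkcond; congr (Rintegral _ _ _); apply/funext => x.
rewrite /pullback !patchE.
have [Ux|Ux] := pselect (U x); last first.
  by rewrite ifF ?ifF //; apply/negP; rewrite inE // => /DU.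
rewrite ifT ?inE //; case: ifPn => // /negP Dx.
have -> : g (a x, b x) = 0.
  by apply/eqP/negPn/negP => gx; apply: Dx; rewrite inE; exact: gD.
by rewrite mul0r.
Qed.

(* Near a point the map is homotopic to its affine approximation, through maps which
   send the complement of a small square off the support of the integrand. *)
Lemma local_change_of_variables y0 : V y0 -> exists2 r : R, 0 < r &
  (forall y, ball y0 r y -> V y) /\
  forall g, smooth_on setT g -> (forall y, ~ ball y0 r y -> g y = 0) ->
    \int[mu2]_x pullback g x = \int[mu2]_x g x.
Proof.
move=> Vy0; pose p := sigma y0.
have Up : U p := VU Vy0.
have [Ep1 Ep2] : a p = y0.1 /\ b p = y0.2 by rewrite -(Ksigma Vy0).
set a0 := pderiv 0 a p; set a1 := pderiv 1 a p; set b0 := pderiv 0 b p; set b1 := pderiv 1 b p.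
have D0 : 0 < a0 * b1 - a1 * b0.
  by have := jac_gt0 Up; rewrite /jac [pderiv 0 b p * _]mulrC.
set D := a0 * b1 - a1 * b0 in D0.
pose S := 1 + `|a0| + `|a1| + `|b0| + `|b1|.
have [S0 Sa0 Sa1 [Sb0 Sb1]] := sum_norm4 a0 a1 b0 b1; rewrite -/S in S0 Sa0 Sa1 Sb0 Sb1.
(* With this tolerance the linearization error contributes [n * D / 2] to the bound of [det_bound]
   for [n], the distance to [p]. Half of the left-hand side absorbs it, and [n <= 4 * S * r / D]
   remains. *)
pose e := D / (4 * S).
have e0 : 0 < e by rewrite divr_gt0 // mulr_gt0.
have [r0 r00 Hr0] : exists2 r0 : R, 0 < r0 & forall x, ball p r0 x ->
    [/\ U x, `|a x - a p - linear2 a0 a1 (x - p)| <= e * `|x - p| &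
        `|b x - b p - linear2 b0 b1 (x - p)| <= e * `|x - p|].
  have h1 := first_order e0 (smooth_on_differentiable oU aU Up).
  have h2 := first_order e0 (smooth_on_differentiable oU bU Up).
  have h3 := open_nbhs_nbhs (conj oU Up).
  have : \forall x \near p, [/\ U x, `|a x - a p - linear2 a0 a1 (x - p)| <= e * `|x - p| &
        `|b x - b p - linear2 b0 b1 (x - p)| <= e * `|x - p|].
    by apply: filterS3 h3 h1 h2 => x ? ? ?; split.
  by move=> /nbhs_ballP [r /= r_0 H]; exists r.
have [r1 r10 Hr1] : exists2 r1 : R, 0 < r1 & forall y, ball y0 r1 y -> V y /\ ball p r0 (sigma y).
  have h1 := open_nbhs_nbhs (conj oV Vy0).
  have h2 : \forall y \near y0, ball p r0 (sigma y).
    by apply: (sigma_cont Vy0); exact: nbhsx_ballx.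
  have : \forall y \near y0, V y /\ ball p r0 (sigma y) by apply: filterS2 h1 h2.
  by move=> /nbhs_ballP [r /= r_0 H]; exists r.
(* The second term makes [rho] at most [r0 / 2], so the closed square that carries the support lies
   in the ball where the linearization is controlled. *)
pose r := Num.min r1 (r0 * D / (8 * S)).
have r_gt0 : 0 < r by rewrite lt_min r10 divr_gt0 ?mulr_gt0.
have rr1 : r <= r1 by rewrite ge_min lexx.
have rr0 : 4 * S * r / D <= r0 / 2.
  have : r <= r0 * D / (8 * S) by rewrite ge_min lexx orbT.
  rewrite ler_pdivlMr ?mulr_gt0 // => h; rewrite ler_pdivrMr //.
  by move: h; clear; lra.
pose rho := 4 * S * r / D.
exists r => //; split=> [y yr|g gS gr].
  by have [] := Hr1 y (le_ball rr1 yr).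
have gball x : g x != 0 -> ball y0 r x by move=> gx; apply: contrapT => /gr E; rewrite E eqxx in gx.
pose c := affine (a p - linear2 a0 a1 p) a0 a1; pose d := affine (b p - linear2 b0 b1 p) b0 b1.
have oW : open (ball p r0) by exact: ball_open.
have CW : csquare p rho `<=` ball p r0.
  move=> x [h1 h2]; apply/ball_pairP.
  have h : rho < r0 by by apply: le_lt_trans rr0 _; rewrite ltr_pdivrMr // ltr_pMr // ltr1n.
  by rewrite (le_lt_trans h1 h) (le_lt_trans h2 h).
have supp s x : 0 <= s <= 1 -> ball p r0 x ->
    g (a x + s * (c x - a x), b x + s * (d x - b x)) != 0 -> csquare p rho x.
  move=> /andP[s0 s1] xW /gball /ball_pairP /= [u v].
  have [_ ea eb] := Hr0 x xW.
  have xE : `|x - p| = Num.max `|x.1 - p.1| `|x.2 - p.2| by [].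
  set n := `|x - p| in xE ea eb.
  have cE : c x - a x = - (a x - a p - linear2 a0 a1 (x - p)) by rewrite /c /affine /linear2 /=;
    ring.
  have dE : d x - b x = - (b x - b p - linear2 b0 b1 (x - p)) by rewrite /d /affine /linear2 /=;
    ring.
  (* At time [s] the map differs from the affine approximation by [(1 - s)] times the error, so the
     linear part is bounded uniformly in [s]. *)
  have bnd (f fp l er : R) : `|er| <= e * n -> er = f - fp - l -> `|f + s * (- er) - fp| < r ->
      `|l| <= r + e * n.
    move=> h1 h2 h3; have -> : l = (f + s * (- er) - fp) + (- (1 - s) * er) by rewrite h2; ring.
    apply: le_trans (ler_normD _ _) _; apply: lerD; first exact: ltW.
    rewrite normrM normrN (ger0_norm (x := 1 - s)) ?subr_ge0 //; apply: (le_trans _ h1).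
    by rewrite ler_piMl // gerBl.
  rewrite cE in u; rewrite dE in v; rewrite -Ep1 in u; rewrite -Ep2 in v.
  have lu := bnd _ _ _ _ ea erefl u; have lv := bnd _ _ _ _ eb erefl v.
  have [hx hy] : `|x.1 - p.1| <= 2 * S * (r + e * n) / D /\ `|x.2 - p.2| <= 2 * S * (r + e * n) / D.
    by apply: (det_bound D0 (lexx D) Sa0 Sa1 Sb0 Sb1 lu lv); rewrite /linear2 /=; ring.
  have nb : n <= 2 * S * (r + e * n) / D by rewrite xE ge_max hx hy.
  have nrho : n <= rho.
    move: nb; rewrite /rho !ler_pdivlMr //.
    have -> : 2 * S * (r + e * n) = 2 * S * r + n * D / 2.
      by rewrite /e; field; rewrite gt_eqF.
    by move: D0; clear; lra.
  by split; apply: le_trans nrho; rewrite xE le_max lexx ?orbT.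
have aW : smooth_on (ball p r0) a by apply: smooth_on_sub aU => x /Hr0 [].
have bW : smooth_on (ball p r0) b by apply: smooth_on_sub bU => x /Hr0 [].
(* A point of [U] that is mapped into the small ball is the image under [sigma] of a point of that
   ball, hence close to [p]: no other part of [U] contributes. *)
have L : \int[mu2]_x pullback g x = \int[mu2]_(x in csquare p rho) (g (a x, b x) * jac a b x).
  apply: pullback_support => [x /CW /Hr0 []//|x Ux gx].
  have [_ xW] := Hr1 _ (le_ball rr1 (gball _ gx)); rewrite sigmaK // in xW.
  by apply: (supp 0 x _ xW); rewrite ?lexx ?ler01 // !mul0r !addr0.
have Rr : \int[mu2]_(x in csquare p rho) (g (c x, d x) * jac c d x) = \int[mu2]_x g x.
  transitivity (\int[mu2]_(x in csquare p rho) (g (c x, d x) * (a0 * b1 - a1 * b0))).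
    by apply: eq_Rintegral => x _; exact: (f_equal2 *%R erefl (jac_affine _ _ _ _ _ _ x)).
  have gM x : ~ square (`|y0.1| + `|y0.2| + r) x -> g x = 0.
    move=> xM; apply: gr => /ball_pairP [h1 h2]; apply: xM; apply/squareP.
    by have := (normr_ge0 y0.1, normr_ge0 y0.2, lerB_dist x.1 y0.1, lerB_dist x.2 y0.2);
      move: h1 h2; clear; move=> h1 h2 [[[? ?] ?] ?]; split; lra.
  have A := @affine_change_of_variables R g _ gS gM _ _ _ _ _ _ D0.
  refine (etrans _ (A _ _)); apply: integral_support => x;
    rewrite mulf_eq0 negb_or => /andP[/gball + _].
  move=> /ball_pairP /= [u v].
  have lu : `|linear2 a0 a1 (x - p)| <= r.
    apply: ltW; move: u; rewrite -Ep1 (_ : c x - a p = linear2 a0 a1 (x - p)) //.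
    by rewrite /c /affine /linear2 /=; ring.
  have lv : `|linear2 b0 b1 (x - p)| <= r.
    apply: ltW; move: v; rewrite -Ep2 (_ : d x - b p = linear2 b0 b1 (x - p)) //.
    by rewrite /d /affine /linear2 /=; ring.
  have [hx hy] : `|x.1 - p.1| <= 2 * S * r / D /\ `|x.2 - p.2| <= 2 * S * r / D.
    by apply: (det_bound D0 (lexx D) Sa0 Sa1 Sb0 Sb1 lu lv); rewrite /linear2 /=; ring.
  have h : 2 * S * r / D <= rho.
    by rewrite ler_pM2r ?invr_gt0 // ler_pM2r // ler_pM2r // ler_nat.
  by split; apply: le_trans h.
have hom := homotopy_integral oW (@compact_csquare R p rho) CW aW bW
  (smooth_affine _ _ _ oW) (smooth_affine _ _ _ oW) gS supp.
exact: (etrans L (etrans hom Rr)).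
Qed.

(** The support of the pullback lies in the image of [C] under [sigma], which is compact because
    [sigma] is continuous. *)
Lemma pullback_supp (g : R * R -> R) (C : set (R * R)) : smooth_on setT g ->
  compact C -> C `<=` V -> (forall y, ~ C y -> g y = 0) ->
  exists r, continuous_supp (pullback g) r.
Proof.
move=> gS cC CV gC; pose C' := sigma @` C.
have cC' : compact C'.
  apply: continuous_compact cC; apply: continuous_in_subspaceT => y.
  by rewrite inE => /CV; exact: sigma_cont.
have C'U : C' `<=` U by move=> _ [y Cy <-]; exact: VU (CV _ Cy).
pose f x := g (a x, b x) * jac a b x.
have fU : smooth_on U f.
  apply: (smooth_onM oU (smooth_on_comp oU openT (fun _ _ => Logic.I) gS aU bU)).
  exact: (smooth_onB oU (smooth_onM oU (smooth_on_pderiv 0 aU) (smooth_on_pderiv 1 bU))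
    (smooth_onM oU (smooth_on_pderiv 0 bU) (smooth_on_pderiv 1 aU))).
have f0 x : U x -> ~ C' x -> f x = 0.
  move=> Ux C'x; rewrite /f gC ?mul0r // => Cx; apply: C'x.
  by exists (a x, b x) => //; rewrite sigmaK.
have [r fr] := smooth_restrict_supp oU cC' C'U fU f0.
exists r; suff -> : pullback g = f \_ C' by [].
apply/funext => x; have [Ux|Ux] := pselect (U x).
  by rewrite (restrict_eq f0 Ux) /pullback patchE ifT // inE.
rewrite restrict_out; first by rewrite /pullback patchE ifF //; apply/negP; rewrite inE.
by move=> /C'U.
Qed.

(** Instead of building a partition of unity, the integrand is peeled: at each centre of a finite
    cover a cut-off splits off a local piece, and the remainder is supported in the part of [C]
    covered by the other centres. *)
Lemma change_of_variables (g : R * R -> R) (C : set (R * R)) : smooth_on V g ->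
  compact C -> C `<=` V -> (forall y, V y -> ~ C y -> g y = 0) ->
  \int[mu2]_x pullback g x = \int[mu2]_x (g \_ V) x.
Proof.
move=> gV cC CV g0.
have pE : pullback g = pullback (g \_ C).
  apply/funext => x; rewrite /pullback [LHS]patchE [RHS]patchE; case: ifPn => //; rewrite inE => Ux.
  by rewrite (restrict_eq g0 (UV Ux)).
have gE : g \_ V = g \_ C.
  apply/funext => y; have [Vy|Vy] := pselect (V y).
    by rewrite (restrict_eq g0 Vy) patchE ifT // inE.
  rewrite [RHS]restrict_out; first by rewrite patchE ifF //; apply/negP; rewrite inE.
  by move=> /CV.
have gS := smooth_restrict oV cC CV gV g0.
have gC y : ~ C y -> (g \_ C) y = 0 := @restrict_out _ C g y.
rewrite pE gE; move: (g \_ C) gS gC => {gV g0 pE gE} f fS fC.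
pose good y r := 0 < r /\ ((forall z, ball y r z -> V z) /\
    forall g, smooth_on setT g -> (forall z, ~ ball y r z -> g z = 0) ->
      \int[mu2]_x pullback g x = \int[mu2]_x g x).
have /boolp.choice [rad radP] : forall y : R * R, exists r : R, V y -> good y r.
  move=> y; have [Vy|Vy] := pselect (V y); last by exists 1.
  by have [r r0 H] := local_change_of_variables Vy; exists r.
have [l lV Cl] : exists2 l : seq (R * R), (forall y, y \in l -> V y) &
    forall y, C y -> exists2 z, z \in l & ball z (rad z / 2) y.
  (* The filter of finite lists of centres, ordered by inclusion. Along it the near-covering form of
     compactness produces a finite subcover. *)
  pose F : set_system (seq (R * R)) := fun A => exists2 l0 : seq (R * R), (forall y, y \in l0 ->
    V y) &
    forall l : seq (R * R), (forall y, y \in l -> V y) -> {subset l0 <= l} -> A l.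
  have FF : Filter F.
    split=> [|A B [l1 l1V A1] [l2 l2V B2]|A B AB [l0 l0V A0]].
    - by exists [::].
    - exists (l1 ++ l2) => [y|l lV sub]; first by rewrite mem_cat => /orP[/l1V|/l2V].
      by split; [apply: A1|apply: B2] => // y yl; apply: sub; rewrite mem_cat yl ?orbT.
    - by exists l0 => // l lV sub; apply: AB; exact: A0.
  pose P (l : seq (R * R)) (y : R * R) := exists2 z, z \in l & ball z (rad z / 2) y.
  have near_cover x : C x -> \forall x' \near x & l \near F, P l x'.
    move=> /CV Vx; have [rx _] := radP x Vx.
    exists (ball x (rad x / 2), [set l : seq (R * R) | x \in l]) => /=.
      split; first by apply: nbhsx_ballx; rewrite divr_gt0.
      exists [:: x] => [y|l lV]; first by rewrite inE => /eqP ->.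
      by apply; rewrite mem_head.
    by move=> [y l] [/= yx xl]; exists x.
  have [l lV H] := (iffLR (compact_near_coveringP C) cC) _ F P FF near_cover.
  by exists l => // y Cy; exact: (H l lV (fun _ h => h)).
(* Both the compact set and the function change when a centre is peeled off. *)
elim: l C f cC CV fS fC lV Cl => [|z l IH] C f cC CV fS fC lV Cl.
  have -> : f = cst 0 by apply/funext => y; apply: fC => /Cl [].
  congr (Rintegral _ _ _); apply/funext => x; rewrite /pullback patchE.
  by case: ifP; rewrite //= mul0r.
have [rz [zV local]] := radP z (lV z (mem_head _ _)).
have r2 : 0 < rad z / 2 by rewrite divr_gt0.
(* Equal to 1 on the half ball that belongs to the cover, and 0 off the full ball, where the local
   formula applies. *)
pose chi := plateau z (rad z / 2).
have chiS : smooth_on setT chi by exact: smooth_plateau openT.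
have f1S : smooth_on setT (fun y => f y * chi y) := smooth_onM openT fS chiS.
have f2S : smooth_on setT (fun y => f y * (1 - chi y)).
  exact: (smooth_onM openT fS (smooth_onB openT (smooth_on_cst 1 openT) chiS)).
have f1C y : ~ C y -> f y * chi y = 0 by move=> /fC ->; rewrite mul0r.
have f1B y : ~ ball z (rad z) y -> f y * chi y = 0.
  move=> zy; rewrite [chi y]plateau_eq0 ?mulr0 //.
  by rewrite mulrC divfK.
pose C2 := C `&` ~` ball z (rad z / 2).
have cC2 : compact C2.
  apply: compact_closedI => //; apply: open_closedC; exact: ball_open.
have f2C y : ~ C2 y -> f y * (1 - chi y) = 0.
  move=> C2y; have [Cy|Cy] := pselect (C y); last by rewrite fC // mul0r.
  have zy : ball z (rad z / 2) y by apply: contrapT => zy; apply: C2y.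
  rewrite [chi y]plateau_eq1 ?subrr ?mulr0 //.
  by move: zy => /ball_pairP [/ltW ? /ltW ?].
have C2V : C2 `<=` V by move=> y [/CV].
have lV2 y : y \in l -> V y by move=> yl; apply: lV; rewrite inE yl orbT.
have Cl2 y : C2 y -> exists2 z', z' \in l & ball z' (rad z' / 2) y.
  move=> [/Cl [z' + yz'] zy]; rewrite inE => /orP[/eqP E|z'l]; last by exists z'.
  by case: zy; rewrite -E.
have I2 := IH C2 _ cC2 C2V f2S f2C lV2 Cl2.
have I1 := local _ f1S f1B.
have int (h : R * R -> R) : (exists r, continuous_supp h r) ->
    mu2.-integrable [set: T2] (EFin \o h).
  by move=> [r hr]; exact: continuous_supp_integrable hr.
have supp (h : R * R -> R) : smooth_on setT h -> (forall y, ~ C y -> h y = 0) ->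
    exists r, continuous_supp h r.
  move=> hS hC; have [r r0 Cr] := compact_in_square cC; exists r; split=> [y|y yr].
    exact: (smooth_on_continuous hS Logic.I).
  by apply: hC => /Cr.
have f2C' y : ~ C y -> f y * (1 - chi y) = 0 by move=> /fC ->; rewrite mul0r.
have e1 := RintegralD measurableT (int _ (pullback_supp f1S cC CV f1C)) (int _ (pullback_supp f2S
  cC CV f2C')).
have e2 := RintegralD measurableT (int _ (supp _ f1S f1C)) (int _ (supp _ f2S f2C')).
have E1 : pullback f = (fun x => pullback (fun y => f y * chi y) x + pullback (fun y => f y * (1
  - chi y)) x).
  apply/funext => x; rewrite /pullback !patchE; case: ifP => _; last by rewrite addr0.
  by ring.
have E2 : f = (fun x => f x * chi x + f x * (1 - chi x)) by apply/funext => x; ring.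
rewrite E1; refine (etrans e1 (etrans (f_equal2 +%R I1 I2) (etrans (esym e2) _))).
exact: (f_equal (fun h : R * R -> R => Rintegral mu2 setT h) (esym E2)).
Qed.

End ChangeOfVariables.

(** * Invariance of the energy density under changes of coordinates *)

Section Components.
Context {R : realType}.

Lemma is_derive_components (f : R * R -> R * R) x v (df : R * R) : is_derive x v f df ->
  is_derive x v (fun y => (f y).1) df.1 /\ is_derive x v (fun y => (f y).2) df.2.
Proof.
move=> [d E].
have c : h^-1 *: ((f \o shift x) (h *: v) - f x) @[h --> (0 : R)^'] --> df by rewrite -E; exact: d.
have c1 : h^-1 *: (((fun y => (f y).1) \o shift x) (h *: v) - (f x).1) @[h --> (0 : R)^'] --> df.1.
  exact: (cvg_comp _ _ c (@cvg_fst _ _ (nbhs df.1) (nbhs df.2) _)).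
have c2 : h^-1 *: (((fun y => (f y).2) \o shift x) (h *: v) - (f x).2) @[h --> (0 : R)^'] --> df.2.
  exact: (cvg_comp _ _ c (@cvg_snd _ _ (nbhs df.1) (nbhs df.2) _)).
by split; apply: DeriveDef; [exact: cvgP c1|exact: cvg_lim c1|exact: cvgP c2|exact: cvg_lim c2].
Qed.

(** The transition maps take values in pairs, whereas the closure properties and the chain rule are
    stated for scalar functions. *)
Lemma smooth_on_components U (f : R * R -> R * R) : open U -> smooth_on U f ->
  smooth_on U (fun y => (f y).1) /\ smooth_on U (fun y => (f y).2).
Proof.
move=> oU fU.
have E s : forall x, U x -> (pderivs s f x).1 = pderivs s (fun y => (f y).1) x /\
    (pderivs s f x).2 = pderivs s (fun y => (f y).2) x.
  elim: s => [//|i s IH] x Ux /=.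
  have d : is_derive x (basis2 i) (pderivs s f) (pderiv i (pderivs s f) x).
    by apply: derivableP; have [_] := fU s x Ux.
  have [[_ e1] [_ e2]] := is_derive_components d.
  by split; [refine (etrans (esym e1) _)|refine (etrans (esym e2) _)];
    apply: (eq_on_derive _ oU Ux) => y /IH [].
split=> s x Ux; have [c d] := fU s x Ux; split.
- apply: (@eq_on_continuous _ _ U (fun y => (pderivs s f y).1) _ _ oU Ux);
  first by move=> y /(E s) [].
  by apply: (continuous_comp c); exact: cvg_fst.
- move=> i; apply: (@eq_on_derivable _ _ U (fun y => (pderivs s f y).1) _ _ _ oU Ux);
  first by move=> y /(E s) [].
  by have [[]] := is_derive_components (derivableP (d i)).
- apply: (@eq_on_continuous _ _ U (fun y => (pderivs s f y).2) _ _ oU Ux);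
  first by move=> y /(E s) [].
  by apply: (continuous_comp c); exact: cvg_snd.
- move=> i; apply: (@eq_on_derivable _ _ U (fun y => (pderivs s f y).2) _ _ _ oU Ux);
  first by move=> y /(E s) [].
  by have [_ []] := is_derive_components (derivableP (d i)).
Qed.

Lemma det_mx2 (A : 'M[R]_2) : \det A = A 0 0 * A 1 1 - A 0 1 * A 1 0.
Proof.
have e0 : lift (0 : 'I_2) (0 : 'I_1) = 1 by apply: val_inj.
have e1 : lift (1 : 'I_2) (0 : 'I_1) = 0 by apply: val_inj.
rewrite (expand_det_row _ 0) sum2E /cofactor !det_mx11 !mxE e0 e1.
by rewrite expr0 expr1 mul1r mulN1r mulrN.
Qed.

Lemma jacobianE U (f : R * R -> R * R) x : smooth_on U f -> U x ->
  Defs.jacobian f x = jac (fun y => (f y).1) (fun y => (f y).2) x.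
Proof.
move=> fU Ux; rewrite /Defs.jacobian det_mx2 !mxE /coord2 /jac /=.
have e i : (pderiv i f x).1 = pderiv i (fun y => (f y).1) x /\
    (pderiv i f x).2 = pderiv i (fun y => (f y).2) x.
  by have [[_ e1] [_ e2]] := is_derive_components (smooth_on_is_derive i fU Ux).
exact: (f_equal2 (fun u v => u - v) (f_equal2 *%R (e 0).1 (e 1).2) (f_equal2 *%R (e 0).2 (e 1).1)).
Qed.

End Components.

Section JetReparametrization.
Context {R : realType} {m : nat}.
Variables (p : 'I_2 -> 'rV[R]_m) (q : 'I_2 -> 'I_2 -> 'rV[R]_m).
Variables (t : 'I_2 -> 'I_2 -> R) (s : 'I_2 -> 'I_2 -> 'I_2 -> R).
Let J := t 0 0 * t 1 1 - t 0 1 * t 1 0.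
Let p' i := \sum_(a < 2) t i a *: p a.
(** [p'] and [q'] form the 2-jet of a composite by the chain rule, with [t] and [s] the first and
    second derivatives of the change of coordinates. The contribution of [s] is tangent. *)
Let q' i j := \sum_(b < 2) \sum_(a < 2) (t i b * t j a) *: q b a + \sum_(a < 2) s i j a *: p a.
Hypotheses (D0 : gram_det p != 0) (J0 : J != 0).

Lemma gram_det_reparam : gram_det p' = gram_det p * J ^+ 2.
Proof.
rewrite /gram_det /p' !sum2E !dotE2 (dotC (p 1) (p 0)) /J.
by move: (dot (p 0) (p 0)) (dot (p 0) (p 1)) (dot (p 1) (p 1)) => *; ring.
Qed.

Lemma gram_det_reparam_neq0 : gram_det p' != 0.
Proof. by rewrite gram_det_reparam mulf_neq0 // expf_neq0. Qed.

Lemma jet_second_normal (pp : 'I_2 -> 'rV[R]_m) qq i j : gram_det pp != 0 ->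
  jet_second pp qq i j = frame_normal pp (qq i j).
Proof.
move=> h; rewrite (frame_normalE h) /jet_second; congr (_ - _).
rewrite exchange_big /=; apply: eq_bigr => k _; rewrite -scaler_suml; congr (_ *: _).
by apply: eq_bigr => l _; rewrite (gram_invC h).
Qed.

(** Since [J] is not zero, [p] and [p'] span the same plane. *)
Lemma frame_normal_reparam v : frame_normal p' v = frame_normal p v.
Proof.
have D' := gram_det_reparam_neq0.
have N' (w : 'rV[R]_m) : (forall i, dot w (p i) = 0) -> frame_normal p' w = w.
  move=> w0; apply: (frame_normal_id D') => i.
  by rewrite /p' sum2E !dotE2 !w0 !mulr0 addr0.
have inv (a b c d : R) : a * d - b * c != 0 ->
    [/\ d / (a * d - b * c) * a + - b / (a * d - b * c) * c = 1,
        d / (a * d - b * c) * b + - b / (a * d - b * c) * d = 0,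
        - c / (a * d - b * c) * a + a / (a * d - b * c) * c = 0 &
        - c / (a * d - b * c) * b + a / (a * d - b * c) * d = 1].
  by move=> h; split; field.
have [i00 i01 i10 i11] := inv _ _ _ _ J0.
have P0 : p 0 = (t 1 1 / J) *: p' 0 + (- t 0 1 / J) *: p' 1.
  rewrite /p' !sum2E !scalerDr !scalerA addrACA -!scalerDl i00 i01.
  by rewrite scale1r scale0r addr0.
have P1 : p 1 = (- t 1 0 / J) *: p' 0 + (t 0 0 / J) *: p' 1.
  rewrite /p' !sum2E !scalerDr !scalerA addrACA -!scalerDl i10 i11.
  by rewrite scale1r scale0r add0r.
have T0 i : frame_normal p' (p i) = 0.
  by case: (I2P i) => ->; [rewrite P0|rewrite P1];
    rewrite (frame_normalD p') !(frame_normalZ p') !(frame_normal_frame D') !scaler0 addr0.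
have E : v = frame_normal p v + \sum_(i < 2) \sum_(j < 2) (gram_inv p i j * dot v (p i)) *: p j.
  by rewrite (frame_normalE D0) subrK.
rewrite [in LHS]E !sum2E !(frame_normalD p') !(frame_normalZ p') !T0 !scaler0 !addr0.
by apply: N' => i; exact: frame_normal_tangent.
Qed.

(** The projection removes the term in [s], so the second fundamental form transforms as a tensor
    and its trace is invariant. *)
Lemma jet_H_reparam : jet_H p' q' = jet_H p q.
Proof.
have D' := gram_det_reparam_neq0.
have N i j : jet_second p' q' i j = \sum_(b < 2) \sum_(a < 2) (t i b * t j a) *: jet_second p q b a.
  rewrite (jet_second_normal _ _ _ D') frame_normal_reparam /q' !sum2E.
  by rewrite !(frame_normalD p) !(frame_normalZ p) !(frame_normal_frame D0) !scaler0 !addr0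
    !(jet_second_normal _ _ _ D0).
congr (_ *: _); rewrite !sum2E !N !sum2E.
move: (jet_second p q) => N0.
have [c00 c01 c10 c11] := gram_invE D0; have [d00 d01 d10 d11] := gram_invE D'.
rewrite c00 c01 c10 c11 d00 d01 d10 d11 gram_det_reparam.
have e i j : dot (p' i) (p' j) = t i 0 * t j 0 * dot (p 0) (p 0)
   + (t i 0 * t j 1 + t i 1 * t j 0) * dot (p 0) (p 1) + t i 1 * t j 1 * dot (p 1) (p 1).
  by rewrite /p' !sum2E !dotE2 (dotC (p 1) (p 0)); ring.
rewrite !e; move: D0 J0; rewrite /J.
move: (dot (p 0) (p 0)) (dot (p 0) (p 1)) (dot (p 1) (p 1)) (gram_det p) => E F G D D0' J0'.
apply/rowP => k; rewrite !mxE.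
move: (N0 0 0 0 k) (N0 0 1 0 k) (N0 1 0 0 k) (N0 1 1 0 k) => n00 n01 n10 n11.
move: (t 0 0) (t 0 1) (t 1 0) (t 1 1) J0' => t00 t01 t10 t11 J0'.
by field; rewrite D0'.
Qed.

Lemma jet_energy_reparam : 0 <= gram_det p -> jet_energy p' q' = jet_energy p q * `|J|.
Proof.
by move=> D; rewrite /jet_energy jet_H_reparam gram_det_reparam sqrtrM // sqrtr_sqr mulrA.
Qed.

End JetReparametrization.

Section DensityReparametrization.
Context {R : realType} {m : nat}.
Variables (U V : set (R * R)) (a b : R * R -> R).
Hypotheses (oU : open U) (oV : open V).
Hypotheses (aU : smooth_on U a) (bU : smooth_on U b).
Hypothesis UV : forall x, U x -> V (a x, b x).
Hypothesis jac_gt0 : forall x, U x -> 0 < jac a b x.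
Implicit Types F G : R * R -> 'rV[R]_m.

Let t x i k : R := if k == 0 :> 'I_2 then pderiv i a x else pderiv i b x.
Let s x i j k : R := if k == 0 :> 'I_2 then pderiv i (pderiv j a) x else pderiv i (pderiv j b) x.

Lemma is_derive_reparam F x i : smooth_on V F -> U x ->
  is_derive x (basis2 i) (fun y => F (a y, b y))
    (pderiv i a x *: pderiv 0 F (a x, b x) + pderiv i b x *: pderiv 1 F (a x, b x)).
Proof.
have mx_comb (u v : R) (A B : 'rV[R]_m) k l : (u *: A + v *: B) k l = u * A k l + v * B k l by
  rewrite !mxE.
move=> FV Ux; have FV' := (iffLR (smooth_on_mxP F oV)) FV; apply/is_derive_mx => k l;
  rewrite mx_comb.
have e j : pderiv j F (a x, b x) k l = pderiv j (fun y => F y k l) (a x, b x).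
  exact: pderiv_mx (smooth_on_derivable (i := j) FV (UV Ux)).
rewrite (e 0) (e 1); exact: (is_derive_comp2 (smooth_on_differentiable oU aU Ux)
  (smooth_on_differentiable oU bU Ux) (smooth_on_differentiable oV (FV' k l) (UV Ux))
  (smooth_on_is_derive i aU Ux) (smooth_on_is_derive i bU Ux)).
Qed.

Lemma pderiv_reparam F G x i : smooth_on V F -> (forall y, U y -> G y = F (a y, b y)) -> U x ->
  pderiv i G x = pderiv i a x *: pderiv 0 F (a x, b x) + pderiv i b x *: pderiv 1 F (a x, b x).
Proof.
move=> FV GF Ux; have [_ E] := is_derive_reparam i FV Ux.
exact: (etrans (eq_on_derive _ oU Ux GF) E).
Qed.

Lemma jet1_reparam F G x i : smooth_on V F -> (forall y, U y -> G y = F (a y, b y)) -> U x ->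
  jet1 G x i = \sum_(k < 2) t x i k *: jet1 F (a x, b x) k.
Proof. by move=> FV GF Ux; rewrite sum2E /t /=; exact: (pderiv_reparam i FV GF Ux). Qed.

Lemma pderiv2_reparam F G x i j : smooth_on V F -> (forall y, U y -> G y = F (a y, b y)) -> U x ->
  pderiv i (pderiv j G) x =
  (pderiv i (pderiv j a) x *: pderiv 0 F (a x, b x) + pderiv j a x *:
    (pderiv i a x *: pderiv 0 (pderiv 0 F) (a x, b x) + pderiv i b x *: pderiv 1 (pderiv 0 F) (a
      x, b x)))
  + (pderiv i (pderiv j b) x *: pderiv 1 F (a x, b x) + pderiv j b x *:
    (pderiv i a x *: pderiv 0 (pderiv 1 F) (a x, b x) + pderiv i b x *: pderiv 1 (pderiv 1 F) (a
      x, b x))).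
Proof.
move=> FV GF Ux.
have E1 y (Uy : U y) := pderiv_reparam j FV GF Uy.
have [_ E] := is_derive_add
  (is_derive_scale (smooth_on_is_derive i (smooth_on_pderiv j aU) Ux)
     (is_derive_reparam i (smooth_on_pderiv 0 FV) Ux))
  (is_derive_scale (smooth_on_is_derive i (smooth_on_pderiv j bU) Ux)
     (is_derive_reparam i (smooth_on_pderiv 1 FV) Ux)).
exact: (etrans (eq_on_derive _ oU Ux E1) E).
Qed.

Lemma jet2_reparam F G x i j : smooth_on V F -> (forall y, U y -> G y = F (a y, b y)) -> U x ->
  jet2 G x i j = \sum_(l < 2) \sum_(k < 2) (t x i l * t x j k) *: jet2 F (a x, b x) l k
    + \sum_(k < 2) s x i j k *: jet1 F (a x, b x) k.
Proof.
move=> FV GF Ux; refine (etrans (pderiv2_reparam i j FV GF Ux) _).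
rewrite -[pderiv 0 F (a x, b x)]/(jet1 F (a x, b x) 0) -[pderiv 1 F (a x, b x)]/(jet1 F (a x, b
  x) 1).
rewrite -[pderiv 0 (pderiv 0 F) (a x, b x)]/(jet2 F (a x, b x) 0 0) -[pderiv 0 (pderiv 1 F) (a x,
  b x)]/(jet2 F (a x, b x) 0 1).
rewrite -[pderiv 1 (pderiv 0 F) (a x, b x)]/(jet2 F (a x, b x) 1 0) -[pderiv 1 (pderiv 1 F) (a x,
  b x)]/(jet2 F (a x, b x) 1 1).
move: (jet1 F (a x, b x)) (jet2 F (a x, b x)) => p q; rewrite /t /s.
move: (pderiv i (pderiv j a) x) (pderiv i (pderiv j b) x) => ? ?.
move: (pderiv i a x) (pderiv i b x) (pderiv j a x) (pderiv j b x) => *.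
by rewrite !sum2E /=; apply/rowP => k; rewrite !mxE; ring.
Qed.

Lemma jac_reparam x : jac a b x = t x 0 0 * t x 1 1 - t x 0 1 * t x 1 0.
Proof. by []. Qed.

Lemma gram_det_jet_reparam F G x : smooth_on V F -> (forall y, U y -> G y = F (a y, b y)) -> U x ->
  gram_det (jet1 G x) = gram_det (jet1 F (a x, b x)) * jac a b x ^+ 2.
Proof.
move=> FV GF Ux; rewrite -(gram_det_reparam _ (t x)); congr gram_det; apply/funext => i.
exact: jet1_reparam.
Qed.

Lemma energy_density_reparam F G x : smooth_on V F -> smooth_on U G ->
  (forall y, U y -> G y = F (a y, b y)) -> U x ->
  0 < gram_det (jet1 F (a x, b x)) ->
  energy_density G x = energy_density F (a x, b x) * jac a b x.
Proof.
move=> FV GU GF Ux D0; have J0 := jac_gt0 Ux.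
have DF := lt0r_neq0 D0.
have DG : gram_det (jet1 G x) != 0.
  by rewrite (gram_det_jet_reparam FV GF Ux) mulf_neq0 // expf_neq0 // gt_eqF.
rewrite (energy_density_jet oU GU Ux DG) (energy_density_jet oV FV (UV Ux) DF).
have -> : jet1 G x = fun i => \sum_(k < 2) t x i k *: jet1 F (a x, b x) k.
  by apply/funext => i; exact: jet1_reparam.
have -> : jet2 G x = fun i j => \sum_(l < 2) \sum_(k < 2) (t x i l * t x j k) *: jet2 F (a x, b
  x) l k
    + \sum_(k < 2) s x i j k *: jet1 F (a x, b x) k.
  by apply/funext => i; apply/funext => j; exact: jet2_reparam.
rewrite (jet_energy_reparam _ _ DF) ?(ltW D0) //.
  by rewrite -jac_reparam gtr0_norm.
by rewrite -jac_reparam gt_eqF.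
Qed.

(** [energy_density_reparam] holds for the perturbed maps as long as their Gram determinant is
    positive, that is, for small parameters. Its derivative at 0 is the claim. *)
Lemma energy_variation_reparam F F' G G' x : smooth_on V F -> smooth_on V F' ->
  smooth_on U G -> smooth_on U G' ->
  (forall y, U y -> G y = F (a y, b y)) -> (forall y, U y -> G' y = F' (a y, b y)) -> U x ->
  0 < gram_det (jet1 F (a x, b x)) ->
  energy_variation G G' 0 x = energy_variation F F' 0 (a x, b x) * jac a b x.
Proof.
move=> FV FV' GU GU' GF GF' Ux D0; have J0 := jac_gt0 Ux.
have p0 (H : R * R -> 'rV[R]_m) H' : perturb H H' 0 = H.
  by apply/funext => y; rewrite /perturb scale0r addr0.
have D0' : 0 < gram_det (jet1 (perturb F F' 0) (a x, b x)) by rewrite p0.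
have D0'' : 0 < gram_det (jet1 (perturb G G' 0) x).
  rewrite p0 (gram_det_jet_reparam FV GF Ux).
  exact: (mulr_gt0 D0 (exprn_gt0 2 J0)).
have dG := is_derive_energy_density oU GU GU' Ux D0''.
have dF := is_derive_mul (is_derive_energy_density oV FV FV' (UV Ux) D0')
  (is_derive_cst (jac a b x) (0 : R) (1 : R)).
have Dn := perturb_det_near FV FV' (UV Ux) D0'.
have E : \forall r \near (0 : R), energy_density (perturb F F' r) (a x, b x) * jac a b x =
    energy_density (perturb G G' r) x.
  apply: filterS Dn => r Dr.
  have GF2 y : U y -> perturb G G' r y = perturb F F' r (a y, b y).
    by move=> Uy; exact: (f_equal2 (fun u v => u + r *: v) (GF y Uy) (GF' y Uy)).
  exact: (esym (energy_density_reparam (smooth_perturb oV r FV FV') (smooth_perturb oU r GU GU')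
    GF2 Ux Dr)).
have [_ e1] := dG; have [_ e2] := dF.
have e3 (u v : R) : u + v * 0 = u by rewrite mulr0 addr0.
exact: (etrans (esym e1) (etrans (esym (near_eq_derive _ E)) (etrans e2 (e3 _ _)))).
Qed.

End DensityReparametrization.

(** * Linearity and locality of the variation *)

Section JetLinearity.
Context {R : realType} {m : nat}.
Implicit Types (p dp : 'I_2 -> 'rV[R]_m) (q dq : 'I_2 -> 'I_2 -> 'rV[R]_m).

Lemma jet_variation0 p q dp dq : (forall i, dp i = 0) -> (forall i j, dq i j = 0) ->
  jet_variation p q dp dq = 0.
Proof.
have d0 (u : 'rV[R]_m) : dot u 0 = 0 by rewrite dotC dot0l.
move=> p0 q0; rewrite /jet_variation !sum2E !p0 !q0 !scaler0 !d0 !dot0l !(addr0, subr0, mulr0,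
  oppr0, d0, mul0r).
by [].
Qed.

Lemma jet_variationD p q dp dq dp' dq' :
  jet_variation p q (fun i => dp i + dp' i) (fun i j => dq i j + dq' i j) =
  jet_variation p q dp dq + jet_variation p q dp' dq'.
Proof.
rewrite /jet_variation -mulrDr; congr (_ * _).
rewrite addrACA [X in _ = X + _]addrACA; congr (_ + _ + _).
- rewrite -big_split; apply: eq_bigr => i _; rewrite -big_split; apply: eq_bigr => j _ /=.
  rewrite -mulrDr -dotDr; congr (_ * dot _ _).
  rewrite addrACA -opprD; congr (_ - _).
  by rewrite -big_split; apply: eq_bigr => k _ /=; rewrite scalerDr.
- rewrite -big_split; apply: eq_bigr => i _; rewrite -big_split; apply: eq_bigr => j _ /=.
  rewrite -mulrDl -opprD; congr (- _ * _).
  rewrite -big_split; apply: eq_bigr => k _; rewrite -big_split; apply: eq_bigr => l _ /=.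
  by rewrite dotDl dotDr; ring.
- rewrite -mulrDr; congr (_ * _).
  rewrite -big_split; apply: eq_bigr => i _; rewrite -big_split; apply: eq_bigr => j _ /=.
  by rewrite dotDr mulrDr.
Qed.

Lemma energy_variation_sum (U : set (R * R)) (I : Type) (r : seq I) (F : R * R -> 'rV[R]_m)
    (W : I -> R * R -> 'rV[R]_m) x : open U -> (forall l, smooth_on U (W l)) -> U x ->
  energy_variation F (fun y => \sum_(l <- r) W l y) 0 x = \sum_(l <- r) energy_variation F (W l)
    0 x.
Proof.
move=> oU WU Ux.
have p0 V : perturb F V 0 = F by apply/funext => y; rewrite /perturb scale0r addr0.
have E V : energy_variation F V 0 x = jet_variation (jet1 F x) (jet2 F x) (jet1 V x) (jet2 V x).
  by rewrite /energy_variation p0.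
rewrite E; under [RHS]eq_bigr do rewrite E.
elim: r => [|l r IH].
  rewrite big_nil; apply: jet_variation0 => [i|i j].
    have E0 y : U y -> \sum_(l <- [::]) W l y = 0 by move=> _; rewrite big_nil.
    exact: (etrans (eq_on_derive (basis2 i) oU Ux E0) (derive_cst _ _ _)).
  have E0 y : U y -> pderiv j (fun y => \sum_(l <- [::]) W l y) y = 0.
    move=> Uy; have E0 z : U z -> \sum_(l <- [::]) W l z = 0 by move=> _; rewrite big_nil.
    exact: (etrans (eq_on_derive (basis2 j) oU Uy E0) (derive_cst _ _ _)).
  exact: (etrans (eq_on_derive (basis2 i) oU Ux E0) (derive_cst _ _ _)).
rewrite big_cons -IH -jet_variationD.
have rU : smooth_on U (fun y => \sum_(l <- r) W l y) := smooth_on_mx_sum r oU WU.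
have e1 i y : U y -> pderiv i (fun y => \sum_(l <- l :: r) W l y) y =
    pderiv i (W l) y + pderiv i (fun y => \sum_(l <- r) W l y) y.
  move=> Uy.
  have E0 z : U z -> \sum_(l <- l :: r) W l z = W l z + \sum_(l <- r) W l z.
    by move=> _; rewrite big_cons.
  have [_ e] := is_derive_add (smooth_on_is_derive i (WU l) Uy) (smooth_on_is_derive i rU Uy).
  exact: (etrans (eq_on_derive (basis2 i) oU Uy E0) e).
have e2 i j : pderiv i (pderiv j (fun y => \sum_(l <- l :: r) W l y)) x =
    pderiv i (pderiv j (W l)) x + pderiv i (pderiv j (fun y => \sum_(l <- r) W l y)) x.
  have [_ e] := is_derive_add (smooth_on_is_derive i (smooth_on_pderiv j (WU l)) Ux)
    (smooth_on_is_derive i (smooth_on_pderiv j rU) Ux).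
  exact: (etrans (eq_on_derive (basis2 i) oU Ux (e1 j)) e).
have e1x : jet1 (fun y => \sum_(l <- l :: r) W l y) x = fun i => jet1 (W l) x i + jet1 (fun y =>
  \sum_(l <- r) W l y) x i.
  by apply/funext => i; exact: (e1 i x Ux).
have e2x : jet2 (fun y => \sum_(l <- l :: r) W l y) x = fun i j => jet2 (W l) x i j + jet2 (fun y
  => \sum_(l <- r) W l y) x i j.
  by apply/funext => i; apply/funext => j; exact: (e2 i j).
by rewrite e1x e2x.
Qed.

Lemma energy_variation_eq0 (U : set (R * R)) (F W : R * R -> 'rV[R]_m) x :
  open U -> U x -> (forall y, U y -> W y = 0) -> energy_variation F W 0 x = 0.
Proof.
move=> oU Ux W0; apply: jet_variation0 => [i|i j].
  exact: (etrans (eq_on_derive (basis2 i) oU Ux W0) (derive_cst _ _ _)).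
have W1 y (Uy : U y) : pderiv j W y = 0 := etrans (eq_on_derive (basis2 j) oU Uy W0) (derive_cst
  _ _ _).
exact: (etrans (eq_on_derive (basis2 i) oU Ux W1) (derive_cst _ _ _)).
Qed.

End JetLinearity.

(** * Surfaces *)

Section Charts.
Context {R : realType}.
Variable S : oriented_surface R.
Implicit Types (c d : atlas_index S) (M : set S).
Local Notation X c := (chart_cod (atlas c)).
Local Notation "'Dom' c" := (chart_dom (atlas c)) (at level 9).
Local Notation to c := (to_coord (atlas c)).
Local Notation of_ c := (of_coord (atlas c)).

Lemma open_chart_preimage c (O : set S) : open O -> open (X c `&` of_ c @^-1` O).
Proof.
move=> oO; have /continuousP /(_ _ oO) := of_coord_continuous (c := atlas c).
move=> /open_subspaceP [V oV VD]; rewrite setIC -VD.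
by apply: openI => //; exact: chart_cod_open.
Qed.

Lemma compact_to_coord c M : compact M -> M `<=` Dom c -> compact (to c @` M).
Proof.
move=> cM MD; apply: continuous_compact cM.
exact: continuous_subspaceW MD (to_coord_continuous (c := atlas c)).
Qed.

Lemma compact_of_coord c (C : set (R * R)) : compact C -> C `<=` X c -> compact (of_ c @` C).
Proof.
move=> cC CX; apply: continuous_compact cC.
exact: continuous_subspaceW CX (of_coord_continuous (c := atlas c)).
Qed.

Lemma surface_compact_open M : compact M -> open (~` M).
Proof. by move=> cM; apply: closed_openC; exact: compact_closed (points_hausdorff (o := S)) cM. Qed.

Lemma to_coord_image c M x : M `<=` Dom c -> X c x -> M (of_ c x) -> (to c @` M) x.
Proof. by move=> MD Xx Mx; exists (of_ c x) => //; rewrite of_coordK. Qed.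

Lemma to_coord_imageP c M x : M `<=` Dom c -> (to c @` M) x -> X c x /\ M (of_ c x).
Proof.
move=> MD [p Mp <-]; split; first by apply: to_coord_cod; exact: MD.
by rewrite to_coordK //; exact: MD.
Qed.

(** A compact subset of a Hausdorff space is closed, so [W] vanishes near the point together with
    its derivatives. *)
Lemma energy_variation_supp (m : nat) c (F : R * R -> 'rV[R]_m) (W : S -> 'rV[R]_m) M x :
  compact M -> (forall p, ~ M p -> W p = 0) -> X c x -> ~ M (of_ c x) ->
  energy_variation F (in_chart c W) 0 x = 0.
Proof.
move=> cM W0 Xx Mx.
have oO := @open_chart_preimage c _ (surface_compact_open cM).
apply: (energy_variation_eq0 F oO (conj Xx Mx)) => y [_ My]; exact: W0.
Qed.

Section Transition.
Variables c d : atlas_index S.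
Let U := transition_dom (atlas c) (atlas d).
Let tau := transition (atlas c) (atlas d).

Lemma transition_dom_open : open U.
Proof. exact: (@open_chart_preimage c _ (chart_dom_open (atlas d))). Qed.

Lemma transition_cod x : U x -> transition_dom (atlas d) (atlas c) (tau x).
Proof.
move=> [Xx Dx]; split; first exact: to_coord_cod.
by rewrite /= /tau /transition /= to_coordK //; exact: of_coord_dom.
Qed.

Lemma of_coord_transition x : U x -> of_ d (tau x) = of_ c x.
Proof. by move=> [Xx Dx]; rewrite /tau /transition /= to_coordK. Qed.

Lemma transitionK x : U x -> transition (atlas d) (atlas c) (tau x) = x.
Proof.
move=> Ux; have [Xx _] := Ux; have E := of_coord_transition Ux.
by rewrite /transition /= E of_coordK.
Qed.

Lemma in_chart_transition (W : Type) (f : S -> W) x : U x ->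
  in_chart c f x = in_chart d f (tau x).
Proof. by move=> Ux; rewrite /in_chart /= of_coord_transition. Qed.

End Transition.
End Charts.

(** * Smoothness of the variation density and its transfer between charts *)

Section SmoothVariation.
Context {R : realType} {m : nat}.
Variables (U : set (R * R)) (F : R * R -> 'rV[R]_m).
Hypothesis oU : open U.
Hypothesis FU : smooth_on U F.
Hypothesis Fimm : forall y, U y -> row_free (diff_mx F y).

Definition energy_flux (V : R * R -> 'rV[R]_m) (j : 'I_2) z : R := volume_density F z *
  (dot (mean_curvature F z) (grad F V j z) + dot (V z) (stress F j z)).

Lemma smooth_energy_flux V j : smooth_on U V -> smooth_on U (energy_flux V j).
Proof.
move=> VU.
exact: (smooth_onM oU (smooth_volume_density oU FU Fimm) (smooth_onD oU
  (smooth_on_dot oU (smooth_mean_curvature oU FU Fimm) (smooth_grad oU FU Fimm j VU))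
  (smooth_on_dot oU VU (smooth_stress oU FU Fimm j)))).
Qed.

Lemma smooth_div_stress : smooth_on U (divergence F (stress F)).
Proof.
have N j : smooth_on U (nabla_vector F j (stress F) j).
  exact: (smooth_on_mxD oU (smooth_on_pderiv j (smooth_stress oU FU Fimm j))
    (smooth_on_mx_sum _ oU (fun k => smooth_on_scale oU (smooth_christoffel oU FU Fimm j j k)
       (smooth_stress oU FU Fimm k)))).
exact: (smooth_on_mx_sum _ oU N).
Qed.

(** The divergence form of the density displays it as a combination of quantities already known to
    be smooth. *)
Lemma smooth_energy_variation V : smooth_on U V -> smooth_on U (energy_variation F V 0).
Proof.
move=> VU.
have H : smooth_on U (fun y => \sum_(j < 2) pderiv j (energy_flux V j) y
   - volume_density F y * dot (V y) (divergence F (stress F) y)).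
  exact: (smooth_onB oU (smooth_on_sum _ oU (fun j => smooth_on_pderiv j (smooth_energy_flux j VU)))
    (smooth_onM oU (smooth_volume_density oU FU Fimm) (smooth_on_dot oU VU smooth_div_stress))).
apply: (smooth_on_eq oU _ H) => y Uy.
exact: (esym (energy_variation_divergence oU FU VU Fimm Uy)).
Qed.

End SmoothVariation.

Section Transfer.
Context {R : realType} {m : nat}.
Variables (S : oriented_surface R) (Phi : S -> 'rV[R]_m).
Hypothesis hPhi : immersion Phi.
Implicit Types (c d : atlas_index S) (M L : set S).
Local Notation T2 := (measurableTypeR R * measurableTypeR R)%type.
Local Notation mu2 := (@lebesgue2 R).
Local Notation X c := (chart_cod (atlas c)).
Local Notation Dom c := (chart_dom (atlas c)).

Definition chart_variation c (W : S -> 'rV[R]_m) : R * R -> R :=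
  energy_variation (in_chart c Phi) (in_chart c W) 0.

Lemma chart_det_gt0 c x : X c x -> 0 < gram_det (jet1 (in_chart c Phi) x).
Proof. by move=> Xx; exact: (immersion_det_gt0 (hPhi.2 c) Xx). Qed.

Lemma smooth_chart_variation c W : smooth W -> smooth_on (X c) (chart_variation c W).
Proof.
by move=> Ws; exact: (smooth_energy_variation (@chart_cod_open R S (atlas c)) (hPhi.1 c) (hPhi.2
  c) (Ws c)).
Qed.

(** Off [M] the variation vanishes because [W] does; on [M] but off [N] the weight vanishes. *)
Lemma chart_integral_compact c (W : S -> 'rV[R]_m) (rho : S -> R) M N :
  compact M -> (forall p, ~ M p -> W p = 0) -> N `<=` Dom c ->
  (forall p, Dom c p -> M p -> ~ N p -> rho p = 0) ->
  \int[mu2]_x (((fun x => in_chart c rho x * chart_variation c W x) \_ (X c)) x) =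
  \int[mu2]_(x in to_coord (atlas c) @` N) (in_chart c rho x * chart_variation c W x).
Proof.
move=> cM W0 ND rho0; apply: integral_restrict_open => [x /(to_coord_imageP ND) []//|x Xx Nx].
have [Mx|Mx] := pselect (M (of_coord (atlas c) x)).
  rewrite [in_chart c rho x]rho0 ?mul0r //; first exact: of_coord_dom.
  by move=> Nof; apply: Nx; exact: (to_coord_image ND Xx Nof).
by have e : chart_variation c W x = 0 := energy_variation_supp _ cM W0 Xx Mx; rewrite e mulr0.
Qed.

(** The integrand lives on the intersection of [M] and [L], which lies in both charts. On the
    overlap the weight is merely composed with the transition map, and the density acquires its
    Jacobian. *)
Lemma variation_transfer c d (W : S -> 'rV[R]_m) (rho : S -> R) M L :
  smooth W -> smooth rho -> compact M -> M `<=` Dom d -> (forall p, ~ M p -> W p = 0) ->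
  compact L -> L `<=` Dom c -> (forall p, ~ L p -> rho p = 0) ->
  \int[mu2]_x (((fun x => in_chart c rho x * chart_variation c W x) \_ (X c)) x) =
  \int[mu2]_x (((fun x => in_chart d rho x * chart_variation d W x) \_ (X d)) x).
Proof.
move=> Ws rs cM MD W0 cL LD rho0.
pose U := transition_dom (atlas c) (atlas d); pose V := transition_dom (atlas d) (atlas c).
pose tau := transition (atlas c) (atlas d); pose sigma := transition (atlas d) (atlas c).
pose a x := (tau x).1; pose b x := (tau x).2.
have tE x : (a x, b x) = tau x by rewrite /a /b -surjective_pairing.
have oU : open U := @transition_dom_open R S c d.
have oV : open V := @transition_dom_open R S d c.
have [aU bU] : smooth_on U a /\ smooth_on U b := smooth_on_components oU (@transition_smooth R S
  c d).
have UV x : U x -> V (a x, b x) by rewrite tE; exact: transition_cod.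
have VU y : V y -> U (sigma y) by exact: transition_cod.
have sK x : U x -> sigma (a x, b x) = x by rewrite tE; exact: transitionK.
have Ks y : V y -> (a (sigma y), b (sigma y)) = y by rewrite tE; exact: transitionK.
have sc y : V y -> {for y, continuous sigma} by exact: (smooth_on_continuous (@transition_smooth
  R S d c)).
have J0 x : U x -> 0 < jac a b x.
  by move=> Ux; rewrite -(jacobianE (@transition_smooth R S c d) Ux); exact: transition_oriented.
pose g y := in_chart d rho y * chart_variation d W y.
have VX y : V y -> X d y by case.
have gV : smooth_on V g.
  exact: (smooth_on_sub VX (smooth_onM (@chart_cod_open R S (atlas d)) (rs d)
    (smooth_chart_variation Ws))).
pose C := to_coord (atlas d) @` (M `&` L).
have MLD : M `&` L `<=` Dom d by move=> p [/MD].
have cC : compact C.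
  by apply: compact_to_coord MLD; apply: compact_closedI cM (compact_closed (@points_hausdorff R
    S) cL).
have CV : C `<=` V.
  by move=> y /(to_coord_imageP MLD) [Xy [My Ly]]; split => //; exact: LD.
have ev0 e y : X e y -> ~ M (of_coord (atlas e) y) -> chart_variation e W y = 0.
  by move=> Xy My; exact: (energy_variation_supp _ cM W0 Xy My).
have g0 y : V y -> ~ C y -> g y = 0.
  move=> [Xy Dy] Cy; rewrite /g.
  have [My|My] := pselect (M (of_coord (atlas d) y)); last by rewrite (ev0 d y Xy My) mulr0.
  rewrite [in_chart d rho y]rho0 ?mul0r // => Ly; apply: Cy.
  exact: (to_coord_image MLD Xy (conj My Ly)).
have cov := change_of_variables oU oV aU bU UV VU sK Ks sc J0 gV cC CV g0.
(* In the chart [c], a point off the overlap is outside of the domain of [d], hence outside of [M]: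
   the variation vanishes. *)
have L1 : (fun x => in_chart c rho x * chart_variation c W x) \_ (X c) = pullback U a b g.
  apply/funext => x; rewrite /pullback !patchE.
  have [Ux|Ux] := pselect (U x).
    rewrite ifT; last by rewrite inE; case: Ux.
    rewrite ifT; last by rewrite inE.
    have er : in_chart c rho x = in_chart d rho (tau x) := in_chart_transition rho Ux.
    have ev : chart_variation c W x = chart_variation d W (a x, b x) * jac a b x.
      have GF f y (Uy : U y) : in_chart c f y = in_chart d f (a y, b y) :> 'rV[R]_m.
        by rewrite tE; exact: in_chart_transition.
      have sV (f : S -> 'rV[R]_m) : smooth f -> smooth_on V (in_chart d f).
        by move=> fs; exact: (smooth_on_sub VX (fs d)).
      have sU (f : S -> 'rV[R]_m) : smooth f -> smooth_on U (in_chart c f).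
        by move=> fs; apply: (smooth_on_sub _ (fs c)) => y [].
      exact: (energy_variation_reparam oU oV aU bU UV J0 (sV _ hPhi.1) (sV _ Ws) (sU _ hPhi.1)
        (sU _ Ws)
        (GF Phi) (GF W) Ux (chart_det_gt0 (VX _ (UV x Ux)))).
    by rewrite er ev /g -tE mulrA.
  rewrite [in RHS]ifF; last by apply/negP; rewrite inE.
  case: ifPn => //; rewrite inE => Xx.
  by rewrite (ev0 c x Xx) ?mulr0 // => /MD Dx; apply: Ux.
(* In the chart [d], a point off the overlap is outside of the domain of [c], hence outside of [L]:
   the weight vanishes. *)
have L2 : g \_ V = g \_ (X d).
  apply/funext => y; rewrite !patchE.
  have [Vy|Vy] := pselect (V y).
    by rewrite !ifT // inE //; exact: VX.
  rewrite ifF; last by apply/negP; rewrite inE.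
  case: ifPn => //; rewrite inE => Xy.
  by rewrite /g [in_chart d rho y]rho0 ?mul0r // => /LD Dy; apply: Vy.
by rewrite L1 -L2.
Qed.

End Transfer.

(** * The derivative of the Willmore energy *)

Section PerturbationContinuity.
Context {R : realType} {m : nat} {T : Type} (l : set_system T) {Fl : Filter l}.
(** Parameter and point vary along an arbitrary filter. This covers joint continuity, continuity in
    the point at a fixed parameter, and the product filter of the compactness argument. *)
Variables (U : set (R * R)) (F V : R * R -> 'rV[R]_m) (tau : T -> R) (xi : T -> R * R).
Variables (t : R) (x : R * R).
Hypotheses (oU : open U) (FU : smooth_on U F) (VU : smooth_on U V) (Ux : U x).
Hypotheses (taut : tau z @[z --> l] --> t) (xix : xi z @[z --> l] --> x).

Let Un : \forall z \near l, U (xi z).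
Proof. exact: (xix (open_nbhs_nbhs (conj oU Ux))). Qed.

Let cvg_combination (f g : R * R -> 'rV[R]_m) (h : R -> R * R -> 'rV[R]_m) :
  smooth_on U f -> smooth_on U g -> (forall s y, U y -> h s y = f y + s *: g y) ->
  h (tau z) (xi z) @[z --> l] --> h t x.
Proof.
move=> fU gU E; rewrite (E _ _ Ux).
have c (k : R * R -> 'rV[R]_m) : smooth_on U k -> k (xi z) @[z --> l] --> k x.
  move=> kU; exact: (@continuous_cvg _ _ _ l Fl xi k x (smooth_on_continuous kU Ux) xix).
apply: cvg_trans (cvgD (c _ fU) (cvgZ taut (c _ gU))); apply: near_eq_cvg.
by apply: filterS Un => z Uz; exact: (esym (E _ _ Uz)).
Qed.

Lemma cvg_perturb_jet1 i : jet1 (perturb F V (tau z)) (xi z) i @[z --> l] -->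
  jet1 (perturb F V t) x i.
Proof.
exact: (cvg_combination (h := fun s y => jet1 (perturb F V s) y i)
  (smooth_on_pderiv i FU) (smooth_on_pderiv i VU) (fun s y Uy => jet1_perturb s i FU VU Uy)).
Qed.

Lemma cvg_perturb_jet2 i j : jet2 (perturb F V (tau z)) (xi z) i j @[z --> l] -->
  jet2 (perturb F V t) x i j.
Proof.
exact: (cvg_combination (h := fun s y => jet2 (perturb F V s) y i j)
  (smooth_on_pderiv i (smooth_on_pderiv j FU)) (smooth_on_pderiv i (smooth_on_pderiv j VU))
  (fun s y Uy => jet2_perturb oU s i j FU VU Uy)).
Qed.

Lemma cvg_jet1 i : jet1 V (xi z) i @[z --> l] --> jet1 V x i.
Proof. exact: (@continuous_cvg _ _ _ l Fl xi (pderiv i V) x (smooth_on_continuous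
  (smooth_on_pderiv i VU) Ux) xix). Qed.

Lemma cvg_jet2 i j : jet2 V (xi z) i j @[z --> l] --> jet2 V x i j.
Proof.
exact: (@continuous_cvg _ _ _ l Fl xi (pderiv i (pderiv j V)) x
  (smooth_on_continuous (smooth_on_pderiv i (smooth_on_pderiv j VU)) Ux) xix).
Qed.

Hypothesis D0 : 0 < gram_det (jet1 (perturb F V t) x).

Lemma perturb_det_gt0_near : \forall z \near l, 0 < gram_det (jet1 (perturb F V (tau z)) (xi z)).
Proof.
have c : gram_det (jet1 (perturb F V (tau z)) (xi z)) @[z --> l] -->
  gram_det (jet1 (perturb F V t) x).
  exact: (cvg_gram_det cvg_perturb_jet1).
exact: (cvgr_gt _ c _ D0).
Qed.

Lemma cvg_energy_variation :
  energy_variation F V (tau z) (xi z) @[z --> l] --> energy_variation F V t x.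
Proof. exact: (cvg_jet_variation cvg_perturb_jet1 cvg_perturb_jet2 cvg_jet1 cvg_jet2 (lt0r_neq0
  D0)). Qed.

Lemma cvg_energy_density :
  energy_density (perturb F V (tau z)) (xi z) @[z --> l] --> energy_density (perturb F V t) x.
Proof.
rewrite (energy_density_jet oU (smooth_perturb oU t FU VU) Ux (lt0r_neq0 D0)).
apply: cvg_trans (cvg_jet_energy cvg_perturb_jet1 cvg_perturb_jet2 (lt0r_neq0 D0));
  apply: near_eq_cvg.
apply: filterS2 Un perturb_det_gt0_near => z Uz Dz.
exact: (esym (energy_density_jet oU (smooth_perturb oU (tau z) FU VU) Uz (lt0r_neq0 Dz))).
Qed.

End PerturbationContinuity.

Section EnergyDerivative.
Context {R : realType} {m : nat}.
Variables (S : oriented_surface R) (Phi : S -> 'rV[R]_m).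
Hypothesis hPhi : immersion Phi.
Local Notation T2 := (measurableTypeR R * measurableTypeR R)%type.
Local Notation mu2 := (@lebesgue2 R).
Local Notation X c := (chart_cod (atlas c)).
Local Notation Dom c := (chart_dom (atlas c)).
Variables (V : S -> 'rV[R]_m) (K : set S).
Hypotheses (Vs : smooth V) (cK : compact K) (V0 : forall p, ~ K p -> V p = 0).

Let perturbed (t : R) (p : S) := Phi p + t *: V p.

Lemma is_derive_chart_energy (c : atlas_index S) (rho : S -> R) (L : set S) :
  smooth rho -> compact L -> L `<=` Dom c -> (forall p, ~ L p -> rho p = 0) ->
  is_derive (0 : R) (1 : R) (fun t => \int[mu2]_(x in X c `&` of_coord (atlas c) @^-1` K)
      (in_chart c rho x
       * dot (mean_curvature (in_chart c (perturbed t)) x) (mean_curvature (in_chart c (perturbed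
         t)) x)
       * volume_density (in_chart c (perturbed t)) x))
    (\int[mu2]_x (((fun x => in_chart c rho x * chart_variation Phi c V x) \_ (X c)) x)).
Proof.
move=> rs cL LD rho0.
pose F := in_chart c Phi; pose W := in_chart c V; pose r := in_chart c rho.
(* The domain of integration need not be compact; the support of the weight cuts it down to this
   compact set. *)
pose C := to_coord (atlas c) @` (L `&` K).
have LKD : L `&` K `<=` Dom c by move=> p [/LD].
have cC : compact C.
  by apply: compact_to_coord LKD; apply: compact_closedI cL (compact_closed (@points_hausdorff R
    S) cK).
have CX x : C x -> X c x /\ (L `&` K) (of_coord (atlas c) x) by exact: to_coord_imageP.
have oX := @chart_cod_open R S (atlas c).
have FX : smooth_on (X c) F := hPhi.1 c.
have WX : smooth_on (X c) W := @Vs c.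
have rX : smooth_on (X c) r := rs c.
have r0 x : ~ L (of_coord (atlas c) x) -> r x = 0 by exact: rho0.
pose A t x := r x * energy_density (perturb F W t) x.
pose B t x := r x * energy_variation F W t x.
have E1 t : \int[mu2]_(x in X c `&` of_coord (atlas c) @^-1` K) (r x
       * dot (mean_curvature (in_chart c (perturbed t)) x) (mean_curvature (in_chart c (perturbed
         t)) x)
       * volume_density (in_chart c (perturbed t)) x) = \int[mu2]_(x in C) A t x.
  have e x : r x * dot (mean_curvature (in_chart c (perturbed t)) x) (mean_curvature (in_chart c
    (perturbed t)) x)
       * volume_density (in_chart c (perturbed t)) x = A t x by rewrite -mulrA.
  have e' : (fun x => r x * dot (mean_curvature (in_chart c (perturbed t)) x) (mean_curvature
    (in_chart c (perturbed t)) x)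
       * volume_density (in_chart c (perturbed t)) x) = A t by apply/funext => x; exact: e.
  rewrite e' Rintegral_mkcond [RHS]Rintegral_mkcond.
  apply: (f_equal (fun h : R * R -> R => Rintegral mu2 setT h)); apply/funext => x.
  have [Cx|Cx] := pselect (C x).
    have [Xx [_ Kx]] := CX x Cx.
    exact: (etrans (restrict_in (A t) (conj Xx Kx : (X c `&` of_coord (atlas c) @^-1` K) x))
      (esym (restrict_in (A t) Cx))).
  refine (etrans _ (esym (restrict_out (A t) Cx))).
  have [XKx|XKx] := pselect ((X c `&` of_coord (atlas c) @^-1` K) x);
    last exact: (restrict_out (A t) XKx).
  refine (etrans (restrict_in (A t) XKx) _); have [Xx Kx] := XKx.
  rewrite /A r0 ?mul0r // => Lx; apply: Cx.
  exact: (to_coord_image LKD Xx (conj Lx Kx)).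
have E2 : \int[mu2]_x (((fun x => r x * chart_variation Phi c V x) \_ (X c)) x) = \int[mu2]_(x in
  C) B 0 x.
  refine (@chart_integral_compact _ _ _ Phi c V rho K (L `&` K) cK V0 LKD _) => p _ Kp LKp;
    apply: rho0 => Lp.
  exact: (LKp (conj Lp Kp)).
have D0 x : X c x -> 0 < gram_det (jet1 (perturb F W 0) x).
  have -> : perturb F W 0 = F by apply/funext => y; rewrite /perturb scale0r addr0.
  exact: chart_det_gt0.
(* By compactness the perturbed map remains an immersion at all points of [C] for the same small
   parameters. *)
have Dn : \forall t \near (0 : R), forall x, C x -> 0 < gram_det (jet1 (perturb F W t) x).
  have H x : C x -> \forall x' \near x & t \near (0 : R), 0 < gram_det (jet1 (perturb F W t) x').
    move=> /CX [Xx _].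
    exact: (perturb_det_gt0_near (l := filter_prod (nbhs x) (nbhs (0 : R))) (tau := snd) (xi :=
      fst) oX FX WX Xx cvg_snd cvg_fst (D0 x Xx)).
  exact: ((iffLR (compact_near_coveringP C) cC) _ (nbhs (0 : R)) _ _ H).
have D : is_derive (0 : R) (1 : R) (fun t => \int[mu2]_(x in C) A t x) (\int[mu2]_(x in C) B 0 x).
  apply: (is_derive_integral_compact cC).
  - apply: filterS Dn => t Dt x Cx; have [Xx _] := CX x Cx.
    have := is_derive_mul (is_derive_cst (r x) (t : R) (1 : R)) (is_derive_energy_density oX FX
      WX Xx (Dt x Cx)).
    by rewrite mul0r add0r.
  - apply: filterS Dn => t Dt; apply: continuous_in_subspaceT => x; rewrite inE => Cx.
    have [Xx _] := CX x Cx.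
    exact: (cvgM (smooth_on_continuous rX Xx)
      (cvg_energy_density oX FX WX Xx (cvg_cst t) cvg_id (Dt x Cx))).
  - move=> x /CX [Xx _].
    have c1 : r z.2 @[z --> ((0 : R), x)] --> r x.
      exact: (@continuous_cvg _ _ _ (nbhs ((0 : R), x)) _ (fun z => z.2) r x
        (smooth_on_continuous rX Xx) cvg_snd).
    exact: (cvgM c1 (cvg_energy_variation (l := nbhs ((0 : R), x)) (tau := fst) (xi := snd) oX FX
      WX Xx cvg_fst cvg_snd (D0 x Xx))).
rewrite -[in_chart c rho]/r E2; have E3 := funext E1; rewrite E3.
exact: D.
Qed.

Lemma is_derive_willmore_energy n (c : 'I_n -> atlas_index S) (rho : 'I_n -> S -> R) :
  partition_of_unity K c rho ->
  is_derive (0 : R) (1 : R) (fun t => willmore_energy K c rho (perturbed t))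
    (\sum_(k < n) \int[mu2]_x (((fun x => in_chart (c k) (rho k) x * chart_variation Phi (c k) V
      x) \_ (X (c k))) x)).
Proof.
move=> [rs _ rL _]; apply: is_derive_bigsum => k; have [L [cL LD rho0]] := rL k.
exact: (is_derive_chart_energy (rs k) cL LD rho0).
Qed.

End EnergyDerivative.

Lemma integral_sum_compact (R : realType) (C : set (R * R)) (I : Type) (r : seq I)
    (f : I -> R * R -> R) : compact C -> (forall l, {within C, continuous (f l)}) ->
  \int[@lebesgue2 R]_(x in C) \sum_(l <- r) f l x = \sum_(l <- r) \int[@lebesgue2 R]_(x in C) f l x.
Proof.
move=> cC fC; have int l := continuous_compact_integrable2 cC (fC l).
suff [_ //] : (@lebesgue2 R).-integrable (C : set (measurableTypeR R * measurableTypeR R))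
    (EFin \o (fun x => \sum_(l <- r) f l x)) /\
  \int[@lebesgue2 R]_(x in C) \sum_(l <- r) f l x = \sum_(l <- r) \int[@lebesgue2 R]_(x in C) f l x.
have mC := compact_measurable2 cC.
elim: r => [|l r [IH1 IH2]].
  have -> : (fun x => \sum_(l <- [::]) f l x) = cst 0 by apply/funext => x; rewrite big_nil.
  rewrite big_nil; split; last by rewrite Rintegral_cst // mul0r.
  apply: (continuous_compact_integrable2 cC); apply: continuous_subspaceT => z; exact: cvg_cst.
have -> : (fun x => \sum_(l <- l :: r) f l x) = (fun x => f l x + \sum_(l <- r) f l x).
  by apply/funext => x; rewrite big_cons.
rewrite big_cons -IH2; split; last exact: RintegralD.
exact: (integrableD mC (int l) IH1).
Qed.

(** * Vanishing divergence of the stress implies Willmore *)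

Section CriticalPoints.
Context {R : realType} {m : nat}.
Variables (S : oriented_surface R) (Phi : S -> 'rV[R]_m).
Hypothesis hPhi : immersion Phi.
Local Notation T2 := (measurableTypeR R * measurableTypeR R)%type.
Local Notation mu2 := (@lebesgue2 R).
Local Notation X c := (chart_cod (atlas c)).
Local Notation Dom c := (chart_dom (atlas c)).
Local Notation Div c := (divergence (in_chart c Phi) (stress (in_chart c Phi))).

Lemma energy_flux_eq0 (U : set (R * R)) (F W : R * R -> 'rV[R]_m) j x :
  open U -> U x -> (forall y, U y -> W y = 0) -> energy_flux F W j x = 0.
Proof.
move=> oU Ux W0; have W1 i : pderiv i W x = 0 := etrans (eq_on_derive (basis2 i) oU Ux W0)
  (derive_cst _ _ _).
have d0 (u : 'rV[R]_m) : dot u 0 = 0 by rewrite dotC dot0l.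
have g0 : grad F W j x = 0 by rewrite /grad big1 // => k _; rewrite W1 scaler0.
by rewrite /energy_flux g0 (W0 x Ux) d0 dot0l addr0 mulr0.
Qed.

(** The flux of [W] is supported in [N], which lies in one chart, so its Euclidean divergence has
    integral zero. *)
Lemma chart_variation_integral c (W : S -> 'rV[R]_m) (N : set S) :
  smooth W -> compact N -> N `<=` Dom c -> (forall p, ~ N p -> W p = 0) ->
  \int[mu2]_(x in to_coord (atlas c) @` N) chart_variation Phi c W x =
  - \int[mu2]_(x in to_coord (atlas c) @` N)
      (volume_density (in_chart c Phi) x * dot (in_chart c W x) (Div c x)).
Proof.
move=> Ws cN ND W0; set C := to_coord (atlas c) @` N.
have cC : compact C := compact_to_coord cN ND.
have CX : C `<=` X c by move=> x /(to_coord_imageP ND) [].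
have oX := @chart_cod_open R S (atlas c).
pose F := in_chart c Phi; pose G := in_chart c W.
have FX : smooth_on (X c) F := hPhi.1 c.
have Fi := hPhi.2 c.
have GX : smooth_on (X c) G := Ws c.
have fluxX j : smooth_on (X c) (energy_flux F G j) := smooth_energy_flux oX FX Fi j GX.
have flux0 j x : X c x -> ~ C x -> energy_flux F G j x = 0.
  move=> Xx Cx; have Nx : ~ N (of_coord (atlas c) x).
    by move=> Nx; apply: Cx; exact: (to_coord_image ND Xx Nx).
  apply: (energy_flux_eq0 F j (open_chart_preimage (c := c) (surface_compact_open cN)) (conj Xx
    Nx)) => y [_ Ny].
  exact: W0.
have wc (f : R * R -> R) : smooth_on (X c) f -> {within C, continuous f}.
  move=> fX; apply: continuous_in_subspaceT => x; rewrite inE => Cx.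
  exact: (smooth_on_continuous fX (CX x Cx)).
have sX j := smooth_on_pderiv j (fluxX j).
have i0 : \int[mu2]_(x in C) (\sum_(j < 2) pderiv j (energy_flux F G j) x) = 0.
  refine (etrans (integral_sum_compact _ cC (fun j => wc _ (sX j))) _).
  apply: big1 => j _; exact: (integral_pderiv_compact oX cC CX (fluxX j) (flux0 j)).
pose h x := volume_density F x * dot (G x) (Div c x).
have hX : smooth_on (X c) h.
  exact: (smooth_onM oX (smooth_volume_density oX FX Fi) (smooth_on_dot oX GX (smooth_div_stress
    oX FX Fi))).
have E : \int[mu2]_(x in C) chart_variation Phi c W x =
    \int[mu2]_(x in C) (\sum_(j < 2) pderiv j (energy_flux F G j) x - h x).
  apply: eq_Rintegral => x; rewrite inE => /CX Xx.
  exact: (energy_variation_divergence oX FX GX Fi Xx).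
have mC := compact_measurable2 cC.
have int f (fX : smooth_on (X c) f) := continuous_compact_integrable2 cC (wc f fX).
have sub := RintegralB mC (int _ (smooth_on_sum _ oX sX)) (int _ hX).
refine (etrans E (etrans (sub _) _)).
have e0 (u v : R) : u = 0 -> u - v = - v by move=> ->; rewrite sub0r.
exact: (e0 _ _ i0).
Qed.

End CriticalPoints.

Section WillmoreSufficient.
Context {R : realType} {m : nat}.
Variables (S : oriented_surface R) (Phi : S -> 'rV[R]_m).
Hypothesis hPhi : immersion Phi.
Local Notation T2 := (measurableTypeR R * measurableTypeR R)%type.
Local Notation mu2 := (@lebesgue2 R).
Local Notation X c := (chart_cod (atlas c)).
Local Notation Dom c := (chart_dom (atlas c)).
Local Notation Div c := (divergence (in_chart c Phi) (stress (in_chart c Phi))).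

Lemma willmore_of_div_stress : (forall c x, X c x -> Div c x = 0) -> willmore Phi.
Proof.
move=> hT V K n c rho Vs cK V0 hrho.
have D := is_derive_willmore_energy hPhi Vs cK V0 hrho.
have [rs _ rL r1] := hrho.
have [L HL] := boolp.choice rL.
(* The weights play two roles: as [rho l] they cut the field into pieces, and as [rho k] they weight
   the chart integrals. This leads to a double sum over [k] and [l]. *)
pose W l p := rho l p *: V p; pose M l := L l `&` K.
have Ws l : smooth (W l).
  move=> d; exact: (smooth_on_scale (@chart_cod_open R S (atlas d)) (rs l d) (Vs d)).
have cM l : compact (M l).
  by have [cL _ _] := HL l; apply: compact_closedI cL (compact_closed (@points_hausdorff R S) cK).
have MD l : M l `<=` Dom (c l) by have [_ LD _] := HL l; move=> p [/LD].
have W0 l p : ~ M l p -> W l p = 0.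
  move=> Mp; have [Kp|Kp] := pselect (K p); last by rewrite /W V0 // scaler0.
  by have [_ _ rho0] := HL l; rewrite /W rho0 ?scale0r // => Lp; apply: Mp.
have VW : V = fun p => \sum_(l < n) W l p.
  apply/funext => p; rewrite /W -scaler_suml.
  have [Kp|Kp] := pselect (K p); first by rewrite r1 // scale1r.
  by rewrite V0 // scaler0.
pose I k d (w : S -> 'rV[R]_m) : R :=
  \int[mu2]_x (((fun x => in_chart d (rho k) x * chart_variation Phi d w x) \_ (X d)) x).
have cont k d w (N : set S) : smooth w -> compact N -> N `<=` Dom d ->
    {within to_coord (atlas d) @` N, continuous (fun x => in_chart d (rho k) x * chart_variation
      Phi d w x)}.
  move=> ws cN ND; apply: continuous_in_subspaceT => x; rewrite inE => /(to_coord_imageP ND) [Xx _].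
  exact: (cvgM (smooth_on_continuous (rs k d) Xx)
    (smooth_on_continuous (smooth_chart_variation hPhi (c := d) ws) Xx)).
have split k : I k (c k) V = \sum_(l < n) I k (c k) (W l).
  have J w : (forall p, ~ K p -> w p = 0) -> I k (c k) w =
      \int[mu2]_(x in to_coord (atlas (c k)) @` M k) (in_chart (c k) (rho k) x * chart_variation
        Phi (c k) w x).
    move=> w0; refine (@chart_integral_compact _ _ _ Phi (c k) w (rho k) K (M k) cK w0 (MD k) _)
      => p _ Kp Mp.
    by have [_ _ rho0] := HL k; apply: rho0 => Lp; exact: (Mp (conj Lp Kp)).
  have WK l p : ~ K p -> W l p = 0 by move=> Kp; rewrite /W V0 // scaler0.
  have JS : \sum_(l < n) I k (c k) (W l) = \sum_(l < n) \int[mu2]_(x in to_coord (atlas (c k)) @`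
    M k)
      (in_chart (c k) (rho k) x * chart_variation Phi (c k) (W l) x).
    by apply: eq_bigr => l _; exact: (J _ (WK l)).
  refine (etrans (J V V0) (etrans _ (esym JS))).
  have cC := compact_to_coord (c := c k) (cM k) (MD k).
  refine (etrans _ (integral_sum_compact _ cC (fun l => cont k (c k) (W l) (M k) (Ws l) (cM k)
    (MD k)))).
  apply: eq_Rintegral => x; rewrite inE => /(to_coord_imageP (MD k)) [Xx _].
  rewrite -mulr_sumr; apply: (f_equal (fun u : R => in_chart (c k) (rho k) x * u)).
  have e := energy_variation_sum (index_enum 'I_n) (in_chart (c k) Phi)
    (@chart_cod_open R S (atlas (c k))) (fun l => Ws l (c k)) Xx.
  refine (etrans _ e); rewrite /chart_variation {1}VW.
  by [].
(* For a fixed piece, all the integrals are taken in the chart of that piece. Its support is in [K],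
   where the weights add up to 1. *)
have vanish l : \sum_(k < n) I k (c l) (W l) = 0.
  have J k : I k (c l) (W l) = \int[mu2]_(x in to_coord (atlas (c l)) @` M l)
      (in_chart (c l) (rho k) x * chart_variation Phi (c l) (W l) x).
    by refine (@chart_integral_compact _ _ _ Phi (c l) (W l) (rho k) (M l) (M l) (cM l) (W0 l)
      (MD l) _).
  refine (etrans (eq_bigr _ (fun k _ => J k)) _).
  have cC := compact_to_coord (c := c l) (cM l) (MD l).
  refine (etrans (esym (integral_sum_compact _ cC (fun k => cont k (c l) (W l) (M l) (Ws l) (cM
    l) (MD l)))) _).
  have E : \int[mu2]_(x in to_coord (atlas (c l)) @` M l)
      (\sum_(k < n) in_chart (c l) (rho k) x * chart_variation Phi (c l) (W l) x) =
    \int[mu2]_(x in to_coord (atlas (c l)) @` M l) chart_variation Phi (c l) (W l) x.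
    apply: eq_Rintegral => x; rewrite inE => /(to_coord_imageP (MD l)) [Xx [_ Kx]].
    by rewrite -mulr_suml r1 // mul1r.
  refine (etrans E (etrans (chart_variation_integral hPhi (Ws l) (cM l) (MD l) (W0 l)) _)).
  have E0 : \int[mu2]_(x in to_coord (atlas (c l)) @` M l)
      (volume_density (in_chart (c l) Phi) x * dot (in_chart (c l) (W l) x) (Div (c l) x)) =
    \int[mu2]_(x in to_coord (atlas (c l)) @` M l) 0.
    apply: eq_Rintegral => x; rewrite inE => /(to_coord_imageP (MD l)) [Xx _].
    by rewrite (hT _ _ Xx) dotC dot0l mulr0.
  by rewrite E0 Rintegral_cst ?mul0r ?oppr0 //; exact: compact_measurable2.
suff E : \sum_(k < n) I k (c k) V = 0 by have [d e] := D; exact: (DeriveDef d (etrans e E)).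
(* After the exchange of the sums, the piece [W l] is moved from the chart [c k] of the weight to
   its own chart [c l]. *)
refine (etrans (eq_bigr _ (fun k _ => split k)) _).
rewrite exchange_big; apply: big1 => l _; refine (etrans _ (vanish l)).
apply: eq_bigr => k _; have [cL LD rho0] := HL k.
exact: (variation_transfer hPhi (Ws l) (rs k) (cM l) (MD l) (W0 l) cL LD rho0).
Qed.

End WillmoreSufficient.

(** * Willmore implies vanishing divergence of the stress *)

Lemma integral_gt0 (R : realType) (C : set (R * R)) (f : R * R -> R) (p : R * R) (r e : R) :
  compact C -> {within C, continuous f} -> (forall x, C x -> 0 <= f x) ->
  0 < r -> csquare p r `<=` C -> 0 < e -> (forall x, csquare p r x -> e <= f x) ->
  0 < \int[@lebesgue2 R]_(x in C) f x.
Proof.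
move=> cC fC f0 r0 pC e0 ef.
have mC := compact_measurable2 cC.
have cp := compact_csquare (p := p) (r := r); have mp := compact_measurable2 cp.
pose g : R * R -> R := cst e \_ (csquare p r).
have E : \int[@lebesgue2 R]_(x in C) g x = e * ((2 * r) * (2 * r)).
  have E1 : \int[@lebesgue2 R]_(x in C) g x = \int[@lebesgue2 R]_x g x.
    apply: integral_support => x; have [px|px] := pselect (csquare p r x); first by move=> _;
      exact: pC.
    by rewrite [g x]restrict_out // eqxx.
  refine (etrans E1 (etrans (esym (Rintegral_mkcond _ _ _)) (etrans (Rintegral_cst _ mp e) _))).
  by rewrite [X in fine X](csquare_measure p r0).
apply: (@lt_le_trans _ _ (e * ((2 * r) * (2 * r)))); first by rewrite !mulr_gt0.
rewrite -E; apply: le_Rintegral => //.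
- apply: (@integrableS _ _ _ _ setT) => //.
  rewrite -restrict_EFin; apply: (integrable_mkcond _ mp).1.
  by apply: (continuous_compact_integrable2 cp); apply: continuous_subspaceT => z; exact: cvg_cst.
- exact: continuous_compact_integrable2.
move=> x Cx; have [px|px] := pselect (csquare p r x).
  by rewrite [g x]restrict_in //; exact: ef.
by rewrite [g x]restrict_out //; exact: f0.
Qed.

Section WillmoreNecessary.
Context {R : realType}.
Variable S : oriented_surface R.
Local Notation X c := (chart_cod (atlas c)).
Local Notation Dom c := (chart_dom (atlas c)).
Implicit Types c d : atlas_index S.

Definition chart_extend c (f : R * R -> R) (p : S) : R :=
  if `[< Dom c p >] then f (to_coord (atlas c) p) else 0.

Lemma chart_extend_in c f x : X c x -> in_chart c (chart_extend c f) x = f x.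
Proof.
move=> Xx; rewrite /in_chart /chart_extend /= asboolT ?of_coordK //.
exact: of_coord_dom.
Qed.

Section Extension.
Variables (c : atlas_index S) (f : R * R -> R) (Q : set (R * R)).
Hypotheses (fX : smooth_on (X c) f) (cQ : compact Q) (QX : Q `<=` X c).
Hypothesis f0 : forall x, X c x -> ~ Q x -> f x = 0.

Lemma chart_extend_out p : ~ (of_coord (atlas c) @` Q) p -> chart_extend c f p = 0.
Proof.
move=> Qp; rewrite /chart_extend; case: asboolP => // Dp.
apply: f0; first exact: to_coord_cod.
by move=> H; apply: Qp; exists (to_coord (atlas c) p) => //; rewrite to_coordK.
Qed.

(** Another chart is covered by its overlap with [c] and by the complement of the compact image of
    [Q], which is open because the surface is Hausdorff. *)
Lemma smooth_chart_extend : smooth (chart_extend c f).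
Proof.
move=> d; pose A := transition_dom (atlas d) (atlas c).
pose B := X d `&` of_coord (atlas d) @^-1` (~` (of_coord (atlas c) @` Q)).
have oA : open A := @transition_dom_open R S d c.
have oB : open B by apply: open_chart_preimage; apply: surface_compact_open;
  exact: compact_of_coord.
have [aA bA] := smooth_on_components oA (@transition_smooth R S d c).
have hA : smooth_on A (in_chart d (chart_extend c f)).
  have AX x : A x -> X c ((transition (atlas d) (atlas c) x).1, (transition (atlas d) (atlas c)
    x).2).
    by move=> /transition_cod [Xx _]; rewrite -surjective_pairing.
  apply: (smooth_on_eq oA _ (smooth_on_comp oA (@chart_cod_open R S (atlas c)) AX fX aA bA)) => x
    Ax.
  rewrite -surjective_pairing (in_chart_transition _ Ax) chart_extend_in //.
  by have [] := transition_cod Ax.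
have hB : smooth_on B (in_chart d (chart_extend c f)).
  by apply: (smooth_on_eq oB _ (smooth_on_cst 0 oB)) => x [_ Bx];
    rewrite /in_chart /= chart_extend_out.
apply: (smooth_on_sub _ (smooth_on_bigcup hA hB)) => x Xx.
have [Bx|Bx] := pselect ((of_coord (atlas c) @` Q) (of_coord (atlas d) x)); last by right.
left; split => //; have [y Qy e] := Bx; rewrite /= -e; exact: of_coord_dom (QX Qy).
Qed.

End Extension.

Variables (m : nat) (Phi : S -> 'rV[R]_m).
Hypothesis hPhi : immersion Phi.
Local Notation Div c := (divergence (in_chart c Phi) (stress (in_chart c Phi))).

Lemma div_stress_of_willmore c x0 : willmore Phi -> X c x0 -> Div c x0 = 0.
Proof.
move=> hW Xx0; apply: contrapT => D0; set D := Div c x0 in D0.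
have oX := @chart_cod_open R S (atlas c).
pose F := in_chart c Phi.
have FX : smooth_on (X c) F := hPhi.1 c.
have Fi := hPhi.2 c.
have dX := smooth_div_stress oX FX Fi.
have vX := smooth_volume_density oX FX Fi.
(* The integrand for the constant field [D], up to sign. At [x0] it is the volume density times the
   square of [D]. *)
pose u x := volume_density F x * dot D (Div c x).
have uX : smooth_on (X c) u.
  exact: (smooth_onM oX vX (smooth_on_dot oX (smooth_on_mx_cst D oX) dX)).
have u0 : 0 < u x0.
  apply: mulr_gt0; first by rewrite volume_densityE sqrtr_gt0; exact: (chart_det_gt0 hPhi Xx0).
  by rewrite lt_neqAle dot_ge0 andbT eq_sym; apply/eqP => /dot_eq0.
pose e := u x0 / 2.
have e0 : 0 < e by rewrite divr_gt0.
have eu : e < u x0 by rewrite ltr_pdivrMr // ltr_pMr // ltr1n.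
have [r0 r00 Hr0] : exists2 r0 : R, 0 < r0 & forall x, ball x0 r0 x -> X c x /\ e < u x.
  have h1 := open_nbhs_nbhs (conj oX Xx0).
  have h2 : \forall x \near x0, e < u x by exact: (cvgr_gt _ (smooth_on_continuous uX Xx0) _ eu).
  have : \forall x \near x0, X c x /\ e < u x by apply: filterS2 h1 h2.
  by move=> /nbhs_ballP [r /= r_0 H]; exists r.
(* Room for three nested squares in the ball of radius [r0]: the field is full on radius [r] and
   supported in [2 * r]; the weight is 1 on [2 * r] and supported in [4 * r]. *)
pose r := r0 / 8.
have r_gt0 : 0 < r by rewrite divr_gt0.
have sq k x : csquare x0 k x -> k < r0 -> ball x0 r0 x.
  by move=> [h1 h2] kr; apply/ball_pairP; rewrite (le_lt_trans h1 kr) (le_lt_trans h2 kr).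
have ball_sq k x : ball x0 k x -> csquare x0 k x by move=> /ball_pairP [/ltW ? /ltW ?].
pose Q2 := csquare x0 (2 * r); pose Q4 := csquare x0 (2 * (2 * r)).
have rr : r < 2 * r by rewrite ltr_pMl // ltr1n.
have r2 : 2 * r < r0 by rewrite /r; lra.
have r4 : 2 * (2 * r) < r0 by rewrite /r; lra.
have Q2X : Q2 `<=` X c by move=> x xQ; have [] := Hr0 x (sq _ _ xQ r2).
have Q4X : Q4 `<=` X c by move=> x xQ; have [] := Hr0 x (sq _ _ xQ r4).
have cQ2 : compact Q2 by exact: compact_csquare.
have cQ4 : compact Q4 by exact: compact_csquare.
have p2 x : X c x -> ~ Q2 x -> plateau x0 r x = 0.
  by move=> _ xQ; apply: plateau_eq0 => // /ball_sq.
have r2_gt0 : 0 < 2 * r by rewrite mulr_gt0.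
have p4 x : X c x -> ~ Q4 x -> plateau x0 (2 * r) x = 0.
  by move=> _ xQ; apply: plateau_eq0 => // /ball_sq.
pose f := chart_extend c (plateau x0 r); pose rho := chart_extend c (plateau x0 (2 * r)).
have fs : smooth f := smooth_chart_extend (smooth_plateau x0 r oX) cQ2 Q2X p2.
have rs : smooth rho := smooth_chart_extend (smooth_plateau x0 (2 * r) oX) cQ4 Q4X p4.
pose V p := f p *: D.
have Vs : smooth V.
  move=> d; have oXd := @chart_cod_open R S (atlas d).
  exact: (smooth_on_scale oXd (fs d) (smooth_on_mx_cst D oXd)).
pose K := of_coord (atlas c) @` Q2.
have cK : compact K := compact_of_coord cQ2 Q2X.
have KD : K `<=` Dom c by move=> p [x Qx <-]; exact: of_coord_dom (Q2X x Qx).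
have V0 p : ~ K p -> V p = 0.
  by move=> Kp; rewrite /V /f (chart_extend_out p2 Kp) scale0r.
have CQ : to_coord (atlas c) @` K = Q2.
  apply/seteqP; split=> [_ [_ [x Qx <-] <-]|x Qx]; first by rewrite of_coordK //; exact: Q2X.
  by exists (of_coord (atlas c) x); [exists x|rewrite of_coordK //; exact: Q2X].
have rho1 x : Q2 x -> in_chart c rho x = 1.
  by move=> Qx; rewrite (chart_extend_in _ (Q2X x Qx)) plateau_eq1.
have hrho : @partition_of_unity R S K 1 (fun=> c) (fun=> rho).
  split=> [_|_ p|_|p [x Qx <-]].
  - exact: rs.
  - by rewrite /rho /chart_extend; case: ifP => // _; exact: plateau_ge0.
  - exists (of_coord (atlas c) @` Q4); split.
    + exact: compact_of_coord.
    + by move=> p [x Qx <-]; exact: of_coord_dom (Q4X x Qx).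
    + by move=> p Qp; exact: (chart_extend_out p4 Qp).
  - by rewrite big_ord1; exact: (rho1 x Qx).
(* Criticality and the variation formula give two values of the same derivative, here for a
   partition of unity with a single function. *)
have [_ E0] := hW V K 1 (fun=> c) (fun=> rho) Vs cK V0 hrho.
have [_ E1] := is_derive_willmore_energy hPhi Vs cK V0 hrho.
have {E0 E1} E := etrans (esym E1) E0; rewrite big_ord1 in E.
have I1 := @chart_integral_compact _ _ _ Phi c V rho K K cK V0 KD (fun p _ Kp nKp => False_ind _
  (nKp Kp)).
have I2 := etrans (esym I1) E.
have I3 : \int[@lebesgue2 R]_(x in to_coord (atlas c) @` K) chart_variation Phi c V x = 0.
  refine (etrans _ I2); apply: eq_Rintegral => x; rewrite inE CQ => Qx.
  by rewrite rho1 // mul1r.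
have I4 := etrans (esym (chart_variation_integral hPhi Vs cK KD V0)) I3.
rewrite CQ in I4; move/eqP: I4; rewrite oppr_eq0 => /eqP I4.
pose g x := plateau x0 r x * u x.
have gX : smooth_on (X c) g := smooth_onM oX (smooth_plateau x0 r oX) uX.
have gI : \int[@lebesgue2 R]_(x in Q2) g x = 0.
  refine (etrans _ I4); apply: eq_Rintegral => x; rewrite inE => Qx.
  have VE : in_chart c V x = plateau x0 r x *: D.
    exact: (f_equal (fun a : R => a *: D) (chart_extend_in _ (Q2X x Qx))).
  by rewrite VE dotZl /g /u mulrCA.
have gc : {within Q2, continuous g}.
  apply: continuous_in_subspaceT => x; rewrite inE => Qx.
  exact: (smooth_on_continuous gX (Q2X x Qx)).
have : 0 < \int[@lebesgue2 R]_(x in Q2) g x.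
  apply: (integral_gt0 (p := x0) (r := r) (e := e) cQ2 gc _ r_gt0 _ e0) => [x Qx|x [h1 h2]|x xr].
  - have [_ ux] := Hr0 x (sq _ _ Qx r2).
    exact: (mulr_ge0 (plateau_ge0 _ _ _) (ltW (lt_trans e0 ux))).
  - exact: (conj (le_trans h1 (ltW rr)) (le_trans h2 (ltW rr))).
  - have [_ ux] := Hr0 x (sq _ _ xr (lt_trans rr r2)).
    have eg : g x = u x by rewrite /g (plateau_eq1 r_gt0 xr) mul1r.
    by rewrite eg ltW.
by rewrite gI ltxx.
Qed.

End WillmoreNecessary.

Theorem theorem2 (R : realType) (m : nat) (hm : (3 <= m)%N)
    (S : oriented_surface R) (Phi : S -> 'rV[R]_m) (hPhi : immersion Phi) :
  (forall (c : atlas_index S) (x : R * R), chart_cod (atlas c) x ->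
     let F := in_chart c Phi in
     let W := willmore_vector F in
     let H := mean_curvature F in
     let T := stress F in
     [/\ divergence F T x = - W x,
         divergence F (fun j y => wedge (T j y) (F y) + wedge (H y) (grad F F j y)) x
           = - wedge (W x) (F x)
       & divergence F (fun j y => dot (T j y) (F y)) x = - dot (W x) (F x)]) /\
  (willmore Phi <->
   forall (c : atlas_index S) (x : R * R), chart_cod (atlas c) x ->
     let F := in_chart c Phi in
     let H := mean_curvature F in
     divergence F
       (fun j y => grad F H j y - 2 *: normal_proj F y (grad F H j y)
                   + dot (H y) (H y) *: grad F F j y) x = 0).
Proof.
split=> [c x Xx F W H T|].
  have [law1 law2 law3] :=
    conservation_laws (@chart_cod_open R S (atlas c)) (hPhi.1 c) (hPhi.2 c) Xx.
  split; first exact: law1.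
  - refine (etrans law2 (etrans (f_equal (wedge^~ (F x)) law1) _)); exact: wedgeNl.
  - refine (etrans law3 (etrans (f_equal (dot^~ (F x)) law1) _)); exact: dotNl.
split=> [hW c x Xx F H|hT]; first exact: (div_stress_of_willmore hPhi hW Xx).
exact: (willmore_of_div_stress hPhi hT).
Qed.
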